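(* Let $1<p<\infty$ and $\frac1p+\frac1{p'}=1$. Let ${\bf u}_n=(u_n^1,u_n^2)$ and ${\bf v}_n=(v_n^1,v_n^2)$ be vector valued sequences converging to zero weakly in $L^p(\mathbb{R}^2)$ and $L^{p'}(\mathbb{R}^2)$, respectively. Assume that the sequence $(\operatorname{div}{\bf u}_n)=(\partial_xu_n^1+\partial_yu_n^2)$ is bounded in $L^p(\mathbb{R}^2)$, and that the sequence $(\operatorname{curl}{\bf v}_n)=(\partial_yv_n^1-\partial_xv_n^2)$ is bounded in $L^{p'}(\mathbb{R}^2)$. Then the sequence $(u_n^1v_n^1+u_n^2v_n^2)$ converges to zero in the sense of distributions on $\mathbb{R}^2$ (or vaguely in the sense of Radon measures).
   Context: Points of $\mathbb{R}^2$ are written $(x,y)$; derivatives are taken in the sense of distributions. *)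

(* Defs.v *)
(* Mathematical Components + MathComp-Analysis. *)
From HB Require Import structures.
From mathcomp Require Import all_boot all_order all_algebra.
From mathcomp Require Import all_classical all_reals all_analysis.

Set Implicit Arguments.
Unset Strict Implicit.
Unset Printing Implicit Defensive.

Import Order.TTheory GRing.Theory Num.Theory.
Import numFieldNormedType.Exports.

Local Open Scope classical_set_scope.
Local Open Scope ring_scope.

Definition leb2 (R : realType) :
    {measure set (measurableTypeR R * measurableTypeR R) -> \bar R} :=
  (@lebesgue_measure R \x @lebesgue_measure R)%E.

Section PlaneFunctions.
Context {R : realType}.
Implicit Types (p : R) (f phi : R * R -> R).

(* Elements of L^p(R^2) are represented by Borel functions; almost-everywhere
   equal representatives are not identified. *)
Definition in_Lp p f : bool := f \in Lfun (leb2 R) p%:E.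

Definition Lp_norm p f : \bar R := Lnorm (leb2 R) p%:E (EFin \o f).

Definition dx phi : R * R -> R := fun z => 'D_((1, 0) : R * R) phi z.
Definition dy phi : R * R -> R := fun z => 'D_((0, 1) : R * R) phi z.

Fixpoint Ck (k : nat) phi : Prop :=
  continuous phi /\
  if k is k'.+1 then
    [/\ forall z, derivable phi z ((1, 0) : R * R),
        forall z, derivable phi z ((0, 1) : R * R),
        Ck k' (dx phi) & Ck k' (dy phi)]
  else True.

Definition smooth phi : Prop := forall k, Ck k phi.

Definition compactly_supported phi : Prop :=
  compact (closure [set z | phi z != 0]).

Definition test_function phi : Prop := smooth phi /\ compactly_supported phi.

(* Membership in the topological dual of L^p(R^2).  The boundedness condition
   makes l independent of the representative; the values of l outside L^p are
   irrelevant. *)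
Definition Lp_dual p (l : (R * R -> R) -> R) : Prop :=
  (forall (a : R) f g, in_Lp p f -> in_Lp p g ->
     l (fun z => a * f z + g z) = a * l f + l g) /\
  exists C : R, forall f, in_Lp p f ->
    ((`|l f|)%:E <= C%:E * Lp_norm p f)%E.

Definition weak_cvg0 p (f : nat -> R * R -> R) : Prop :=
  (forall n, in_Lp p (f n)) /\
  forall l, Lp_dual p l -> (fun n => l (f n)) @ \oo --> (0 : R).

Definition weak_cvg0_vec p (u : nat -> R * R -> R * R) : Prop :=
  weak_cvg0 p (fun n z => (u n z).1) /\ weak_cvg0 p (fun n z => (u n z).2).

(* A functional whose values are meaningful on test functions only, except in
   [vague_cvg0], where it is evaluated on continuous compactly supported
   functions.  All the functionals used here come from locally integrable
   functions through [of_fun] and [distr_dx], [distr_dy]. *)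
Definition distr : Type := (R * R -> R) -> R.

Definition of_fun f : distr := fun phi => \int[leb2 R]_z (f z * phi z).

Definition distr_dx (T : distr) : distr := fun phi => - T (dx phi).
Definition distr_dy (T : distr) : distr := fun phi => - T (dy phi).

Definition distr_eq (S T : distr) : Prop :=
  forall phi, test_function phi -> S phi = T phi.

Definition distr_div (u : R * R -> R * R) : distr := fun phi =>
  distr_dx (of_fun (fun z => (u z).1)) phi +
  distr_dy (of_fun (fun z => (u z).2)) phi.

Definition distr_curl (v : R * R -> R * R) : distr := fun phi =>
  distr_dy (of_fun (fun z => (v z).1)) phi -
  distr_dx (of_fun (fun z => (v z).2)) phi.

Definition bounded_in_Lp p (T : nat -> distr) : Prop :=
  exists (M : R) (g : nat -> R * R -> R), forall n,
    [/\ in_Lp p (g n), (Lp_norm p (g n) <= M%:E)%E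
      & distr_eq (T n) (of_fun (g n))].

Definition distr_cvg0 (T : nat -> distr) : Prop :=
  forall phi, test_function phi -> (fun n => T n phi) @ \oo --> (0 : R).

Definition vague_cvg0 (T : nat -> distr) : Prop :=
  forall phi, continuous phi -> compactly_supported phi ->
    (fun n => T n phi) @ \oo --> (0 : R).

End PlaneFunctions.

Arguments distr R : clear implicits.

(* Main.v *)
(** Let rho_s(x, y) = m_s(x) m_s(y), where m_s = H_s' and H_s is a smooth step
    from 0 to 1 on [0, s].  Then rho_s - rho_e = (m_s - m_e) (x) m_s
    + m_e (x) (m_s - m_e) with m_s - m_e = (H_s - H_e)', so testing the curl
    equation on tensor kernels gives, for s <= e,
      v * rho_s - v * rho_e = grad W + G,
    where W and G are convolutions of v and of curl v with kernels of L^1 norm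
    O(e).  Integrating grad W by parts against u, whose divergence is bounded,
    yields |\int u . (v * rho_s - v * rho_e) phi| <= C e uniformly in n and in s.
    For fixed n, \int u . (v - v * rho_s) phi tends to 0 with s (Lebesgue points
    in the mean); for fixed e, v_n * rho_e tends to 0 pointwise and boundedly,
    because v_n does so weakly.  The norms of a weakly convergent sequence are
    bounded by a gliding hump argument, and continuous test functions are
    uniform limits of smooth ones. *)

Require Import Defs.
From HB Require Import structures.
From mathcomp Require Import all_boot all_order all_algebra.
From mathcomp Require Import all_classical all_reals all_analysis measurable_realfun ring lra.
Import Order.TTheory GRing.Theory Num.Theory.
Import numFieldNormedType.Exports.
Set Implicit Arguments.
Unset Strict Implicit.
Unset Printing Implicit Defensive.
Local Open Scope classical_set_scope.
Local Open Scope ring_scope.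

(** * Integration over the plane *)

(** Weak convergence makes the mollified [v n] small only at a fixed scale e, while [v n] is close
    to its mollification only at a scale s that depends on n; neither tool works at both scales. The
    curl and divergence bounds bridge the gap from s to e with a constant free of s, so that s may
    be chosen after n. A Helmholtz decomposition would need the L^p theory of singular integrals;
    comparing two mollifications yields an explicit potential W with smooth kernels instead, and the
    Schur test is the only operator bound used. The derivatives of W are not controlled as s
    decreases: they occur both in the difference of the mollifications and in the product rule for W
    phi, and cancel. Neither H_s nor H_e has compact support, but their difference has, and this is
    what makes the tensor kernels admissible in the curl equation. Young's inequality is used
    without its constants; where smallness is needed, the two factors are first rescaled by t and
    1/t. *)

Section PlaneMeasure.
Variable R : realType.
Local Notation T2 := (measurableTypeR R * measurableTypeR R)%type.

Lemma leb2_setX (A B : set (measurableTypeR R)) :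
  measurable A -> measurable B ->
  leb2 R (A `*` B) = (lebesgue_measure A * lebesgue_measure B)%E.
Proof. by move=> mA mB; exact: product_measure1E. Qed.

Lemma leb2_sigma_finite : sigma_finite setT (leb2 R).
Proof.
have /sigma_finiteP[F [TF ndF Foo]] := sigma_finiteT (@lebesgue_measure R).
exists (fun n => F n `*` F n).
  rewrite -setXTT TF predeqE => -[x y]; split.
    move=> [/= [n _ Fnx] [k _ Fky]]; exists (maxn n k) => //; split.
    - by move: x Fnx; exact/subsetPset/ndF/leq_maxl.
    - by move: y Fky; exact/subsetPset/ndF/leq_maxr.
  by move=> [n _ []/= ? ?]; split; exists n.
move=> k; have [? ?] := Foo k.
by split; [exact: measurableX|rewrite leb2_setX// lte_mul_pinfty// ge0_fin_numE].
Qed.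

(* The library provides no sigma-finite instance for the product of two
   sigma-finite measures, whence this copy of [leb2 R]. *)
Let lebp : set T2 -> \bar R := leb2 R.
HB.instance Definition _ := Measure.on lebp.
HB.instance Definition _ :=
  Measure_isSigmaFinite.Build _ _ _ lebp leb2_sigma_finite.

Lemma leb2_tonelli (f : T2 * T2 -> \bar R) :
  measurable_fun setT f -> (forall x, 0 <= f x)%E ->
  (\int[leb2 R]_z \int[leb2 R]_w f (z, w) =
   \int[leb2 R]_w \int[leb2 R]_z f (z, w))%E.
Proof. by move=> mf f0; exact: (@fubini_tonelli _ _ _ _ _ lebp lebp). Qed.

Lemma leb2_measurable_section (f : T2 * T2 -> \bar R) :
  measurable_fun setT f -> (forall x, 0 <= f x)%E ->
  measurable_fun setT (fun z => \int[leb2 R]_w f (z, w))%E.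
Proof.
by move=> mf f0; exact: (@measurable_fun_fubini_tonelli_F _ _ _ _ _ lebp).
Qed.

(** The indicator of [-r, r], common majorant of all one-variable kernels below. *)
Definition bump (r s : R) : R := (`|s| <= r)%R%:R.

Lemma bump_ge0 r s : 0 <= bump r s. Proof. by rewrite /bump ler0n. Qed.

Lemma bump_le1 r s : bump r s <= 1.
Proof. by rewrite /bump lern1 leq_b1. Qed.

Lemma bumpBC r s t : bump r (s - t) = bump r (t - s).
Proof. by rewrite /bump distrC. Qed.

Lemma measurable_bump r : measurable_fun setT (bump r).
Proof.
have -> : bump r = \1_(`[- r, r]%classic : set R).
  by apply/funext => s; rewrite /bump indicE mem_setE in_itv/= ler_norml.
exact: measurable_indic.
Qed.

Lemma integral_bump2 (r r' : R) (z : T2) : 0 <= r -> 0 <= r' ->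
  (\int[leb2 R]_w (bump r (z.1 - w.1) * bump r' (z.2 - w.2))%:E)%E =
  (4 * r * r')%:E.
Proof.
move=> r0 r'0.
pose A := `[z.1 - r, z.1 + r]%classic : set (measurableTypeR R).
pose B := `[z.2 - r', z.2 + r']%classic : set (measurableTypeR R).
under eq_integral => w _.
  rewrite (_ : _ * _ = \1_(A `*` B) w); last first.
    rewrite /bump indicE -natrM mulnb; congr ((nat_of_bool _)%:R).
    by rewrite in_setX /A /B !mem_setE !in_itv/= !ler_distlC.
  over.
have mA : measurable A by exact: measurable_itv.
have mB : measurable B by exact: measurable_itv.
rewrite integral_indic//; last exact: measurableX.
rewrite setIT leb2_setX//= /A /B !lebesgue_measure_itv/= !lte_fin.
(* The length formula branches on strict order of the endpoints; at t = 0 both branches give 0. *)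
have h (c t : R) : 0 <= t ->
    (if (c - t < c + t)%R then (c + t)%:E - (c - t)%:E else 0)%E = (2 * t)%:E.
  rewrite le_eqVlt => /predU1P[<-|t0]; first by rewrite subr0 addr0 ltxx mulr0.
  by rewrite ltrBlDr -addrA ltrDl addr_gt0// -EFinB; congr EFin; ring.
by rewrite !h// -EFinM; congr EFin; ring.
Qed.

End PlaneMeasure.

(** * Convolution with tensor kernels and the Schur test *)

Section Convolution.
Variable R : realType.
Local Notation T2 := (measurableTypeR R * measurableTypeR R)%type.
Local Notation mu := (leb2 R).
Implicit Types (p q r : R) (f U V : T2 -> R) (a b : R -> R).

(** The p-th power of the norm. Young's inequality bounds pairings by sums of such powers, which
    keeps roots out of the estimates. *)
Definition Lp_pow p f := (\int[leb2 R]_z (`|f z| `^ p)%:E)%E.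

Lemma Lp_pow_ge0 p f : (0 <= Lp_pow p f)%E.
Proof. by apply: integral_ge0 => z _; rewrite lee_fin powR_ge0. Qed.

Lemma measurable_normp p f : measurable_fun setT f ->
  measurable_fun setT (fun z => `|f z| `^ p).
Proof.
move=> mf; apply: (@measurableT_comp _ _ _ _ _ _ (fun x : R => x `^ p)) => //.
exact: measurableT_comp.
Qed.

Lemma Lp_normE p f : Lp_norm p f = (Lp_pow p f `^ p^-1)%E.
Proof. by rewrite /Lp_norm unlock. Qed.

Lemma in_LpP p f : 0 < p ->
  in_Lp p f <-> measurable_fun setT f /\ (Lp_pow p f < +oo)%E.
Proof.
move=> p0; split.
  rewrite /in_Lp inE => /andP[]; rewrite inE/= => mf.
  rewrite inE/= /finite_norm => fin; split => //.
  have := fin; rewrite -/(Lp_norm p f) Lp_normE.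
  rewrite !ltey; apply: contra => /eqP/(@eqy_poweR _ _ p^-1).
  by rewrite invr_gt0 => /(_ p0) <-.
move=> [mf fin]; rewrite /in_Lp inE; apply/andP; split; rewrite inE//=.
rewrite /finite_norm -/(Lp_norm p f) Lp_normE.
by rewrite poweR_lty.
Qed.

Lemma conjugate_gt1 p q : 1 < p -> p^-1 + q^-1 = 1 -> 1 < q.
Proof.
move=> p1 pq; have p0 : 0 < p by exact: lt_trans p1.
have qV : 0 < q^-1 by rewrite -(ltrD2l p^-1) pq addr0 invf_lt1.
have q0 : 0 < q by rewrite -invr_gt0.
by rewrite -invf_lt1// -pq ltrDr invr_gt0.
Qed.

(** Young's inequality with the factors 1/p and 1/q, both at most 1, dropped. *)
Lemma young p q (x y : R) : 1 < p -> p^-1 + q^-1 = 1 -> 0 <= x -> 0 <= y ->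
  x * y <= x `^ p + y `^ q.
Proof.
move=> p1 pq x0 y0.
have p0 : 0 < p by exact: lt_trans p1.
have qV : 0 < q^-1 by rewrite -(ltrD2l p^-1) pq addr0 invf_lt1.
have q0 : 0 < q by rewrite -invr_gt0.
apply: (le_trans (conjugate_powR x0 y0 p0 q0 pq)).
have pV : 0 < p^-1 by rewrite invr_gt0.
apply: lerD; apply: ler_piMr; rewrite ?powR_ge0//; lra.
Qed.

Lemma measurable_kernel a b :
  measurable_fun setT a -> measurable_fun setT b ->
  measurable_fun setT (fun zw : T2 * T2 =>
    a (zw.1.1 - zw.2.1) * b (zw.1.2 - zw.2.2)).
Proof.
move=> ma mb.
have m11 : measurable_fun setT (fun zw : T2 * T2 => zw.1.1).
  exact: (measurableT_comp measurable_fst measurable_fst).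
have m12 : measurable_fun setT (fun zw : T2 * T2 => zw.1.2).
  exact: (measurableT_comp measurable_snd measurable_fst).
have m21 : measurable_fun setT (fun zw : T2 * T2 => zw.2.1).
  exact: (measurableT_comp measurable_fst measurable_snd).
have m22 : measurable_fun setT (fun zw : T2 * T2 => zw.2.2).
  exact: (measurableT_comp measurable_snd measurable_snd).
apply: measurable_funM.
  apply: (measurableT_comp ma); exact: measurable_funB.
apply: (measurableT_comp mb); exact: measurable_funB.
Qed.

Lemma measurable_kernel_r a b (z : T2) :
  measurable_fun setT a -> measurable_fun setT b ->
  measurable_fun setT (fun w : T2 => a (z.1 - w.1) * b (z.2 - w.2)).
Proof.
move=> ma mb.
exact: (measurableT_comp (measurable_kernel ma mb) (measurable_pair1 z)).
Qed.

(** Schur test: Young's inequality separates [U] from [V], and the box kernel has integral 4 r r' in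
    each variable when the other is fixed. *)
Lemma schur p q (r r' : R) U V : 1 < p -> p^-1 + q^-1 = 1 ->
  0 <= r -> 0 <= r' ->
  measurable_fun setT U -> measurable_fun setT V ->
  (\int[mu]_z \int[mu]_w (`|U z| * `|V w| *
     (bump r (z.1 - w.1) * bump r' (z.2 - w.2)))%:E <=
   (4 * r * r')%:E * (Lp_pow p U + Lp_pow q V))%E.
Proof.
move=> p1 pq r0 r'0 mU mV.
pose K (z w : T2) := bump r (z.1 - w.1) * bump r' (z.2 - w.2).
have mK : measurable_fun setT (fun zw : T2 * T2 => K zw.1 zw.2).
  by apply: measurable_kernel; exact: measurable_bump.
have K0 z w : 0 <= K z w by rewrite mulr_ge0// bump_ge0.
have mU1 : measurable_fun setT (fun zw : T2 * T2 => `|U zw.1| `^ p).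
  exact: (measurableT_comp (measurable_normp p mU) measurable_fst).
have mV2 : measurable_fun setT (fun zw : T2 * T2 => `|V zw.2| `^ q).
  exact: (measurableT_comp (measurable_normp q mV) measurable_snd).
have mAU : measurable_fun setT (fun zw : T2 * T2 => `|U zw.1|).
  by apply: measurableT_comp => //; exact: (measurableT_comp mU measurable_fst).
have mAV : measurable_fun setT (fun zw : T2 * T2 => `|V zw.2|).
  by apply: measurableT_comp => //; exact: (measurableT_comp mV measurable_snd).
pose FU (zw : T2 * T2) := `|U zw.1| `^ p * K zw.1 zw.2.
pose FV (zw : T2 * T2) := `|V zw.2| `^ q * K zw.1 zw.2.
pose F (zw : T2 * T2) := `|U zw.1| * `|V zw.2| * K zw.1 zw.2.
have mFU : measurable_fun setT (EFin \o FU).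
  by apply/measurable_EFinP; exact: measurable_funM.
have mFV : measurable_fun setT (EFin \o FV).
  by apply/measurable_EFinP; exact: measurable_funM.
have mF : measurable_fun setT (EFin \o F).
  by apply/measurable_EFinP; apply: measurable_funM => //; exact: measurable_funM.
have FU0 x : (0 <= (EFin \o FU) x)%E by rewrite lee_fin mulr_ge0// powR_ge0.
have FV0 x : (0 <= (EFin \o FV) x)%E by rewrite lee_fin mulr_ge0// powR_ge0.
have F0 x : (0 <= (EFin \o F) x)%E by rewrite lee_fin !mulr_ge0.
have sec (G : T2 * T2 -> R) z : measurable_fun setT (EFin \o G) ->
   measurable_fun setT (fun w => (G (z, w))%:E).
  by move=> h; exact: (measurableT_comp h (measurable_pair1 z)).
apply: (@le_trans _ _ (\int[mu]_z (\int[mu]_w (FU (z, w))%:E +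
     \int[mu]_w (FV (z, w))%:E))%E).
  apply: ge0_le_integral => //.
  - by move=> z _; apply: integral_ge0 => w _; exact: (F0 (z, w)).
  - exact: (leb2_measurable_section mF F0).
  - apply: emeasurable_funD.
      exact: (leb2_measurable_section mFU FU0).
    exact: (leb2_measurable_section mFV FV0).
  - move=> z _; rewrite -ge0_integralD//; last 4 first.
    + by move=> w _; exact: (FU0 (z, w)).
    + exact: sec.
    + by move=> w _; exact: (FV0 (z, w)).
    + exact: sec.
    apply: ge0_le_integral => //.
    + by move=> w _; exact: (F0 (z, w)).
    + exact: (sec F z mF).
    + by apply: emeasurable_funD; exact: sec.
    + move=> w _; rewrite -EFinD lee_fin /F /FU /FV /= -mulrDl ler_wpM2r ?mulr_ge0 ?bump_ge0//.
      exact: young.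
rewrite ge0_integralD//; last 4 first.
- by move=> z _; apply: integral_ge0 => w _; exact: (FU0 (z, w)).
- exact: (leb2_measurable_section mFU FU0).
- by move=> z _; apply: integral_ge0 => w _; exact: (FV0 (z, w)).
- exact: (leb2_measurable_section mFV FV0).
(* The term in [V] is integrated in z first, so that the kernel is again integrated alone. *)
rewrite [X in (_ + X)%E](leb2_tonelli mFV FV0).
have mIp s f : measurable_fun setT f -> measurable_fun setT (fun z => (`|f z| `^ s)%:E).
  by move=> mf; apply/measurable_EFinP; exact: measurable_normp.
have c0 : 0 <= 4 * r * r' by rewrite !mulr_ge0.
have intK s f : measurable_fun setT f ->
   (\int[mu]_z \int[mu]_w (`|f z| `^ s * K z w)%:E = (4 * r * r')%:E * Lp_pow s f)%E.
  move=> mf.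
  transitivity (\int[mu]_z ((4 * r * r')%:E * (`|f z| `^ s)%:E))%E; last first.
    rewrite ge0_integralZl//; first exact: mIp.
  apply: eq_integral => z _.
  under eq_integral do rewrite EFinM.
  have mKz : measurable_fun setT (EFin \o K z).
    apply/measurable_EFinP.
    exact: (measurable_kernel_r z (measurable_bump r) (measurable_bump r')).
  rewrite ge0_integralZl//; last by move=> w _; rewrite lee_fin mulr_ge0// bump_ge0.
  by rewrite integral_bump2// muleC.
rewrite /FU /FV /= intK//.
(* The kernel is symmetric because [bump] is even. *)
have -> : (\int[mu]_w \int[mu]_z (`|V w| `^ q * K z w)%:E =
    \int[mu]_w \int[mu]_z (`|V w| `^ q * K w z)%:E)%E.
  apply: eq_integral => w _; apply: eq_integral => z _.
  by rewrite /K bumpBC (bumpBC r').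
by rewrite intK// [leRHS]ge0_muleDr ?Lp_pow_ge0.
Qed.

(** Height and support in a single inequality: the kernel a(x) b(y) of two boxed functions then has
    L^1 norm at most A B (4 r r'). *)
Definition boxed (A r : R) a : Prop :=
  measurable_fun setT a /\ forall s, `|a s| <= A * bump r s.

Lemma Lp_pow_kernel p (A r B r' : R) a b (z : T2) : 0 < p -> 0 <= r -> 0 <= r' ->
  boxed A r a -> boxed B r' b ->
  (Lp_pow p (fun w : T2 => a (z.1 - w.1) * b (z.2 - w.2))%R <=
    ((`|A| * `|B|) `^ p * (4 * r * r'))%:E)%E.
Proof.
move=> p0 r0 r'0 [ma Ha] [mb Hb].
have mk := measurable_kernel_r z ma mb.
pose K (w : T2) := bump r (z.1 - w.1) * bump r' (z.2 - w.2).
have mKz : measurable_fun setT (EFin \o K).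
  apply/measurable_EFinP.
  exact: (measurable_kernel_r z (measurable_bump r) (measurable_bump r')).
apply: (@le_trans _ _ (\int[mu]_w (((`|A| * `|B|) `^ p)%:E * (K w)%:E)))%E; last first.
  rewrite ge0_integralZl ?lee_fin ?powR_ge0//; last first.
    by move=> w _; rewrite lee_fin mulr_ge0// bump_ge0.
  by rewrite integral_bump2// -EFinM.
apply: ge0_le_integral => //.
- by apply/measurable_EFinP; exact: measurable_normp.
- exact: measurable_funeM.
- move=> w _; rewrite -EFinM lee_fin.
  (* The box kernel takes only the values 0 and 1, and 0 to the power p is 0 since p is positive. *)
  have KK : K w = K w `^ p.
    rewrite /K /bump -natrM mulnb; case: (_ && _); rewrite ?powR1//.
    by rewrite powR0// gt_eqF.
  rewrite KK -powRM ?mulr_ge0 ?bump_ge0//.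
  apply: ge0_ler_powR; rewrite ?nnegrE ?mulr_ge0 ?bump_ge0//; first exact: ltW.
  rewrite normrM (mulrACA `|A|); apply: ler_pM => //.
    by apply: (le_trans (Ha _)); rewrite ler_wpM2r ?bump_ge0// ler_norm.
  by apply: (le_trans (Hb _)); rewrite ler_wpM2r ?bump_ge0// ler_norm.
Qed.

Lemma in_Lp_kernel p (A r B r' : R) a b (z : T2) : 0 < p -> 0 <= r -> 0 <= r' ->
  boxed A r a -> boxed B r' b ->
  in_Lp p (fun w : T2 => a (z.1 - w.1) * b (z.2 - w.2)).
Proof.
move=> p0 r0 r'0 Ha Hb; apply/(in_LpP _ p0); split.
  by have [ma _] := Ha; have [mb _] := Hb; exact: measurable_kernel_r.
exact: le_lt_trans (Lp_pow_kernel z p0 r0 r'0 Ha Hb) (ltry _).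
Qed.

Lemma le_integral_mul p q U V : 1 < p -> p^-1 + q^-1 = 1 ->
  measurable_fun setT U -> measurable_fun setT V ->
  (\int[mu]_z `|(U z * V z)%:E| <= Lp_pow p U + Lp_pow q V)%E.
Proof.
move=> p1 pq mU mV.
have mp := measurable_normp p mU.
have mq := measurable_normp q mV.
rewrite /Lp_pow -ge0_integralD//; last 2 first.
- exact/measurable_EFinP.
- exact/measurable_EFinP.
apply: ge0_le_integral => //.
- by apply: measurableT_comp => //; apply/measurable_EFinP; exact: measurable_funM.
- by apply: emeasurable_funD; exact/measurable_EFinP.
- by move=> z _; rewrite -EFinD lee_fin normrM; exact: young.
Qed.

Lemma integrable_mul p q U V : 1 < p -> p^-1 + q^-1 = 1 ->
  in_Lp p U -> in_Lp q V -> mu.-integrable setT (fun z => (U z * V z)%:E).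
Proof.
move=> p1 pq LU LV.
have p0 : 0 < p by exact: lt_trans p1.
have q0 : 0 < q by apply: lt_trans (conjugate_gt1 p1 pq).
have [mU fU] := (in_LpP _ p0).1 LU; have [mV fV] := (in_LpP _ q0).1 LV.
apply/integrableP; split; first by apply/measurable_EFinP; exact: measurable_funM.
apply: (le_lt_trans (le_integral_mul p1 pq mU mV)).
exact: (lte_add_pinfty fU fV).
Qed.

(** Only tensor kernels occur: an x-derivative falls on [a] and a y-derivative on [b], so calculus
    of one variable is enough for the kernels. *)
Definition conv f a b (z : T2) : R :=
  \int[mu]_w (f w * (a (z.1 - w.1) * b (z.2 - w.2))).

Lemma integrable_conv q (A r B r' : R) f a b z : 1 < q -> 0 <= r -> 0 <= r' ->
  in_Lp q f -> boxed A r a -> boxed B r' b ->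
  mu.-integrable setT (fun w => (f w * (a (z.1 - w.1) * b (z.2 - w.2)))%:E).
Proof.
move=> q1 r0 r'0 Lf Ha Hb.
(* The exponent conjugate to q, in which the bounded, compactly supported kernel is tested. *)
pose p := (1 - q^-1)^-1.
have q0 : 0 < q by exact: lt_trans q1.
have qp : q^-1 + p^-1 = 1 by rewrite /p invrK addrC subrK.
have p1 := conjugate_gt1 q1 qp.
apply: (integrable_mul q1 qp Lf).
exact: (in_Lp_kernel z (lt_trans ltr01 p1) r0 r'0 Ha Hb).
Qed.

(** The real integral is the finite part of a difference of two nonnegative integrals, each
    measurable in z by Tonelli. *)
Lemma measurable_conv f a b : measurable_fun setT f ->
  measurable_fun setT a -> measurable_fun setT b ->
  measurable_fun setT (conv f a b).
Proof.
move=> mf ma mb.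
pose F (zw : T2 * T2) := (f zw.2 * (a (zw.1.1 - zw.2.1) * b (zw.1.2 - zw.2.2)))%:E.
have mF : measurable_fun setT F.
  apply/measurable_EFinP; apply: measurable_funM; last exact: measurable_kernel.
  exact: (measurableT_comp mf measurable_snd).
have -> : conv f a b = fine \o (fun z => \int[mu]_w F^\+ (z, w) - \int[mu]_w F^\- (z, w))%E.
  apply/funext => z; rewrite /conv /Rintegral integralE /=.
  by congr (fine (_ - _)); apply: eq_integral => w _; rewrite ?funeposE ?funenegE.
apply: measurableT_comp => //; apply: emeasurable_funB.
  exact: leb2_measurable_section (measurable_funepos mF) (funepos_ge0 F).
exact: leb2_measurable_section (measurable_funeneg mF) (funeneg_ge0 F).
Qed.

(** The kernel is dominated by A B times a box, to which the Schur test applies. The factor A B (4 r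
    r') is what later becomes O(e). *)
Lemma conv_pair p q (A B r r' : R) U V a b : 1 < p -> p^-1 + q^-1 = 1 ->
  0 <= A -> 0 <= B -> 0 <= r -> 0 <= r' -> boxed A r a -> boxed B r' b ->
  in_Lp p U -> in_Lp q V ->
  (\int[mu]_z `|(U z * conv V a b z)%:E| <=
     (A * B * (4 * r * r'))%:E * (Lp_pow p U + Lp_pow q V))%E.
Proof.
move=> p1 pq A0 B0 r0 r'0 Ha Hb LU LV.
have q1 := conjugate_gt1 p1 pq.
have p0 : 0 < p by exact: lt_trans p1.
have q0 : 0 < q by exact: lt_trans q1.
have [mU fU] := (in_LpP _ p0).1 LU; have [mV fV] := (in_LpP _ q0).1 LV.
have [ma Ha'] := Ha; have [mb Hb'] := Hb.
pose F (zw : T2 * T2) := (`|U zw.1| * `|V zw.2| *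
     (bump r (zw.1.1 - zw.2.1) * bump r' (zw.1.2 - zw.2.2)))%:E.
have F0 x : (0 <= F x)%E by rewrite lee_fin !mulr_ge0// bump_ge0.
have mF : measurable_fun setT F.
  apply/measurable_EFinP; apply: measurable_funM; last first.
    by apply: measurable_kernel; exact: measurable_bump.
  apply: measurable_funM.
    by apply: measurableT_comp => //; exact: (measurableT_comp mU measurable_fst).
  by apply: measurableT_comp => //; exact: (measurableT_comp mV measurable_snd).
have mFz z : measurable_fun setT (fun w => F (z, w)).
  exact: (measurableT_comp mF (measurable_pair1 z)).
rewrite EFinM -muleA.
apply: (le_trans _ (lee_wpmul2l _ (schur p1 pq r0 r'0 mU mV))); last first.
  by rewrite lee_fin mulr_ge0.
rewrite -ge0_integralZl//; last 3 first.
- exact: (leb2_measurable_section mF F0).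
- by move=> z _; apply: integral_ge0 => w _; exact: (F0 (z, w)).
- by rewrite lee_fin mulr_ge0.
apply: ge0_le_integral => //.
- apply: measurableT_comp => //; apply/measurable_EFinP; apply: measurable_funM => //.
  exact: measurable_conv.
- by apply: measurable_funeM; exact: (leb2_measurable_section mF F0).
move=> z _.
have ic := integrable_conv z q1 r0 r'0 LV Ha Hb.
rewrite -ge0_integralZl//; last 3 first.
- exact: mFz.
- by move=> w _; exact: (F0 (z, w)).
- by rewrite lee_fin mulr_ge0.
have [mc _] := (integrableP _ _ _ ic).
rewrite EFinM abseM [X in (_ * X)%E](_ : _ =
    `|\int[mu]_w (V w * (a (z.1 - w.1) * b (z.2 - w.2)))%:E|)%E; last first.
  exact: EFin_normr_Rintegral.
apply: (le_trans (lee_wpmul2l _ (le_abse_integral _ _ mc))) => //.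
rewrite -ge0_integralZl//; last exact: measurableT_comp.
apply: ge0_le_integral => //.
- by apply: measurable_funeM; exact: measurableT_comp.
- by apply: measurable_funeM; exact: mFz.
move=> w _; rewrite /F /= -!EFinM lee_fin.
set k1 := bump _ _; set k2 := bump _ _.
have -> : A * B * (`|U z| * `|V w| * (k1 * k2)) =
  `|U z| * (`|V w| * ((A * k1) * (B * k2))) by ring.
rewrite !normrM; do 2 apply: ler_wpM2l => //.
by apply: ler_pM.
Qed.

End Convolution.

(** * Pairings against bounded weights *)

Section Pairing.
Variable R : realType.
Local Notation T2 := (measurableTypeR R * measurableTypeR R)%type.
Local Notation mu := (leb2 R).
Implicit Types (p q r : R) (f U V psi : T2 -> R) (a b : R -> R).

Lemma integrable_le f (M : R) : measurable_fun setT f ->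
  (\int[mu]_z `|(f z)%:E| <= M%:E)%E -> mu.-integrable setT (EFin \o f).
Proof.
move=> mf fM; apply/integrableP; split; first exact/measurable_EFinP.
by apply: (le_lt_trans fM); rewrite ltry.
Qed.

Lemma normr_Rintegral_le f (M : R) : measurable_fun setT f ->
  (\int[mu]_z `|(f z)%:E| <= M%:E)%E -> `|\int[mu]_z f z| <= M.
Proof.
move=> mf fM; have fi := integrable_le mf fM.
rewrite -lee_fin EFin_normr_Rintegral//; apply: (le_trans _ fM).
by apply: le_abse_integral => //; exact/measurable_EFinP.
Qed.

Lemma le_integral_weight f psi (M : R) : measurable_fun setT f ->
  measurable_fun setT psi -> (forall z, `|psi z| <= M) ->
  (\int[mu]_z `|(f z * psi z)%:E| <= M%:E * \int[mu]_z `|(f z)%:E|)%E.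
Proof.
move=> mf mpsi psiM.
have M0 : 0 <= M by exact: (le_trans _ (psiM (0, 0))).
rewrite -ge0_integralZl//; last first.
  by apply: measurableT_comp => //; exact/measurable_EFinP.
apply: ge0_le_integral => //.
- by apply: measurableT_comp => //; apply/measurable_EFinP; exact: measurable_funM.
- apply: measurable_funeM; apply: measurableT_comp => //; exact/measurable_EFinP.
- by move=> z _; rewrite /= -EFinM lee_fin normrM mulrC ler_wpM2r.
Qed.

Lemma in_Lp_measurable p f : 0 < p -> in_Lp p f -> measurable_fun setT f.
Proof. by move=> p0 /(in_LpP _ p0)[]. Qed.

Section Bound.
Variables (p q A B r r' M C D : R) (a b : R -> R) (U V psi : T2 -> R).
Hypotheses (p1 : 1 < p) (pq : p^-1 + q^-1 = 1).
Hypotheses (A0 : 0 <= A) (B0 : 0 <= B) (r0 : 0 <= r) (r'0 : 0 <= r').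
Hypotheses (Ha : boxed A r a) (Hb : boxed B r' b).
Hypotheses (LU : in_Lp p U) (LV : in_Lp q V).
Hypotheses (mpsi : measurable_fun setT psi) (psiM : forall z, `|psi z| <= M).
Hypotheses (UC : (Lp_pow p U <= C%:E)%E) (VD : (Lp_pow q V <= D%:E)%E).

Let p0 : 0 < p := lt_trans ltr01 p1.
Let q0 : 0 < q := lt_trans ltr01 (conjugate_gt1 p1 pq).
Let mU := in_Lp_measurable p0 LU.
Let mV := in_Lp_measurable q0 LV.
Let M0 : 0 <= M := le_trans (normr_ge0 _) (psiM (0, 0)).

Let mc : measurable_fun setT (conv V a b).
Proof. by apply: measurable_conv => //; [case: Ha|case: Hb]. Qed.

Lemma le_integral_conv : (\int[mu]_z `|(U z * conv V a b z * psi z)%:E| <=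
  (M * (A * B * (4 * r * r')) * (C + D))%:E)%E.
Proof.
apply: (le_trans (le_integral_weight _ mpsi psiM)).
  exact: measurable_funM.
rewrite -mulrA EFinM; apply: lee_wpmul2l; first by rewrite lee_fin.
apply: (le_trans (conv_pair p1 pq A0 B0 r0 r'0 Ha Hb LU LV)).
rewrite [leRHS]EFinM; apply: lee_wpmul2l; first by rewrite lee_fin !mulr_ge0.
by rewrite EFinD; apply: leeD.
Qed.

Let m : measurable_fun setT (fun z => U z * conv V a b z * psi z).
Proof. by apply: measurable_funM => //; exact: measurable_funM. Qed.

Lemma integrable_conv_mul :
  mu.-integrable setT (fun z => (U z * conv V a b z * psi z)%:E).
Proof. exact: (integrable_le m le_integral_conv). Qed.

Lemma normr_conv_mul : `|\int[mu]_z (U z * conv V a b z * psi z)| <=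
  M * (A * B * (4 * r * r')) * (C + D).
Proof. exact: (normr_Rintegral_le m le_integral_conv). Qed.

End Bound.

End Pairing.

(** * Smooth functions of one variable *)

Section Smooth1.
Variable R : realType.
Implicit Types (f g : R -> R) (k : nat).

(** The derivative is a witness rather than [derive1 f], so that closed formulas can be supplied in
    inductions on k. *)
Fixpoint Ck1 k f : Prop :=
  if k is k'.+1 then
    exists2 g, (forall x, is_derive x (1 : R) f (g x)) & Ck1 k' g
  else continuous f.

Lemma is_derive_continuous f g :
  (forall x, is_derive x (1 : R) f (g x)) -> continuous f.
Proof.
move=> fg x; apply: differentiable_continuous.
by apply/derivable1_diffP; have [] := fg x.
Qed.

Lemma Ck1_pred k f : Ck1 k.+1 f -> Ck1 k f.
Proof.
elim: k f => [f [g fg _]|k IHk f [g fg cg]]; first exact: is_derive_continuous fg.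
by exists g => //; exact: IHk.
Qed.

Lemma Ck1_cst k (c : R) : Ck1 k (cst c).
Proof.
elim: k c => [c|k IHk c]; first exact: cst_continuous.
by exists (cst 0) => // x; exact: is_derive_cst.
Qed.

Lemma Ck1D k f g : Ck1 k f -> Ck1 k g -> Ck1 k (fun x => f x + g x).
Proof.
elim: k f g => [f g cf cg x|k IHk f g [f' ff' cf'] [g' gg' cg']].
  by apply: continuousD; [exact: cf|exact: cg].
exists (fun x => f' x + g' x); last exact: IHk.
by move=> x; exact: is_deriveD.
Qed.

Lemma Ck1M k f g : Ck1 k f -> Ck1 k g -> Ck1 k (fun x => f x * g x).
Proof.
elim: k f g => [f g cf cg x|k IHk f g].
  by apply: continuousM; [exact: cf|exact: cg].
move=> Cf Cg; have cf := Ck1_pred Cf; have cg := Ck1_pred Cg.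
move: Cf Cg => [f' ff' cf'] [g' gg' cg'].
exists (fun x => f x * g' x + g x * f' x); last by apply: Ck1D; exact: IHk.
by move=> x; exact: is_deriveM.
Qed.

Lemma Ck1N k f : Ck1 k f -> Ck1 k (fun x => - f x).
Proof.
move=> cf; have := Ck1M (Ck1_cst k (-1)) cf.
by rewrite (_ : (fun x => _) = (fun x => - f x))//; apply/funext => x; rewrite mulN1r.
Qed.

Lemma Ck1_inv k f : (forall x, f x != 0) -> Ck1 k f -> Ck1 k (fun x => (f x)^-1).
Proof.
move=> f0; elim: k => [cf x|k IHk Cf].
  by apply: continuousV => //; exact: cf.
(* The derivative of 1/f contains 1/f again, one order lower, where the induction hypothesis
   applies. *)
have cV := IHk (Ck1_pred Cf).
move: Cf => [f' ff' cf'].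
exists (fun x => - (f' x * ((f x)^-1 * (f x)^-1))); last first.
  by apply: Ck1N; apply: Ck1M => //; exact: Ck1M.
move=> x; have [df <-] := ff' x.
apply: DeriveDef; first exact: derivableV.
rewrite deriveV// /GRing.scale/= expr2 invfM mulNr; congr (- _); exact: mulrC.
Qed.

Lemma is_derive_affine (c d x : R) :
  is_derive x (1 : R) (fun x : R => c * x + d) c.
Proof.
have h : is_derive x (1 : R) ((fun x => c *: x) + cst d) (c *: 1 + 0).
  by apply: is_deriveD; exact: is_deriveZ.
by move: h; rewrite addr0 /GRing.scale/= mulr1.
Qed.

Lemma Ck1_affine k f (c d : R) : Ck1 k f -> Ck1 k (fun x => f (c * x + d)).
Proof.
elim: k f => [f cf x|k IHk f [f' ff' cf']].
  apply: (@continuous_comp _ _ _ (fun x : R => c * x + d) f); last exact: cf.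
  exact: (is_derive_continuous (is_derive_affine c d)).
exists (fun x => f' (c * x + d) * c); last first.
  by apply: Ck1M; [exact: IHk|exact: Ck1_cst].
move=> x; apply: (@is_derive1_comp _ f (fun x : R => c * x + d)).
exact: is_derive_affine.
Qed.

(* The span of the functions [P(1/x) exp(-1/x)] on [x > 0] is stable under
   differentiation, which makes all of them smooth at 0. *)
Definition efun (P : {poly R}) (x : R) : R :=
  if 0 < x then P.[x^-1] * expR (- x^-1) else 0.

(** With y = 1/x, the exponential series gives exp y at least y^(n+2)/(n+2)!. The two extra powers
    of y become x^2, enough for a zero derivative at 0. *)
Lemma expRN_decay n (x : R) : 0 < x ->
  x^-1 ^+ n * expR (- x^-1) <= (n.+2)`!%:R * x ^+ 2.
Proof.
move=> x0; have y0 : 0 < x^-1 by rewrite invr_gt0.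
have := expR_ge1Dxn n.+1 (ltW y0); set E := expR _ => hE.
have E0 : 0 < E by exact: expR_gt0.
have f0 : 0 < (n.+2)`!%:R :> R by rewrite ltr0n fact_gt0.
have hE' : x^-1 ^+ n.+2 <= (n.+2)`!%:R * E.
  by rewrite mulrC -ler_pdivrMr//; apply: le_trans hE; rewrite lerDr.
have -> : x^-1 ^+ n = x^-1 ^+ n.+2 * x ^+ 2.
  by rewrite -addn2 exprD -mulrA -exprMn mulVf ?gt_eqF// expr1n mulr1.
rewrite expRN -/E mulrAC ler_wpM2r ?sqr_ge0//.
by rewrite ler_pdivrMr.
Qed.

Lemma efun_bound P : exists2 C : R, 0 <= C & forall x, `|efun P x| <= C * x ^+ 2.
Proof.
exists (\sum_(i < size P) `|P`_i| * (i.+2)`!%:R).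
  by apply: sumr_ge0 => i _; rewrite mulr_ge0// ler0n.
move=> x; rewrite /efun; case: ifPn => [x0|_]; last first.
  rewrite normr0 mulr_ge0// ?sqr_ge0//.
  by apply: sumr_ge0 => i _; rewrite mulr_ge0// ler0n.
rewrite horner_coef mulr_suml (le_trans (ler_norm_sum _ _ _))// mulr_suml.
apply: ler_sum => i _; rewrite -!mulrA normrM ler_wpM2l//.
rewrite ger0_norm ?expRN_decay// mulr_ge0 ?expR_ge0// exprn_ge0// invr_ge0.
exact: ltW.
Qed.

(** With y = 1/x one has y' = - y^2, and differentiating P(y) exp(-y) produces the polynomial X^2 (P
    - P'). *)
Lemma is_derive_efun P x :
  is_derive x (1 : R) (efun P) (efun ('X^2 * (P - P^`())) x).
Proof.
have [x0|x0|->] := ltgtP x 0.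
- have -> : efun ('X^2 * (P - P^`())) x = 0 by rewrite /efun ltNge (ltW x0).
  apply: (near_eq_is_derive _ (is_derive_cst (0 : R) x 1)).
  near=> y; rewrite /efun ltNge (_ : y <= 0)//=; apply/ltW.
  by near: y; exact: lt_nbhsl.
- have -> : efun ('X^2 * (P - P^`())) x =
      ('X^2 * (P - P^`())).[x^-1] * expR (- x^-1) by rewrite /efun x0.
  have xn0 : x != 0 by rewrite gt_eqF.
  have dV : is_derive x (1 : R) (fun y : R => y^-1) (- x ^- 2).
    have := @is_deriveV R (@id R) x 1 1 xn0 (is_derive_id _ _).
    by rewrite /GRing.scale/= mulr1.
  have dP : is_derive x (1 : R) (horner P \o (fun y : R => y^-1)) ((P^`()).[x^-1] * - x ^- 2).
    exact: is_derive1_comp.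
  have dE : is_derive x (1 : R) (expR \o (-%R \o (fun y : R => y^-1)))
     (expR (- x^-1) * x ^- 2).
    apply: is_derive1_comp; have := is_deriveN dV; by rewrite opprK.
  apply: (near_eq_is_derive (f := (horner P \o (fun y : R => y^-1)) *
    (expR \o (-%R \o (fun y : R => y^-1))))).
    near=> y; rewrite /efun (_ : 0 < y)//; near: y; exact: lt_nbhsr.
  apply: (is_derive_eq (is_deriveM dP dE)).
  rewrite /= /GRing.scale/= hornerM hornerXn hornerD hornerN exprVn; ring.
- have -> : efun ('X^2 * (P - P^`())) 0 = 0 by rewrite /efun ltxx.
  have [C C0 HC] := efun_bound P.
  have E0 : efun P 0 = 0 by rewrite /efun ltxx.
  (* By the quadratic bound the difference quotient at 0 is at most C |h|. *)
  have lim0 : h^-1 *: ((efun P \o shift 0) (h *: (1:R)) - efun P 0) @[h --> 0^'] --> (0 : R).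
    apply/cvgr0Pnorm_le => e e0; near=> h.
    have h0 : h != 0 by near: h; exact: nbhs_dnbhs_neq.
    rewrite E0 subr0 /GRing.scale/= addr0 mulr1 normrM normfV.
    rewrite ler_pdivrMl ?normr_gt0//; apply: (le_trans (HC h)).
    have hlt : `|h| < e / (C + 1).
      by near: h; apply: dnbhs0_lt; rewrite divr_gt0// ltr_wpDl.
    rewrite -real_normK ?num_real// expr2 mulrA mulrC ler_wpM2l//.
    apply: (@le_trans _ _ ((C + 1) * `|h|)); first by rewrite ler_wpM2r// lerDl.
    by rewrite mulrC -ler_pdivlMr ?ltr_wpDl// ltW.
  apply: DeriveDef; first by apply/cvg_ex; exists 0.
  exact/cvg_lim.
Unshelve. all: by end_near. Qed.

Lemma smooth_efun P k : Ck1 k (efun P).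
Proof.
elim: k P => [|k IHk] P.
  exact: (is_derive_continuous (is_derive_efun P)).
by exists (efun ('X^2 * (P - P^`()))) => //; exact: is_derive_efun.
Qed.

End Smooth1.

(** * Test functions of one variable and their Taylor bounds *)

Section Smooth1Compact.
Variable R : realType.
Implicit Types (f g a : R -> R) (k : nat).

Definition smooth1 f : Prop := forall k, Ck1 k f.

(** Each order k comes with its own witness for the derivative; by uniqueness all of them equal
    [derive1 f]. *)
Lemma smooth1_derive f : smooth1 f ->
  (forall x, is_derive x (1 : R) f ((derive1 f) x)) /\ smooth1 (derive1 f).
Proof.
move=> sf.
have E k : exists2 g, (forall x, is_derive x (1 : R) f (g x)) & Ck1 k g := sf k.+1.
have U g : (forall x, is_derive x (1 : R) f (g x)) -> g = (derive1 f).
  by move=> h; apply/funext => x; rewrite derive1E; have [_ ->] := h x.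
split=> [x|k].
  by have [g gf cg] := E 0%N; rewrite -(U g)//; exact: gf.
by have [g gf cg] := E k; rewrite -(U g).
Qed.

Lemma smooth1_continuous f : smooth1 f -> continuous f.
Proof. by move=> sf; exact: (sf 0%N). Qed.

Lemma smooth1D f g : smooth1 f -> smooth1 g -> smooth1 (fun x => f x + g x).
Proof. by move=> sf sg k; exact: Ck1D. Qed.

Lemma smooth1M f g : smooth1 f -> smooth1 g -> smooth1 (fun x => f x * g x).
Proof. by move=> sf sg k; exact: Ck1M. Qed.

Lemma smooth1N f : smooth1 f -> smooth1 (fun x => - f x).
Proof. by move=> sf k; exact: Ck1N. Qed.

Lemma smooth1_affine f (c d : R) : smooth1 f -> smooth1 (fun x => f (c * x + d)).
Proof. by move=> sf k; exact: Ck1_affine. Qed.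

Definition test1 f : Prop :=
  smooth1 f /\ exists2 r, 0 <= r & forall s, r < `|s| -> f s = 0.

Lemma derive1_locally_zero f r s : (forall s, r < `|s| -> f s = 0) ->
  r < `|s| -> (derive1 f) s = 0.
Proof.
move=> f0 rs; rewrite derive1E.
rewrite (@near_eq_derive _ _ _ f (cst 0)) ?derive_cst ?oner_eq0//.
near=> t; apply: f0; near: t.
have : (fun t : R => `|t|) @ s --> `|s| by exact: norm_continuous.
by move/cvgr_gt; apply.
Unshelve. all: by end_near. Qed.

Lemma test1_derive f : test1 f -> test1 (derive1 f).
Proof.
move=> [sf [r r0 fr]]; split; first by have [] := smooth1_derive sf.
by exists r => // s; exact: derive1_locally_zero.
Qed.

Lemma measurable_smooth1 f : smooth1 f -> measurable_fun setT f.
Proof. by move=> sf; apply: continuous_measurable_fun; exact: (smooth1_continuous sf). Qed.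

Lemma continuous_boxed f r : continuous f -> 0 <= r ->
  (forall s, r < `|s| -> f s = 0) -> exists2 A : R, 0 <= A & boxed A r f.
Proof.
move=> cf r0 fr.
have rr : - r <= r by rewrite (le_trans _ r0)// oppr_le0.
have cn : {within `[- r, r], continuous (fun s => `|f s|)}.
  apply: continuous_subspaceT => x.
  by apply: (@continuous_comp _ _ _ f (fun t : R => `|t|)); [exact: cf|exact: norm_continuous].
have [c _ cM] := EVT_max rr cn.
exists `|f c| => //; split; first exact: continuous_measurable_fun.
move=> s; rewrite /bump; case: (leP `|s| r) => [sr|sr]; last by rewrite fr// normr0 mulr0.
by rewrite mulr1; apply: cM; rewrite in_itv/= -ler_norml.
Qed.

Lemma test1_boxed f : test1 f -> exists A r, [/\ 0 <= A, 0 <= r & boxed A r f].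
Proof.
move=> [sf [r r0 fr]].
have [A A0 HA] := continuous_boxed (smooth1_continuous sf) r0 fr.
by exists A, r.
Qed.

Lemma test1_mvt f (s t : R) : smooth1 f -> exists2 c : R,
  `|c - s| <= `|t| & f (s + t) - f s = t * (derive1 f) c.
Proof.
move=> sf; have [df _] := smooth1_derive sf.
have cf := smooth1_continuous sf.
have [t0|t0] := leP 0 t.
  have st : s <= s + t by rewrite lerDl.
  have [c cst ->] := MVT_segment st (fun x _ => df x) (continuous_subspaceT cf).
  exists c; last by rewrite [s + t]addrC addrK mulrC.
  move: cst; rewrite in_itv/= => /andP[sc ct].
  by rewrite !ger0_norm ?subr_ge0// lerBlDl.
have st : s + t <= s by rewrite gerDl ltW.
have [c cst h] := MVT_segment st (fun x _ => df x) (continuous_subspaceT cf).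
exists c.
  move: cst; rewrite in_itv/= => /andP[sc ct].
  by rewrite (ltr0_norm t0) distrC ger0_norm ?subr_ge0//; lra.
by rewrite -opprB h -mulrN opprB [s + t]addrC addrK mulrC.
Qed.

Lemma bump_le (r r' s : R) : r <= r' -> bump r s <= bump r' s.
Proof.
move=> rr'; rewrite /bump ler_nat; case: (leP `|s| r) => // sr.
by rewrite (le_trans sr rr').
Qed.

Lemma bump_shift (r s t u : R) : `|t - s| <= u -> bump r t <= bump (r + u) s.
Proof.
move=> h; rewrite /bump; case: (leP `|t| r) => // tr.
rewrite (_ : `|s| <= r + u)//.
by rewrite -[s](subrK t) (le_trans (ler_normD _ _))// addrC lerD// distrC.
Qed.

(** The remainders keep a support factor because they are integrated against an L^q function. A
    shift by at most 1 widens the support by at most 1. *)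
Lemma test1_taylor f : test1 f -> exists A r, [/\ 0 <= A, 0 <= r &
  forall s t, `|t| <= 1 ->
    `|f (s + t) - f s| <= `|t| * (A * bump r s) /\
    `|f (s + t) - f s - t * (derive1 f) s| <= t ^+ 2 * (A * bump r s)].
Proof.
move=> ccf; have ccf1 := test1_derive ccf; have ccf2 := test1_derive ccf1.
have [A1 [r1 [A10 r10 [_ H1]]]] := test1_boxed ccf1.
have [A2 [r2 [A20 r20 [_ H2]]]] := test1_boxed ccf2.
pose r := Num.max r1 r2.
have mb ri (B A s c : R) : 0 <= B -> B <= A -> ri <= r -> `|c - s| <= 1 ->
    B * bump ri c <= A * bump (r + 1) s.
  move=> B0 BA rir cs; apply: ler_pM; rewrite ?bump_ge0//.
  by apply: (le_trans (bump_shift _ cs)); apply: bump_le; rewrite lerD2r.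
exists (A1 + A2), (r + 1); split.
- by rewrite addr_ge0.
- by rewrite addr_ge0// le_max r10.
move=> s t t1; split.
  have [c cs ->] := test1_mvt s t ccf.1.
  rewrite normrM ler_wpM2l//; apply: (le_trans (H1 _)).
  apply: mb => //; first by rewrite lerDl.
    by rewrite le_max lexx.
  exact: le_trans t1.
have [c cs ->] := test1_mvt s t ccf.1.
rewrite -mulrBr normrM.
(* A second mean value step, for the derivative between s and the intermediate point c, provides the
   second factor t. *)
have [d ds] := test1_mvt s (c - s) ccf1.1.
rewrite [s + _]addrC subrK => ->.
rewrite normrM -[t ^+ 2]real_normK ?num_real// expr2 -mulrA ler_wpM2l//.
apply: ler_pM => //; apply: (le_trans (H2 _)).
apply: mb => //; first by rewrite lerDr.
  by rewrite le_max lexx orbT.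
exact: le_trans (le_trans ds _) t1.
Qed.

Lemma test1_lipschitz f : test1 f -> exists A r, [/\ 0 <= A, 0 <= r &
  forall s t, `|t| <= 1 -> [/\ `|f s| <= A * bump r s,
    `|f (s + t)| <= A * bump r s & `|f (s + t) - f s| <= `|t| * (A * bump r s)]].
Proof.
move=> ccf.
have [A0 [r0 [A00 r00 [_ H0]]]] := test1_boxed ccf.
have [A1 [r1 [A10 r10 H1]]] := test1_taylor ccf.
exists (A0 + A1), (Num.max r0 r1); split.
- by rewrite addr_ge0.
- by rewrite le_max r00.
move=> s t t1.
have b0 := bump_le s (_ : r0 <= Num.max r0 r1).
have b1 := bump_le s (_ : r1 <= Num.max r0 r1).
have h0 : A0 * bump r0 s <= A0 * bump (Num.max r0 r1) s.
  by rewrite ler_wpM2l// b0// le_max lexx.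
have h1 : A1 * bump r1 s <= A1 * bump (Num.max r0 r1) s.
  by rewrite ler_wpM2l// b1// le_max lexx orbT.
have d : `|f (s + t) - f s| <= `|t| * (A1 * bump (Num.max r0 r1) s).
  by apply: (le_trans (H1 s t t1).1); rewrite ler_wpM2l.
have p0 : 0 <= A0 * bump (Num.max r0 r1) s by rewrite mulr_ge0// bump_ge0.
have p1 : 0 <= A1 * bump (Num.max r0 r1) s by rewrite mulr_ge0// bump_ge0.
rewrite mulrDl; split.
- by apply: (le_trans (H0 s)); apply: (le_trans h0); rewrite lerDl.
- rewrite -[f (s + t)](subrK (f s)) (le_trans (ler_normD _ _))// addrC lerD//.
    exact: le_trans h0.
  by apply: (le_trans d); rewrite ler_piMl.
- by apply: (le_trans d); rewrite ler_wpM2l// lerDr.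
Qed.

End Smooth1Compact.

(** * The smooth step and the mollifier *)

Section Step.
Variable R : realType.
Implicit Types (s e x : R).

(** The function exp(-1/x) on x > 0, extended by 0. *)
Let e1 : R -> R := efun 1.

Let e1_gt0 x : 0 < x -> 0 < e1 x.
Proof. by move=> x0; rewrite /e1 /efun x0 hornerC mul1r expR_gt0. Qed.

Let e1_le0 x : x <= 0 -> e1 x = 0.
Proof. by move=> x0; rewrite /e1 /efun ltNge x0. Qed.

Let e1_ge0 x : 0 <= e1 x.
Proof. by have [/e1_le0 ->//|/e1_gt0/ltW] := leP x 0. Qed.

Let den_gt0 x : 0 < e1 x + e1 (-1 * x + 1).
Proof.
have [x0|x0] := leP x 0; last by rewrite ltr_wpDr// e1_gt0.
by rewrite ltr_wpDl// e1_gt0//; lra.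
Qed.

(** The classical transition function e1(x) / (e1(x) + e1(1 - x)). The argument is written as an
    affine expression to fit [smooth1_affine]; likewise the [+ 0] in [scaled_step]. *)
Definition step x := e1 x * (e1 x + e1 (-1 * x + 1))^-1.

Lemma smooth1_step : smooth1 step.
Proof.
have se : smooth1 e1 by move=> k; exact: smooth_efun.
apply: smooth1M => // k; apply: Ck1_inv; first by move=> x; rewrite gt_eqF.
exact: (smooth1D se (smooth1_affine (-1) 1 se)).
Qed.

Lemma step_le0 x : x <= 0 -> step x = 0.
Proof. by move=> x0; rewrite /step e1_le0// mul0r. Qed.

Lemma step_ge1 x : 1 <= x -> step x = 1.
Proof.
move=> x1; rewrite /step (@e1_le0 (-1 * x + 1)); last by lra.
by rewrite addr0 divff// gt_eqF// e1_gt0//; lra.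
Qed.

Lemma step_ge0 x : 0 <= step x.
Proof. by rewrite mulr_ge0// invr_ge0 ltW. Qed.

Lemma step_le1 x : step x <= 1.
Proof. by rewrite ler_pdivrMr// mul1r lerDl. Qed.

Definition scaled_step s x := step (s^-1 * x + 0).

Lemma smooth1_scaled_step s : smooth1 (scaled_step s).
Proof. by apply: smooth1_affine; exact: smooth1_step. Qed.

Lemma scaled_step_le0 s x : 0 < s -> x <= 0 -> scaled_step s x = 0.
Proof. by move=> s0 x0; rewrite /scaled_step addr0 step_le0// pmulr_rle0// invr_gt0. Qed.

Lemma scaled_step_ge s x : 0 < s -> s <= x -> scaled_step s x = 1.
Proof.
by move=> s0 sx; rewrite /scaled_step addr0 step_ge1// mulrC ler_pdivlMr// mul1r.
Qed.

Definition moll s : R -> R := derive1 (scaled_step s).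

Lemma is_derive_scaled_step s x : is_derive x (1 : R) (scaled_step s) (moll s x).
Proof. exact: (smooth1_derive (smooth1_scaled_step s)).1. Qed.

Lemma smooth1_moll s : smooth1 (moll s).
Proof. exact: (smooth1_derive (smooth1_scaled_step s)).2. Qed.

Lemma moll_eq0 s x : 0 < s -> s < `|x| -> moll s x = 0.
Proof.
move=> s0 sx; rewrite /moll derive1E.
have [x0|x0] := ltP x 0.
  rewrite (@near_eq_derive _ _ _ _ (cst (0 : R))) ?derive_cst ?oner_eq0//.
  near=> t; apply: scaled_step_le0 => //; apply/ltW; near: t; exact: lt_nbhsl.
rewrite ger0_norm// in sx.
rewrite (@near_eq_derive _ _ _ _ (cst (1 : R))) ?derive_cst ?oner_eq0//.
near=> t; apply: scaled_step_ge => //; apply/ltW; near: t; exact: lt_nbhsr.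
Unshelve. all: by end_near. Qed.

Lemma test1_moll s : 0 < s -> test1 (moll s).
Proof.
move=> s0; split; first exact: smooth1_moll.
by exists s => [|x]; [exact: ltW|exact: moll_eq0].
Qed.

(** Chain rule for [scaled_step]; it makes the constant in [boxed_moll] independent of s. *)
Lemma mollE s x : moll s x = s^-1 * moll 1 (s^-1 * x).
Proof.
have h : is_derive x (1 : R) (scaled_step s) (moll 1 (s^-1 * x) * s^-1).
  have -> : scaled_step s = scaled_step 1 \o (fun y => s^-1 * y + 0).
    by apply/funext => y; rewrite /= /scaled_step invr1 mul1r !addr0.
  apply: is_derive1_comp; last exact: is_derive_affine.
  by rewrite addr0; exact: is_derive_scaled_step.
by rewrite /moll derive1E mulrC; have [_ ->] := h.
Qed.

Lemma boxed_moll : exists2 M : R, 0 <= M &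
  forall s, 0 < s -> boxed (M / s) s (moll s).
Proof.
have [M M0 [_ HM]] := continuous_boxed (smooth1_continuous (smooth1_moll 1))
  ler01 (fun s => @moll_eq0 1 s ltr01).
exists M => // s s0; split.
  exact: measurable_smooth1 (smooth1_moll s).
move=> x; rewrite mollE normrM normfV (gtr0_norm s0).
rewrite (mulrC M) -mulrA; apply: ler_wpM2l; first by rewrite invr_ge0 ltW.
apply: (le_trans (HM _)); rewrite /bump normrM normfV (gtr0_norm s0).
by rewrite ler_pdivrMl// mulr1.
Qed.

Definition step_diff s e x := scaled_step s x - scaled_step e x.

Lemma smooth1_step_diff s e : smooth1 (step_diff s e).
Proof. apply: smooth1D; [|apply: smooth1N]; exact: smooth1_scaled_step. Qed.

Lemma derive1_step_diff s e : derive1 (step_diff s e) = (fun x => moll s x - moll e x).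
Proof.
apply/funext => x; rewrite derive1E.
by have [_ ->] := is_deriveB (is_derive_scaled_step s x) (is_derive_scaled_step e x).
Qed.

Lemma step_diff_eq0 s e x : 0 < s -> s <= e -> e < `|x| -> step_diff s e x = 0.
Proof.
move=> s0 se ex; have e0 : 0 < e by exact: lt_le_trans se.
rewrite /step_diff; have [x0|x0] := ltP x 0.
  by rewrite !scaled_step_le0 ?subr0 ?ltW.
rewrite ger0_norm// in ex.
by rewrite !scaled_step_ge ?subrr// ?ltW// (le_lt_trans se).
Qed.

Lemma test1_step_diff s e : 0 < s -> s <= e -> test1 (step_diff s e).
Proof.
move=> s0 se; split; first exact: smooth1_step_diff.
exists e => [|x]; first by rewrite ltW// (lt_le_trans s0).
exact: step_diff_eq0.
Qed.

(** Height 1 whatever s, since both steps take values in [0, 1], and width e: this is the origin of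
    the factor e in the final estimate. *)
Lemma boxed_step_diff s e : 0 < s -> s <= e -> boxed 1 e (step_diff s e).
Proof.
move=> s0 se; split; first exact: measurable_smooth1 (smooth1_step_diff s e).
move=> x; rewrite mul1r /bump; case: (leP `|x| e) => xe; last first.
  by rewrite step_diff_eq0// normr0.
rewrite /step_diff /scaled_step ler_norml; apply/andP.
have := step_ge0; have := step_le1 => h1 h0.
have := h0 (s^-1 * x + 0); have := h0 (e^-1 * x + 0).
by have := h1 (s^-1 * x + 0); have := h1 (e^-1 * x + 0); split; rewrite ?mulr1n; lra.
Qed.

Lemma integral_moll s (c : R) : 0 < s ->
  (\int[lebesgue_measure]_t (moll s (c - t))%:E = 1)%E.
Proof.
move=> s0.
(* A primitive of t |-> m_s(c - t); it increases from -1 at c - s to 0 at c + s. *)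
pose F (t : R) := - scaled_step s (-1 * t + c).
have dF t : is_derive t (1 : R) F (moll s (c - t)).
  have -> : F = - (scaled_step s \o (fun t : R => -1 * t + c)) by [].
  have h := @is_derive1_comp R (scaled_step s) (fun t : R => -1 * t + c) t _ _
    (is_derive_scaled_step s (-1 * t + c)) (is_derive_affine (-1) c t).
  have := is_deriveN h; rewrite mulrN1 opprK mulN1r addrC.
  exact.
have cm : continuous (fun t => moll s (c - t)).
  move=> t; apply: (@continuous_comp _ _ _ (fun t => c - t) (moll s)).
    by apply: cvgB; [exact: cvg_cst|exact: cvg_id].
  exact: (smooth1_continuous (smooth1_moll s)).
have cF : continuous F by apply: is_derive_continuous; exact: dF.
have ab : c - s < c + s by lra.
transitivity (\int[lebesgue_measure]_(t in `[(c - s)%R, (c + s)%R]) (moll s (c - t))%:E)%E.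
  rewrite [RHS]integral_mkcond; apply: eq_integral => t _.
  rewrite patchE; case: ifPn => //; rewrite notin_setE/= in_itv/= => /negP h.
  by rewrite moll_eq0// ltNge; apply: contra h; rewrite ler_distlC.
rewrite (@continuous_FTC2 _ _ F _ _ ab).
- have F0 : scaled_step s (-1 * (c + s) + c) = 0 by apply: scaled_step_le0 => //; lra.
  have F1 : scaled_step s (-1 * (c - s) + c) = 1 by apply: scaled_step_ge => //; lra.
  by rewrite /F F0 F1 -EFinB; congr EFin; lra.
- exact: continuous_subspaceT.
- split.
  + by move=> t _; have [] := dF t.
  + by apply: cvg_at_right_filter; exact: cF.
  + by apply: cvg_at_left_filter; exact: cF.
- by move=> t _; rewrite derive1E; have [_ ->] := dF t.
Qed.

Lemma integral_moll2 s (z : measurableTypeR R * measurableTypeR R) : 0 < s ->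
  \int[leb2 R]_w (moll s (z.1 - w.1) * moll s (z.2 - w.2)) = 1.
Proof.
move=> s0.
have [M M0 HM] := boxed_moll.
(* With exponent 1, membership in L^p is the absolute integrability that Fubini asks for. *)
have L := in_Lp_kernel z ltr01 (ltW s0) (ltW s0) (HM s s0) (HM s s0).
have [mk fk] := (in_LpP _ ltr01).1 L.
have ik : (leb2 R).-integrable setT (fun w => (moll s (z.1 - w.1) * moll s (z.2 - w.2))%:E).
  apply/integrableP; split; first exact/measurable_EFinP.
  apply: le_lt_trans fk; rewrite le_eqVlt; apply/orP; left; apply/eqP.
  by apply: eq_integral => w _; rewrite powRr1.
have E : (\int[lebesgue_measure]_x \int[lebesgue_measure]_y
    (moll s (z.1 - x) * moll s (z.2 - y))%:E =
    \int[leb2 R]_w (moll s (z.1 - w.1) * moll s (z.2 - w.2))%:E)%E.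
  exact: (integral12_prod_meas1 ik).
rewrite /Rintegral -E.
have msz (c : R) : measurable_fun setT (fun x : measurableTypeR R => moll s (c - x)).
  apply: (measurableT_comp (measurable_smooth1 (smooth1_moll s))).
  exact: measurable_funB.
have intm (c : R) : lebesgue_measure.-integrable setT
    (fun t : measurableTypeR R => (moll s (c - t))%:E).
  have := integrable_indic_itv (c - s) (c + s) true false.
  move/(integrableZl measurableT (M / s)); apply: le_integrable => //.
    exact/measurable_EFinP.
  move=> t _; rewrite lee_fin.
  have [_ /(_ (c - t))] := HM s s0; move/le_trans; apply.
  apply: le_trans (ler_norm _); rewrite /bump indicE mem_setE in_itv/=.
  by rewrite ler_distlC.
have -> : (\int[lebesgue_measure]_x \int[lebesgue_measure]_y
    (moll s (z.1 - x) * moll s (z.2 - y))%:E =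
    \int[lebesgue_measure]_x (moll s (z.1 - x))%:E)%E.
  apply: eq_integral => x _.
  rewrite -[RHS]mule1 -(integral_moll z.2 s0) -integralZl//.
by rewrite integral_moll.
Qed.

End Step.

(** * Smoothness of convolutions *)

Section ConvSmooth.
Variable R : realType.
Local Notation T2 := (measurableTypeR R * measurableTypeR R)%type.
Local Notation mu := (leb2 R).
Implicit Types (p q r : R) (f : T2 -> R) (a b : R -> R).

(** Dividing the remainder by t leaves at most |t| K, which tends to 0. *)
Lemma quadratic_is_derive (F : R * R -> R) (z v : R * R) (L K : R) :
  (forall t : R, `|t| <= 1 -> `|F (t *: v + z) - F z - t * L| <= t ^+ 2 * K) ->
  is_derive z v F L.
Proof.
move=> H.
(* The hypothesis at t = 1 bounds an absolute value by K. *)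
have K0 : 0 <= K.
  by have := le_trans (normr_ge0 _) (H 1 _); rewrite normr1 expr1n mul1r; apply.
have lim : h^-1 *: ((F \o shift z) (h *: v) - F z) @[h --> 0^'] --> L.
  apply/cvgrPdist_le => e e0; near=> h.
  have h0 : h != 0 by near: h; exact: nbhs_dnbhs_neq.
  have h1 : `|h| <= 1 by near: h; apply: dnbhs0_le.
  have he : `|h| <= e / (K + 1) by near: h; apply: dnbhs0_le; rewrite divr_gt0// ltr_wpDl.
  rewrite /GRing.scale/= distrC.
  have -> : h^-1 * (F (h *: v + z) - F z) - L = h^-1 * (F (h *: v + z) - F z - h * L).
    by rewrite [RHS]mulrBr mulrA mulVf// mul1r.
  rewrite normrM normfV ler_pdivrMl ?normr_gt0//.
  apply: (le_trans (H h h1)).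
  rewrite -real_normK ?num_real// expr2 -mulrA ler_wpM2l//.
  apply: (@le_trans _ _ (`|h| * (K + 1))); first by rewrite ler_wpM2l// lerDl.
  by rewrite -ler_pdivlMr// ltr_wpDl.
apply: DeriveDef; first by apply/cvg_ex; exists L.
exact/cvg_lim.
Unshelve. all: by end_near. Qed.

Lemma boxed_bump (A r : R) : 0 <= A -> boxed A r (fun s => A * bump r s).
Proof.
move=> A0; split; first by apply: measurable_funM => //; exact: measurable_bump.
by move=> s; rewrite ger0_norm// mulr_ge0// bump_ge0.
Qed.

Lemma in_Lp_norm q f : 0 < q -> in_Lp q f -> in_Lp q (fun z => `|f z|).
Proof.
move=> q0 /(in_LpP _ q0)[mf ff]; apply/(in_LpP _ q0); split.
  exact: measurableT_comp.
by rewrite /Lp_pow; under eq_integral do rewrite normr_id.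
Qed.

Section OneFunction.
Variables (q : R) (f : T2 -> R).
Hypotheses (q1 : 1 < q) (Lf : in_Lp q f).

Let q0 : 0 < q := lt_trans ltr01 q1.
Let mf := in_Lp_measurable q0 Lf.

(** Convolution of |f| with a box kernel. It serves as the constant K of [quadratic_is_derive]: it
    depends on z but not on t. *)
Definition majorant (A r B r' : R) : T2 -> R :=
  conv (fun w => `|f w|) (fun s => A * bump r s) (fun s => B * bump r' s).

Lemma normr_conv_kernel (c A r B r' : R) (z : T2) (k : T2 -> R) :
  0 <= c -> 0 <= A -> 0 <= B -> 0 <= r -> 0 <= r' -> measurable_fun setT k ->
  (forall w, `|k w| <= c * ((A * bump r (z.1 - w.1)) * (B * bump r' (z.2 - w.2)))) ->
  `|\int[mu]_w (f w * k w)| <= c * majorant A r B r' z.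
Proof.
move=> c0 A0 B0 r0 r'0 mk Hk.
have iM := integrable_conv z q1 r0 r'0 (in_Lp_norm q0 Lf)
  (boxed_bump r A0) (boxed_bump r' B0).
have le w : `|f w * k w| <= c * (`|f w| * ((A * bump r (z.1 - w.1)) * (B * bump r' (z.2 - w.2)))).
  by rewrite normrM mulrCA ler_wpM2l.
have iM' := integrableZl measurableT c iM.
have ik : mu.-integrable setT (EFin \o (fun w => f w * k w)).
  apply: le_integrable iM' => //; first by apply/measurable_EFinP; exact: measurable_funM.
  by move=> w _; rewrite lee_fin; apply: (le_trans (le w)); exact: ler_norm.
apply: (le_trans (le_normr_Rintegral _ ik)) => //.
rewrite /majorant /conv -RintegralZl//.
apply: le_Rintegral => //.
exact: (integrable_norm ik).
Qed.

Section OneKernel.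
Variables (a b : R -> R).
Hypotheses (cca : test1 a) (ccb : test1 b).

Lemma integrable_conv_test1 (a' b' : R -> R) z : test1 a' -> test1 b' ->
  mu.-integrable setT (fun w => (f w * (a' (z.1 - w.1) * b' (z.2 - w.2)))%:E).
Proof.
move=> ca cb.
have [A [r [A0 r0 Ha]]] := test1_boxed ca; have [B [r' [B0 r'0 Hb]]] := test1_boxed cb.
exact: (integrable_conv z q1 r0 r'0 Lf Ha Hb).
Qed.

Lemma measurable_kernel_test1 (a' b' : R -> R) (z : T2) : test1 a' -> test1 b' ->
  measurable_fun setT (fun w : T2 => a' (z.1 - w.1) * b' (z.2 - w.2)).
Proof.
by move=> [sa _] [sb _]; apply: measurable_kernel_r; exact: measurable_smooth1.
Qed.

(** Differentiation under the integral sign, reduced to a Taylor bound on the kernel that holds for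
    every w; [z'] is the displaced point and a1, b1 form the differentiated kernel. *)
Lemma conv_taylor (a1 b1 : R -> R) (z z' : T2) (t A r B r' : R) :
  test1 a1 -> test1 b1 -> 0 <= A -> 0 <= B -> 0 <= r -> 0 <= r' ->
  (forall w : T2, `|a (z'.1 - w.1) * b (z'.2 - w.2) - a (z.1 - w.1) * b (z.2 - w.2)
      - t * (a1 (z.1 - w.1) * b1 (z.2 - w.2))| <=
    t ^+ 2 * ((A * bump r (z.1 - w.1)) * (B * bump r' (z.2 - w.2)))) ->
  `|conv f a b z' - conv f a b z - t * conv f a1 b1 z| <=
    t ^+ 2 * majorant A r B r' z.
Proof.
move=> cca1 ccb1 A0 B0 r0 r'0 H.
have i1 := integrable_conv_test1 z' cca ccb.
have i2 := integrable_conv_test1 z cca ccb.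
have i3 := integrable_conv_test1 z cca1 ccb1.
have -> : conv f a b z' - conv f a b z - t * conv f a1 b1 z =
    \int[mu]_w (f w * (a (z'.1 - w.1) * b (z'.2 - w.2) -
      a (z.1 - w.1) * b (z.2 - w.2) - t * (a1 (z.1 - w.1) * b1 (z.2 - w.2)))).
  rewrite /conv -RintegralZl// -!RintegralB//.
  - by apply: eq_Rintegral => w _; rewrite !mulrBr (mulrCA t).
  - exact: (integrableB measurableT i1 i2).
  - exact: (integrableZl measurableT t i3).
apply: normr_conv_kernel => //; first exact: sqr_ge0.
apply: measurable_funB; last by apply: measurable_funM => //; exact: measurable_kernel_test1.
by apply: measurable_funB; exact: measurable_kernel_test1.
Qed.

Lemma is_derive_conv_x (z : R * R) :
  is_derive z ((1, 0) : R * R) (conv f a b : R * R -> R) (conv f (derive1 a) b z).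
Proof.
have [A [r [A0 r0 Ha]]] := test1_taylor cca.
have [B [r' [B0 r'0 [_ Hb]]]] := test1_boxed ccb.
apply: (@quadratic_is_derive _ _ _ _ (majorant A r B r' z)) => t t1.
apply: conv_taylor => //; first exact: test1_derive.
move=> w; rewrite /= /GRing.scale/= mulr1 mulr0 add0r.
set s := z.1 - w.1; set s' := z.2 - w.2.
have -> : t + z.1 - w.1 = s + t by rewrite /s -addrA addrC.
have -> : a (s + t) * b s' - a s * b s' - t * (derive1 a s * b s') =
  (a (s + t) - a s - t * derive1 a s) * b s' by ring.
rewrite normrM mulrA; apply: ler_pM => //.
exact: (Ha s t t1).2.
Qed.

Lemma is_derive_conv_y (z : R * R) :
  is_derive z ((0, 1) : R * R) (conv f a b : R * R -> R) (conv f a (derive1 b) z).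
Proof.
have [A [r [A0 r0 [_ Ha]]]] := test1_boxed cca.
have [B [r' [B0 r'0 Hb]]] := test1_taylor ccb.
apply: (@quadratic_is_derive _ _ _ _ (majorant A r B r' z)) => t t1.
apply: conv_taylor => //; first exact: test1_derive.
move=> w; rewrite /= /GRing.scale/= mulr1 mulr0 add0r.
set s := z.1 - w.1; set s' := z.2 - w.2.
have -> : t + z.2 - w.2 = s' + t by rewrite /s' -addrA addrC.
have -> : a s * b (s' + t) - a s * b s' - t * (a s * derive1 b s') =
  a s * (b (s' + t) - b s' - t * derive1 b s') by ring.
rewrite normrM mulrCA; apply: ler_pM => //.
exact: (Hb s' t t1).2.
Qed.

Lemma continuous_conv : continuous (conv f a b : R * R -> R).
Proof.
have [A [r [A0 r0 Ha]]] := test1_lipschitz cca.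
have [B [r' [B0 r'0 Hb]]] := test1_lipschitz ccb.
move=> z; pose K := majorant A r B r' z.
have H (z' : T2) : `|z.1 - z'.1| <= 1 -> `|z.2 - z'.2| <= 1 ->
    `|conv f a b z - conv f a b z'| <= (`|z.1 - z'.1| + `|z.2 - z'.2|) * K.
  move=> h1 h2.
  have i1 := integrable_conv_test1 z' cca ccb.
  have i2 := integrable_conv_test1 z cca ccb.
  have -> : conv f a b z - conv f a b z' =
      \int[mu]_w (f w * (a (z.1 - w.1) * b (z.2 - w.2) -
        a (z'.1 - w.1) * b (z'.2 - w.2))).
    rewrite /conv -!RintegralB//.
    by apply: eq_Rintegral => w _; rewrite mulrBr.
  apply: normr_conv_kernel => //.
    by apply: measurable_funB; exact: measurable_kernel_test1.
  move=> w; set s := z.1 - w.1; set s' := z.2 - w.2.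
  pose t := z'.1 - z.1; pose t' := z'.2 - z.2.
  have -> : z'.1 - w.1 = s + t by rewrite /s /t; ring.
  have -> : z'.2 - w.2 = s' + t' by rewrite /s' /t'; ring.
  rewrite [`|z.1 - _|]distrC [`|z.2 - _|]distrC -/t -/t'.
  rewrite distrC in h1; rewrite distrC in h2.
  have [a1 a2 a3] := Ha s t h1; have [b1 b2 b3] := Hb s' t' h2.
  have -> : a s * b s' - a (s + t) * b (s' + t') =
    - ((a (s + t) - a s) * b (s' + t') + a s * (b (s' + t') - b s')) by ring.
  rewrite normrN; apply: (le_trans (ler_normD _ _)); rewrite [leRHS]mulrDl; apply: lerD.
    by rewrite normrM mulrA; apply: ler_pM.
  by rewrite normrM mulrCA; apply: ler_pM.
(* The bound just proved, at a point at distance 1 from z, has right-hand side K. *)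
have K0 : 0 <= K.
  have := H z; rewrite !subrr normr0 => /(_ ler01 ler01) _.
  have := H ((z.1 + 1, z.2) : T2); rewrite /= opprD addrA subrr sub0r normrN normr1 subrr normr0.
  by rewrite addr0 mul1r => /(_ (lexx _) ler01); exact: le_trans.
have cf : (fun w : R * R => w.1) @ z --> z.1 by exact: cvg_fst.
have cs : (fun w : R * R => w.2) @ z --> z.2 by exact: cvg_snd.
apply/cvgrPdist_le => e e0.
(* Each of the two coordinates contributes d K; the cap at 1 is the range in which [test1_lipschitz]
   applies. *)
pose d := Num.min 1 (e / (2 * (K + 1))).
have d0 : 0 < d by rewrite lt_min ltr01 divr_gt0// mulr_gt0// ltr_wpDl.
have d1 : d <= 1 by rewrite ge_min lexx.
have de : d <= e / (2 * (K + 1)) by rewrite ge_min lexx orbT.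
near=> z'.
have h1 : `|z.1 - z'.1| <= d by near: z'; move/cvgrPdist_le : cf; exact.
have h2 : `|z.2 - z'.2| <= d by near: z'; move/cvgrPdist_le : cs; exact.
apply: (le_trans (H z' (le_trans h1 d1) (le_trans h2 d1))).
apply: (@le_trans _ _ ((d + d) * (K + 1))).
  by apply: ler_pM; rewrite ?addr_ge0// ?lerDl// lerD.
rewrite ler_pdivlMr ?mulr_gt0// ?ltr_wpDl// in de.
by have -> : (d + d) * (K + 1) = d * (2 * (K + 1)) by ring.
Unshelve. all: by end_near. Qed.

End OneKernel.
End OneFunction.
End ConvSmooth.

(** * Smooth functions and test functions on the plane *)

Section SmoothPlane.
Variable R : realType.
Implicit Types (f g : R * R -> R) (a b : R -> R) (k : nat).

Lemma Ck_intro k f fx fy : continuous f ->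
  (forall z, is_derive z ((1, 0) : R * R) f (fx z)) ->
  (forall z, is_derive z ((0, 1) : R * R) f (fy z)) ->
  Ck k fx -> Ck k fy -> Ck k.+1 f.
Proof.
move=> cf dfx dfy cx cy; split => //=.
have -> : dx f = fx by apply/funext => z; rewrite /dx; have [_ ->] := dfx z.
have -> : dy f = fy by apply/funext => z; rewrite /dy; have [_ ->] := dfy z.
by split.
Qed.

Lemma Ck_elim k f : Ck k.+1 f -> [/\ continuous f,
  (forall z, is_derive z ((1, 0) : R * R) f (dx f z)),
  (forall z, is_derive z ((0, 1) : R * R) f (dy f z)), Ck k (dx f) & Ck k (dy f)].
Proof.
by move=> [cf [d1 d2 c1 c2]]; split.
Qed.

Lemma Ck_continuous k f : Ck k f -> continuous f.
Proof. by case: k => [|k] []. Qed.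

Lemma Ck_pred k f : Ck k.+1 f -> Ck k f.
Proof.
elim: k f => [f []//|k IHk f] /Ck_elim[cf d1 d2 c1 c2].
apply: (Ck_intro cf d1 d2); exact: IHk.
Qed.

Lemma CkD k f g : Ck k f -> Ck k g -> Ck k (fun z => f z + g z).
Proof.
elim: k f g => [f g [cf _] [cg _]|k IHk f g].
  by split => // z; apply: cvgD; [exact: cf|exact: cg].
move=> /Ck_elim[cf d1 d2 c1 c2] /Ck_elim[cg e1 e2 s1 s2].
apply: (@Ck_intro _ _ (fun z => dx f z + dx g z) (fun z => dy f z + dy g z)).
- by move=> z; apply: cvgD; [exact: cf|exact: cg].
- exact: IHk.
- exact: IHk.
Qed.

Lemma CkM k f g : Ck k f -> Ck k g -> Ck k (fun z => f z * g z).
Proof.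
elim: k f g => [f g [cf _] [cg _]|k IHk f g].
  by split => // z; apply: cvgM; [exact: cf|exact: cg].
move=> Cf Cg; have pf := Ck_pred Cf; have pg := Ck_pred Cg.
move: Cf Cg => /Ck_elim[cf d1 d2 c1 c2] /Ck_elim[cg e1 e2 s1 s2].
apply: (@Ck_intro _ _ (fun z => f z * dx g z + g z * dx f z)
                      (fun z => f z * dy g z + g z * dy f z)).
- by move=> z; apply: cvgM; [exact: cf|exact: cg].
- by apply: CkD; exact: IHk.
- by apply: CkD; exact: IHk.
Qed.

(** Both partial derivatives are convolutions of the same f with test kernels, so the induction on k
    ranges over all a and b. *)
Lemma smooth_conv q (f : measurableTypeR R * measurableTypeR R -> R) a b :
  1 < q -> in_Lp q f -> test1 a -> test1 b -> smooth (conv f a b : R * R -> R).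
Proof.
move=> q1 Lf ca cb k; elim: k a b ca cb => [|k IHk] a b ca cb.
  by split => //; exact: (continuous_conv q1 Lf ca cb).
apply: (@Ck_intro _ _ (conv f (derive1 a) b) (conv f a (derive1 b))).
- exact: (continuous_conv q1 Lf ca cb).
- exact: (is_derive_conv_x q1 Lf ca cb).
- exact: (is_derive_conv_y q1 Lf ca cb).
- by apply: IHk => //; exact: test1_derive.
- by apply: IHk => //; exact: test1_derive.
Qed.

Lemma is_derive_shift_x a (c : R) (w : R * R) : test1 a ->
  is_derive w ((1, 0) : R * R) (fun w : R * R => a (c - w.1)) (- derive1 a (c - w.1)).
Proof.
move=> ca; have [A [r [A0 r0 Ha]]] := test1_taylor ca.
apply: (@quadratic_is_derive _ _ _ _ _ (A * bump r (c - w.1))) => t t1.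
rewrite /= /GRing.scale/= mulr1 mulrN -mulNr.
have -> : c - (t + w.1) = (c - w.1) + - t by rewrite opprD addrA addrAC.
by rewrite -[t ^+ 2]sqrrN; apply: (Ha _ _ _).2; rewrite normrN.
Qed.

Lemma is_derive_shift_y a (c : R) (w : R * R) : test1 a ->
  is_derive w ((0, 1) : R * R) (fun w : R * R => a (c - w.2)) (- derive1 a (c - w.2)).
Proof.
move=> ca; have [A [r [A0 r0 Ha]]] := test1_taylor ca.
apply: (@quadratic_is_derive _ _ _ _ _ (A * bump r (c - w.2))) => t t1.
rewrite /= /GRing.scale/= mulr1 mulrN -mulNr.
have -> : c - (t + w.2) = (c - w.2) + - t by rewrite opprD addrA addrAC.
by rewrite -[t ^+ 2]sqrrN; apply: (Ha _ _ _).2; rewrite normrN.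
Qed.

Lemma is_derive_cst_dir (a : R -> R) (c : R) (w : R * R) :
  is_derive w ((0, 1) : R * R) (fun w : R * R => a (c - w.1)) 0 /\
  is_derive w ((1, 0) : R * R) (fun w : R * R => a (c - w.2)) 0.
Proof.
have H (t : R) (x : R) : c - (t * 0 + x) = c - x by rewrite mulr0 add0r.
split; apply: (@quadratic_is_derive _ _ _ _ _ 0) => t t1.
  by rewrite /= /GRing.scale/= H subrr mulr0 subr0 normr0 mulr0.
by rewrite /= /GRing.scale/= H subrr mulr0 subr0 normr0 mulr0.
Qed.

Definition kernel_at a b (z w : R * R) : R := a (z.1 - w.1) * b (z.2 - w.2).

Lemma is_derive_kernel_x a b (z w : R * R) : test1 a ->
  is_derive w ((1, 0) : R * R) (kernel_at a b z) (- kernel_at (derive1 a) b z w).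
Proof.
move=> ca; have h := is_deriveM (is_derive_shift_x z.1 w ca) (is_derive_cst_dir b z.2 w).2.
apply: (is_derive_eq h).
by rewrite /GRing.scale/= mulr0 add0r mulrN mulrC.
Qed.

Lemma is_derive_kernel_y a b (z w : R * R) : test1 b ->
  is_derive w ((0, 1) : R * R) (kernel_at a b z) (- kernel_at a (derive1 b) z w).
Proof.
move=> cb; have h := is_deriveM (is_derive_cst_dir a z.1 w).1 (is_derive_shift_y z.2 w cb).
apply: (is_derive_eq h).
by rewrite /GRing.scale/= mulr0 addr0 mulrN.
Qed.

Lemma continuous_kernel_at a b z : test1 a -> test1 b -> continuous (kernel_at a b z).
Proof.
move=> [sa _] [sb _] w; apply: cvgM.
  apply: (@continuous_comp _ _ _ (fun w : R * R => z.1 - w.1) a).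
    by apply: cvgB; [exact: cvg_cst|exact: cvg_fst].
  exact: (smooth1_continuous sa).
apply: (@continuous_comp _ _ _ (fun w : R * R => z.2 - w.2) b).
  by apply: cvgB; [exact: cvg_cst|exact: cvg_snd].
exact: (smooth1_continuous sb).
Qed.

Lemma test1N a : test1 a -> test1 (fun x => - a x).
Proof.
move=> [sa [r r0 h]]; split; first exact: smooth1N.
by exists r => // s /h ->; rewrite oppr0.
Qed.

Lemma smooth_kernel_at a b z : test1 a -> test1 b -> smooth (kernel_at a b z).
Proof.
move=> ca cb k; elim: k a b ca cb => [|k IHk] a b ca cb.
  by split => //; exact: continuous_kernel_at.
(* The sign created by differentiating in w is absorbed into the first factor, so the derivatives
   are again of the form [kernel_at]. *)
have N (f g : R -> R) : (fun w => - kernel_at f g z w) = kernel_at (fun x => - f x) g z.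
  by apply/funext => w; rewrite /kernel_at mulNr.
apply: (@Ck_intro _ _ (fun w => - kernel_at (derive1 a) b z w)
   (fun w => - kernel_at a (derive1 b) z w)).
- exact: continuous_kernel_at.
- by move=> w; exact: is_derive_kernel_x.
- by move=> w; exact: is_derive_kernel_y.
- by rewrite N; apply: IHk => //; exact/test1N/test1_derive.
- by rewrite N; apply: IHk => //; [exact: test1N|exact: test1_derive].
Qed.

Lemma bounded_compactly_supported f (r : R) :
  (forall z, f z != 0 -> `|z.1| <= r /\ `|z.2| <= r) -> compactly_supported f.
Proof.
move=> H; rewrite /compactly_supported.
pose I := `[- r, r]%classic : set R.
have cI : compact I by exact: segment_compact.
have cII : compact (I `*` I) by exact: compact_setX.
apply: (subclosed_compact _ cII); first exact: closed_closure.
have clII : closed (I `*` I) by apply: compact_closed => //; exact: norm_hausdorff.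
rewrite [X in _ `<=` X](closure_id _).1//.
apply: closure_subset => z /= /H[h1 h2].
by split; rewrite /I /= in_itv/= -ler_norml.
Qed.

Lemma compactly_supported_bounded f : compactly_supported f ->
  exists2 r : R, 0 <= r & forall z, f z != 0 -> `|z.1| <= r /\ `|z.2| <= r.
Proof.
move=> cf; have [M [_ HM]] := compact_bounded cf.
exists (`|M| + 1) => [|z fz]; first by rewrite addr_ge0.
have : `|z| <= `|M| + 1.
  apply: HM; first by rewrite (le_lt_trans (ler_norm _))// ltrDl.
  by apply: subset_closure => /=; exact: fz.
by rewrite prod_normE ge_max => /andP[].
Qed.

Lemma test_function_kernel a b z : test1 a -> test1 b -> test_function (kernel_at a b z).
Proof.
move=> ca cb; split; first exact: smooth_kernel_at.
have [_ [r r0 Ha]] := ca; have [_ [r' r'0 Hb]] := cb.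
apply: (@bounded_compactly_supported _ (r + r' + `|z.1| + `|z.2|)) => w.
rewrite /kernel_at mulf_eq0 negb_or => /andP[h1 h2].
have ha : `|z.1 - w.1| <= r by rewrite leNgt; apply: contra h1 => /Ha ->.
have hb : `|z.2 - w.2| <= r' by rewrite leNgt; apply: contra h2 => /Hb ->.
have n1 := normr_ge0 z.1; have n2 := normr_ge0 z.2.
have t1 : `|w.1| <= r + `|z.1|.
  rewrite -[w.1](subrK z.1) (le_trans (ler_normD _ _))// lerD// distrC//.
have t2 : `|w.2| <= r' + `|z.2|.
  rewrite -[w.2](subrK z.2) (le_trans (ler_normD _ _))// lerD// distrC//.
by split; lra.
Qed.

End SmoothPlane.

Section ContinuousMeasurable.
Variable R : realType.
Local Notation T2 := (measurableTypeR R * measurableTypeR R)%type.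

(** The sigma-algebra here is the product one, so an open set is written as a countable union of
    rational boxes. *)
Lemma open_plane_measurable (U : set (R * R)) : open U ->
  measurable (U : set T2).
Proof.
move=> oU.
pose box (q : rat * rat * (rat * rat)) : set T2 :=
  (`]ratr q.1.1, ratr q.1.2[%classic : set (measurableTypeR R)) `*`
  (`]ratr q.2.1, ratr q.2.2[%classic : set (measurableTypeR R)).
(* All quadruples of rationals are enumerated; boxes not contained in [U] are replaced by the empty
   set. *)
pose F (i : nat) : set T2 := if unpickle i is Some q then
  (if `[< box q `<=` U >] then box q else set0) else set0.
have -> : (U : set T2) = \bigcup_i F i.
  apply/seteqP; split => [z Uz|z [i _]]; last first.
    rewrite /F; case: (unpickle i) => // q; case: ifPn => // /asboolP; exact.
  have /nbhs_ballP[e /= e0 He] := open_nbhs_nbhs (conj oU Uz).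
  have [q1] := @rat_in_itvoo R (z.1 - e) z.1 (ltac:(by rewrite ltrBlDr ltrDl)).
  rewrite in_itv/= => /andP[q11 q12].
  have [q2] := @rat_in_itvoo R z.1 (z.1 + e) (ltac:(by rewrite ltrDl)).
  rewrite in_itv/= => /andP[q21 q22].
  have [q3] := @rat_in_itvoo R (z.2 - e) z.2 (ltac:(by rewrite ltrBlDr ltrDl)).
  rewrite in_itv/= => /andP[q31 q32].
  have [q4] := @rat_in_itvoo R z.2 (z.2 + e) (ltac:(by rewrite ltrDl)).
  rewrite in_itv/= => /andP[q41 q42].
  have [i Hi] : exists i, unpickle i = Some ((q1, q2), (q3, q4)).
    by exists (pickle ((q1, q2), (q3, q4))); exact: pickleK.
  exists i; [exact: I|rewrite /F Hi].
  case: ifPn => [_|/negP].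
    by split; rewrite /= in_itv/=; apply/andP.
  case; apply/asboolP => w [/=]; rewrite !in_itv/= => /andP[h1 h2] /andP[h3 h4].
  apply: He; split; rewrite /ball/= ltr_norml; apply/andP; split; lra.
apply: bigcupT_measurable => i; rewrite /F; case: (unpickle i) => // q.
by case: ifPn => // _; apply: measurableX; exact: measurable_itv.
Qed.

Lemma measurable_continuous2 (f : R * R -> R) : continuous f ->
  measurable_fun setT (f : T2 -> R).
Proof.
move=> /continuousP cf; apply: (measurability _ (RGenOpens.measurableE R)).
move=> _ [_ [a [b ->] <-]]; rewrite setTI; apply: open_plane_measurable.
exact/cf/interval_open.
Qed.

End ContinuousMeasurable.

(** * Lebesgue points in the mean *)

Section Oscillation.
Variable R : realType.
Local Notation T2 := (measurableTypeR R * measurableTypeR R)%type.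
Local Notation mu := (leb2 R).
Implicit Types (n : nat) (V : T2 -> R) (F G : T2 * T2 -> R).

(* The averaging boxes have their base point as upper right corner, so that the
   indicator of a half-open rectangle is constant on all small enough boxes. *)
Definition hat (d s : R) : R := (0 <= s <= d)%R%:R.

Lemma hat_ge0 d s : 0 <= hat d s. Proof. by rewrite /hat ler0n. Qed.

Lemma hat_bump d s : hat d s <= bump d s.
Proof.
rewrite /hat /bump ler_nat; case: (boolP (0 <= s <= d)) => // /andP[s0 sd].
by rewrite ger0_norm// sd.
Qed.

Lemma measurable_hat d : measurable_fun setT (hat d).
Proof.
have -> : hat d = \1_(`[0, d]%classic : set R).
  by apply/funext => s; rewrite /hat indicE mem_setE in_itv/=.
exact: measurable_indic.
Qed.

(** The density of the uniform mean over the square of side 1/(n+1) whose upper right corner is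
    z. *)
Definition box_avg n (z w : T2) : R :=
  n.+1%:R ^+ 2 * (hat n.+1%:R^-1 (z.1 - w.1) * hat n.+1%:R^-1 (z.2 - w.2)).

Lemma box_avg_ge0 n z w : 0 <= box_avg n z w.
Proof. by rewrite mulr_ge0 ?sqr_ge0// mulr_ge0// hat_ge0. Qed.

Lemma measurable_box_avg n :
  measurable_fun setT (fun zw : T2 * T2 => box_avg n zw.1 zw.2).
Proof.
apply: measurable_funM => //.
by apply: (measurable_kernel (measurable_hat _) (measurable_hat _)).
Qed.

Let d_ge0 n : 0 <= n.+1%:R^-1 :> R. Proof. by rewrite invr_ge0. Qed.

Lemma box_avg_le n (z w : T2) : box_avg n z w <=
  n.+1%:R ^+ 2 * (bump n.+1%:R^-1 (z.1 - w.1) * bump n.+1%:R^-1 (z.2 - w.2)).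
Proof.
rewrite ler_wpM2l ?sqr_ge0//.
by apply: ler_pM; rewrite ?hat_ge0 ?hat_bump.
Qed.

Lemma box_avg_neq0 n (z w : T2) : box_avg n z w != 0 ->
  (z.1 - n.+1%:R^-1 <= w.1 <= z.1) /\ (z.2 - n.+1%:R^-1 <= w.2 <= z.2).
Proof.
rewrite mulf_eq0 negb_or => /andP[_]; rewrite mulf_eq0 negb_or /hat.
rewrite !pnatr_eq0 !eqb0 !negbK => /andP[/andP[h1 h2] /andP[h3 h4]].
rewrite -[w.1 <= _]subr_ge0 -[w.2 <= _]subr_ge0 h1 h3 !andbT.
by rewrite lerBlDr -lerBlDl h2 lerBlDr -lerBlDl h4.
Qed.

Let c4 n : n.+1%:R ^+ 2 * (4 * n.+1%:R^-1 * n.+1%:R^-1) = 4 :> R.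
Proof. by field; rewrite addrC natr1 pnatr_eq0. Qed.

Let mbump2 n (z : T2) : measurable_fun setT
  (fun w : T2 => (bump n.+1%:R^-1 (z.1 - w.1) * bump n.+1%:R^-1 (z.2 - w.2))%:E).
Proof.
apply/measurable_EFinP.
exact: (measurable_kernel_r z (measurable_bump _) (measurable_bump _)).
Qed.

(** Replacing [hat] by the twice wider [bump] in each variable costs a factor 4 over the true mass
    1. *)
Lemma integral_box_avg_r n (z : T2) : (\int[mu]_w (box_avg n z w)%:E <= 4%:E)%E.
Proof.
apply: (@le_trans _ _ (\int[mu]_w ((n.+1%:R ^+ 2)%:E *
   (bump n.+1%:R^-1 (z.1 - w.1) * bump n.+1%:R^-1 (z.2 - w.2))%:E))%E); last first.
  rewrite ge0_integralZl//; last first.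
    by move=> w _; rewrite lee_fin mulr_ge0// bump_ge0.
  by rewrite integral_bump2// -EFinM c4.
apply: ge0_le_integral => //.
- by move=> w _; rewrite lee_fin box_avg_ge0.
- apply/measurable_EFinP.
  exact: (measurableT_comp (measurable_box_avg n) (measurable_pair1 z)).
- exact: measurable_funeM.
- by move=> w _; rewrite -EFinM lee_fin box_avg_le.
Qed.

Lemma integral_box_avg_l n (w : T2) : (\int[mu]_z (box_avg n z w)%:E <= 4%:E)%E.
Proof.
apply: (@le_trans _ _ (\int[mu]_z ((n.+1%:R ^+ 2)%:E *
   (bump n.+1%:R^-1 (w.1 - z.1) * bump n.+1%:R^-1 (w.2 - z.2))%:E))%E); last first.
  rewrite ge0_integralZl//; last first.
    by move=> z _; rewrite lee_fin mulr_ge0// bump_ge0.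
  by rewrite integral_bump2// -EFinM c4.
apply: ge0_le_integral => //.
- by move=> z _; rewrite lee_fin box_avg_ge0.
- apply/measurable_EFinP.
  exact: (measurableT_comp (measurable_box_avg n) (measurable_pair2 w)).
- exact: measurable_funeM.
- move=> z _; rewrite -EFinM lee_fin.
  by rewrite bumpBC [X in _ <= _ * (_ * X)]bumpBC box_avg_le.
Qed.

Definition avg2 n F : \bar R :=
  (\int[mu]_z \int[mu]_w (F (z, w) * box_avg n z w)%:E)%E.

Let mFK n F : measurable_fun setT F ->
  measurable_fun setT (EFin \o (fun zw : T2 * T2 => F zw * box_avg n zw.1 zw.2)).
Proof.
by move=> mF; apply/measurable_EFinP; apply: measurable_funM => //;
  exact: measurable_box_avg.
Qed.

Let sec (H : T2 * T2 -> R) z : measurable_fun setT (EFin \o H) ->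
  measurable_fun setT (fun w => (H (z, w))%:E).
Proof. by move=> h; exact: (measurableT_comp h (measurable_pair1 z)). Qed.

Let FK0 n F : (forall zw, 0 <= F zw) ->
  forall zw, (0 <= (EFin \o (fun zw : T2 * T2 => F zw * box_avg n zw.1 zw.2)%R) zw)%E.
Proof. by move=> F0 zw; rewrite lee_fin mulr_ge0// box_avg_ge0. Qed.

(** The comparison is asked only where the averaging kernel is nonzero, that is for w close to z. *)
Lemma avg2_le n F G : measurable_fun setT F -> measurable_fun setT G ->
  (forall zw, 0 <= F zw) -> (forall zw, 0 <= G zw) ->
  (forall z w, box_avg n z w != 0 -> F (z, w) <= G (z, w)) ->
  (avg2 n F <= avg2 n G)%E.
Proof.
move=> mF mG F0 G0 FG; have mFn := mFK n mF; have mGn := mFK n mG.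
apply: ge0_le_integral => //.
- by move=> z _; apply: integral_ge0 => w _; exact: (FK0 n F0 (z, w)).
- exact: (leb2_measurable_section mFn (FK0 n F0)).
- exact: (leb2_measurable_section mGn (FK0 n G0)).
move=> z _; apply: ge0_le_integral => //.
- by move=> w _; exact: (FK0 n F0 (z, w)).
- exact: (sec z mFn).
- exact: (sec z mGn).
- move=> w _; rewrite lee_fin; have [->|k0] := eqVneq (box_avg n z w) 0.
    by rewrite !mulr0.
  by rewrite ler_wpM2r ?box_avg_ge0// FG.
Qed.

Lemma avg2D n F G : measurable_fun setT F -> measurable_fun setT G ->
  (forall zw, 0 <= F zw) -> (forall zw, 0 <= G zw) ->
  avg2 n (fun zw => F zw + G zw) = (avg2 n F + avg2 n G)%E.
Proof.
move=> mF mG F0 G0; have mFn := mFK n mF; have mGn := mFK n mG.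
rewrite /avg2 -ge0_integralD//; last 4 first.
- by move=> z _; apply: integral_ge0 => w _; exact: (FK0 n F0 (z, w)).
- exact: (leb2_measurable_section mFn (FK0 n F0)).
- by move=> z _; apply: integral_ge0 => w _; exact: (FK0 n G0 (z, w)).
- exact: (leb2_measurable_section mGn (FK0 n G0)).
apply: eq_integral => z _; rewrite -ge0_integralD//; last 4 first.
- by move=> w _; exact: (FK0 n F0 (z, w)).
- exact: (sec z mFn).
- by move=> w _; exact: (FK0 n G0 (z, w)).
- exact: (sec z mGn).
by apply: eq_integral => w _; rewrite -EFinD mulrDl.
Qed.

Lemma avg2Z n F (c : R) : 0 <= c -> measurable_fun setT F ->
  (forall zw, 0 <= F zw) -> avg2 n (fun zw => c * F zw) = (c%:E * avg2 n F)%E.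
Proof.
move=> c0 mF F0; have mFn := mFK n mF.
rewrite /avg2 -ge0_integralZl//; last 2 first.
- exact: (leb2_measurable_section mFn (FK0 n F0)).
- by move=> z _; apply: integral_ge0 => w _; exact: (FK0 n F0 (z, w)).
apply: eq_integral => z _; rewrite -ge0_integralZl//; last 2 first.
- exact: (sec z mFn).
- by move=> w _; exact: (FK0 n F0 (z, w)).
by apply: eq_integral => w _; rewrite -mulrA EFinM.
Qed.

Lemma avg2_fst n (g : T2 -> R) : measurable_fun setT g -> (forall z, 0 <= g z) ->
  (avg2 n (g \o fst) <= 4%:E * \int[mu]_z (g z)%:E)%E.
Proof.
move=> mg g0.
have mG : measurable_fun setT (g \o @fst T2 T2) by exact: measurableT_comp.
have mGn := mFK n mG.
have mgE : measurable_fun setT (EFin \o g) by exact/measurable_EFinP.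
have gE0 z : setT z -> (0 <= (g z)%:E)%E by rewrite lee_fin.
rewrite -ge0_integralZl//.
apply: ge0_le_integral => //.
- by move=> z _; apply: integral_ge0 => w _; exact: (FK0 n (fun zw => g0 zw.1) (z, w)).
- exact: (leb2_measurable_section mGn (FK0 n (fun zw => g0 zw.1))).
- exact: measurable_funeM.
move=> z _; rewrite [leRHS]muleC.
have -> : (\int[mu]_w ((g \o fst) (z, w) * box_avg n z w)%:E =
   (g z)%:E * \int[mu]_w (box_avg n z w)%:E)%E.
  have mk : measurable_fun setT (fun w => (box_avg n z w)%:E).
    apply/measurable_EFinP.
    exact: (measurableT_comp (measurable_box_avg n) (measurable_pair1 z)).
  have k0 w : setT w -> (0 <= (box_avg n z w)%:E)%E by rewrite lee_fin box_avg_ge0.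
  by rewrite -ge0_integralZl ?lee_fin.
by apply: lee_wpmul2l; [rewrite lee_fin|exact: integral_box_avg_r].
Qed.

Lemma avg2_snd n (g : T2 -> R) : measurable_fun setT g -> (forall z, 0 <= g z) ->
  (avg2 n (g \o snd) <= 4%:E * \int[mu]_z (g z)%:E)%E.
Proof.
move=> mg g0.
have mG : measurable_fun setT (g \o @snd T2 T2) by exact: measurableT_comp.
have mGn := mFK n mG.
have G0 := FK0 n (fun zw : T2 * T2 => g0 zw.2).
have mgE : measurable_fun setT (EFin \o g) by exact/measurable_EFinP.
have gE0 z : setT z -> (0 <= (g z)%:E)%E by rewrite lee_fin.
rewrite -ge0_integralZl//.
rewrite /avg2 (leb2_tonelli mGn G0).
apply: ge0_le_integral => //.
- by move=> w _; apply: integral_ge0 => z _; exact: (G0 (z, w)).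
- apply: (leb2_measurable_section (f := fun wz : T2 * T2 =>
    (g wz.1 * box_avg n wz.2 wz.1)%:E)).
    apply/measurable_EFinP; apply: measurable_funM.
      exact: (measurableT_comp mg measurable_fst).
    have msw : measurable_fun setT (fun x : T2 * T2 => (x.2, x.1)).
      exact: (measurable_fun_pair measurable_snd measurable_fst).
    exact: (measurableT_comp (measurable_box_avg n) msw).
  by move=> x; exact: (G0 (x.2, x.1)).
- exact: measurable_funeM.
move=> w _; rewrite [leRHS]muleC.
have -> : (\int[mu]_z ((g \o snd) (z, w) * box_avg n z w)%:E =
   (g w)%:E * \int[mu]_z (box_avg n z w)%:E)%E.
  have mk : measurable_fun setT (fun z => (box_avg n z w)%:E).
    apply/measurable_EFinP.
    exact: (measurableT_comp (measurable_box_avg n) (measurable_pair2 w)).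
  have k0 z : setT z -> (0 <= (box_avg n z w)%:E)%E by rewrite lee_fin box_avg_ge0.
  by rewrite -ge0_integralZl ?lee_fin.
by apply: lee_wpmul2l; [rewrite lee_fin|exact: integral_box_avg_l].
Qed.

End Oscillation.

(** * Mean oscillation over a bounded square *)

Section Vanishing.
Variable R : realType.
Local Notation T2 := (measurableTypeR R * measurableTypeR R)%type.
Local Notation mu := (leb2 R).
Implicit Types (n : nat) (V : T2 -> R) (F G : T2 * T2 -> R).

Definition vanish (a : nat -> \bar R) : Prop :=
  forall e : R, 0 < e -> exists n0, forall n, (n0 <= n)%N -> (a n <= e%:E)%E.

Lemma vanish_le a b : (forall n, (a n <= b n)%E) -> vanish b -> vanish a.
Proof.
move=> ab vb e e0; have [n0 h] := vb e e0; exists n0 => n nn.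
exact: le_trans (ab n) (h n nn).
Qed.

Lemma vanishD a b : vanish a -> vanish b -> vanish (fun n => a n + b n)%E.
Proof.
move=> va vb e e0; have e2 : 0 < e / 2 by rewrite divr_gt0.
have [n1 h1] := va _ e2; have [n2 h2] := vb _ e2; exists (maxn n1 n2) => n.
rewrite geq_max => /andP[nn1 nn2]; rewrite (splitr e) EFinD.
by apply: leeD; [exact: h1|exact: h2].
Qed.

Lemma vanishZ (c : R) a : 0 <= c -> vanish a -> vanish (fun n => c%:E * a n)%E.
Proof.
move=> c0 va e e0.
have c1 : 0 < c + 1 by rewrite ltr_wpDl.
have [n0 h] := va (e / (c + 1)) (divr_gt0 e0 c1).
exists n0 => n /h hn.
apply: (@le_trans _ _ (c%:E * (e / (c + 1))%:E)%E).
  by apply: lee_wpmul2l; rewrite ?lee_fin.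
by rewrite -EFinM lee_fin mulrA ler_pdivrMr// mulrC ler_wpM2l ?lerDl// ltW.
Qed.

Lemma vanish_cvg0 (a : nat -> \bar R) : (a @ \oo --> 0%E) -> vanish a.
Proof.
move=> /fine_cvgP[fa /cvgrPdist_le ca] e e0.
have [n1 _ h1] := fa; have [n2 _ h2] := ca _ e0.
exists (maxn n1 n2) => n; rewrite geq_max => /andP[nn1 nn2].
have := h1 n nn1 => /= fin; rewrite -(fineK fin) lee_fin.
have := h2 n nn2; rewrite /= sub0r normrN; apply: le_trans; exact: ler_norm.
Qed.

Definition cutoff (r : R) (z : T2) : R := bump r z.1 * bump r z.2.

Lemma cutoff_ge0 r z : 0 <= cutoff r z.
Proof. by rewrite mulr_ge0// bump_ge0. Qed.

Lemma cutoff_le1 r z : cutoff r z <= 1.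
Proof. by rewrite -[1]mulr1 ler_pM ?bump_ge0 ?bump_le1. Qed.

Lemma measurable_cutoff r : measurable_fun setT (cutoff r).
Proof.
apply: measurable_funM.
  exact: (measurableT_comp (measurable_bump r) measurable_fst).
exact: (measurableT_comp (measurable_bump r) measurable_snd).
Qed.

Lemma integral_cutoff (r : R) : 0 <= r ->
  (\int[mu]_z (cutoff r z)%:E = (4 * r * r)%:E)%E.
Proof.
move=> r0; rewrite -(integral_bump2 ((0, 0) : T2) r0 r0).
by apply: eq_integral => z _; rewrite /= /bump !sub0r !normrN.
Qed.

Variable N : R.

Definition oscF V (zw : T2 * T2) : R := cutoff N zw.1 * `|V zw.1 - V zw.2|.

Lemma oscF_ge0 V zw : 0 <= oscF V zw.
Proof. by rewrite mulr_ge0// cutoff_ge0. Qed.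

Lemma measurable_oscF V : measurable_fun setT V -> measurable_fun setT (oscF V).
Proof.
move=> mV; apply: measurable_funM.
  exact: (measurableT_comp (measurable_cutoff N) measurable_fst).
apply: measurableT_comp => //; apply: measurable_funB.
  exact: (measurableT_comp mV measurable_fst).
exact: (measurableT_comp mV measurable_snd).
Qed.

(** The Lebesgue point property integrated over the square [-N, N]^2, in place of a statement at
    almost every point. *)
Definition lebpt V : Prop :=
  measurable_fun setT V /\ vanish (fun n => avg2 n (oscF V)).

Lemma lebptD V V' : lebpt V -> lebpt V' -> lebpt (fun z => V z + V' z).
Proof.
move=> [mV vV] [mV' vV']; have mD := measurable_funD mV mV'.
split; first exact: mD.
apply: vanish_le (vanishD vV vV') => n.
rewrite -(avg2D n (measurable_oscF mV) (measurable_oscF mV') (oscF_ge0 V) (oscF_ge0 V')).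
apply: avg2_le; try exact: oscF_ge0.
- exact: measurable_oscF.
- by apply: measurable_funD; exact: measurable_oscF.
- by move=> zw; rewrite addr_ge0// oscF_ge0.
move=> z w _; rewrite /oscF /= -mulrDr ler_wpM2l ?cutoff_ge0//.
by rewrite opprD addrACA ler_normD.
Qed.

Lemma lebptZ (c : R) V : lebpt V -> lebpt (fun z => c * V z).
Proof.
move=> [mV vV]; split; first exact: measurable_funM.
apply: vanish_le (vanishZ (normr_ge0 c) vV) => n.
rewrite -(avg2Z n (normr_ge0 c) (measurable_oscF mV) (oscF_ge0 V)).
apply: avg2_le; try exact: oscF_ge0.
- by apply: measurable_oscF; exact: measurable_funM.
- by apply: measurable_funM => //; exact: measurable_oscF.
- by move=> zw; rewrite mulr_ge0// oscF_ge0.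
by move=> z w _; rewrite /oscF /= -mulrBr normrM mulrCA.
Qed.

Lemma lebpt_cst (c : R) : lebpt (cst c).
Proof.
split=> // e e0; exists 0%N => n _.
have -> : oscF (cst c) = (fun=> 0).
  by apply/funext => zw; rewrite /oscF subrr normr0 mulr0.
rewrite /avg2; under eq_integral do under eq_integral do rewrite mul0r.
by under eq_integral do rewrite integral0; rewrite integral0 lee_fin ltW.
Qed.

Lemma cutoff_shift n (z w : T2) : box_avg n z w != 0 -> cutoff N z <= cutoff (N + 1) w.
Proof.
move=> /box_avg_neq0[/andP[h1 h2] /andP[h3 h4]].
have d1 : n.+1%:R^-1 <= 1 :> R by rewrite invf_le1// ler1n.
have s1 : `|z.1 - w.1| <= 1 by rewrite ger0_norm ?subr_ge0// (le_trans _ d1)// lerBlDl -lerBlDr.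
have s2 : `|z.2 - w.2| <= 1 by rewrite ger0_norm ?subr_ge0// (le_trans _ d1)// lerBlDl -lerBlDr.
by apply: ler_pM; rewrite ?bump_ge0//; exact: bump_shift.
Qed.

Lemma cutoff_le z : cutoff N z <= cutoff (N + 1) z.
Proof. by apply: ler_pM; rewrite ?bump_ge0//; apply: bump_le; rewrite lerDl. Qed.

(** The increment of V is at most that of V' plus |V - V'| at both points. The point w may leave the
    square of half side N by at most 1, hence the larger cutoff. *)
Lemma lebpt_approx V : measurable_fun setT V ->
  (forall e : R, 0 < e -> exists2 V', lebpt V' &
    (\int[mu]_z (cutoff (N + 1) z * `|V z - V' z|)%:E <= e%:E)%E) -> lebpt V.
Proof.
move=> mV H; split => // e e0.
(* Each of the two error terms costs a factor 4 by [avg2_fst] and [avg2_snd], so together they take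
   e / 2. *)
have e16 : 0 < e / 16 by rewrite divr_gt0.
have [V' [mV' vV'] HV'] := H _ e16.
have e2 : 0 < e / 2 by rewrite divr_gt0.
have [n0 hn0] := vV' _ e2; exists n0 => n /hn0 hn.
pose g z := cutoff (N + 1) z * `|V z - V' z|.
have mg : measurable_fun setT g.
  apply: measurable_funM; first exact: measurable_cutoff.
  by apply: measurableT_comp => //; exact: measurable_funB.
have g0 z : 0 <= g z by rewrite mulr_ge0// cutoff_ge0.
have mg1 : measurable_fun setT (g \o @fst T2 T2) by exact: measurableT_comp.
have mg2 : measurable_fun setT (g \o @snd T2 T2) by exact: measurableT_comp.
have mo := measurable_oscF mV'.
apply: (@le_trans _ _ (avg2 n (fun zw => oscF V' zw + ((g \o fst) zw + (g \o snd) zw)))).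
  apply: avg2_le.
  - exact: measurable_oscF.
  - by apply: measurable_funD => //; exact: measurable_funD.
  - exact: oscF_ge0.
  - by move=> zw; apply: addr_ge0; [exact: oscF_ge0|apply: addr_ge0; exact: g0].
  move=> z w k0; rewrite /oscF /g /=.
  apply: (@le_trans _ _ (cutoff N z * (`|V' z - V' w| + (`|V z - V' z| + `|V w - V' w|)))).
    rewrite ler_wpM2l ?cutoff_ge0//.
    have -> : V z - V w = (V' z - V' w) + ((V z - V' z) + - (V w - V' w)) by ring.
    rewrite (le_trans (ler_normD _ _))// lerD2l.
    by rewrite (le_trans (ler_normD _ _))// normrN.
  rewrite !mulrDr lerD2l; apply: lerD; apply: ler_wpM2r => //.
    exact: cutoff_le.
  exact: cutoff_shift k0.
rewrite avg2D//; [|exact: measurable_funD|exact: oscF_ge0|by move=> zw; apply: addr_ge0; exact: g0].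
rewrite avg2D//; [|by move=> zw; exact: g0|by move=> zw; exact: g0].
have -> : e = e / 2 + (4 * (e / 16) + 4 * (e / 16)) by field.
rewrite [leRHS]EFinD; apply: leeD => //; rewrite EFinD; apply: leeD.
  apply: (le_trans (avg2_fst n mg g0)); rewrite EFinM.
  by apply: lee_wpmul2l => //; rewrite lee_fin.
apply: (le_trans (avg2_snd n mg g0)); rewrite EFinM.
by apply: lee_wpmul2l => //; rewrite lee_fin.
Qed.

End Vanishing.

(** * Mean oscillation of indicators *)

Section Sets.
Variable R : realType.
Local Notation T2 := (measurableTypeR R * measurableTypeR R)%type.
Local Notation mu := (leb2 R).
Variable N : R.
Hypothesis N0 : 0 <= N.

Lemma invS_small (e : R) : 0 < e -> exists n0, forall n, (n0 <= n)%N ->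
  n.+1%:R^-1 < e :> R.
Proof.
move=> e0; have := near_infty_natSinv_lt (PosNum e0).
by move=> [n0 _ h]; exists n0 => n /h.
Qed.

(** When y approaches x from the left, a < y ends up equivalent to a < x, even for a = x. This is
    the point of the one-sided boxes. *)
Lemma ray_stable (a x : R) : exists n0, forall n, (n0 <= n)%N -> forall y,
  x - n.+1%:R^-1 <= y <= x -> (a < y) = (a < x).
Proof.
have [ax|xa] := ltP a x; last first.
  exists 0%N => n _ y /andP[_ yx]; apply/negbTE; rewrite -leNgt.
  exact: le_trans xa.
have [n0 h] := @invS_small (x - a) (ltac:(by rewrite subr_gt0)).
exists n0 => n /h hn y /andP[xy _].
by rewrite (lt_le_trans _ xy)// ltrBrDl -ltrBrDr.
Qed.

Definition ocrect (a b c d : R) : set T2 :=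
  (`]a, b]%classic : set (measurableTypeR R)) `*`
  (`]c, d]%classic : set (measurableTypeR R)).

Lemma measurable_ocrect a b c d : measurable (ocrect a b c d).
Proof. by apply: measurableX; exact: measurable_itv. Qed.

Lemma ocrect_stable a b c d (z : T2) : exists n0, forall n, (n0 <= n)%N ->
  forall w, box_avg n z w != 0 -> \1_(ocrect a b c d) w = \1_(ocrect a b c d) z :> R.
Proof.
have [n1 h1] := ray_stable a z.1; have [n2 h2] := ray_stable b z.1.
have [n3 h3] := ray_stable c z.2; have [n4 h4] := ray_stable d z.2.
exists (maxn (maxn n1 n2) (maxn n3 n4)) => n.
rewrite !geq_max => /andP[/andP[l1 l2] /andP[l3 l4]] w /box_avg_neq0[b1 b2].
rewrite !indicE /ocrect !in_setX !mem_setE !in_itv/=.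
rewrite (h1 n l1 _ b1) (h3 n l3 _ b2) ![_ <= _]leNgt.
by rewrite (h2 n l2 _ b1) (h4 n l4 _ b2).
Qed.

(** For each z the inner integral is exactly 0 from some n on, and it is at most 4 times the cutoff,
    so dominated convergence applies. *)
Lemma lebpt_ocrect a b c d : lebpt N (\1_(ocrect a b c d) : T2 -> R).
Proof.
set V := \1_ _.
have mV : measurable_fun setT V by apply: measurable_indic; exact: measurable_ocrect.
split => //; apply: vanish_cvg0.
pose A n z := (\int[mu]_w (oscF N V (z, w) * box_avg n z w)%:E)%E.
have F0 n zw : (0 <= (EFin \o (fun zw : T2 * T2 => oscF N V zw * box_avg n zw.1 zw.2)%R) zw)%E.
  by rewrite lee_fin mulr_ge0 ?oscF_ge0 ?box_avg_ge0.
have mF n : measurable_fun setT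
    (EFin \o (fun zw : T2 * T2 => oscF N V zw * box_avg n zw.1 zw.2)).
  apply/measurable_EFinP; apply: measurable_funM; first exact: measurable_oscF.
  exact: measurable_box_avg.
have mA n : measurable_fun setT (A n) by exact: (leb2_measurable_section (mF n) (F0 n)).
have A0 n z : (0 <= A n z)%E.
  by apply: integral_ge0 => w _; exact: (F0 n (z, w)).
have Acvg z : A n z @[n --> \oo] --> 0%E.
  have [n0 h] := ocrect_stable a b c d z.
  apply: cvg_near_cst; exists n0 => //= n /= nn.
  rewrite /A; apply: integral0_eq => w _.
  have [->|k0] := eqVneq (box_avg n z w) 0; first by rewrite mulr0.
  by rewrite /oscF /= /V (h n nn w k0) subrr normr0 mulr0 mul0r.
have iq : mu.-integrable setT (fun z => (4 * cutoff N z)%:E).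
  apply/integrableP; split.
    by apply/measurable_EFinP; apply: measurable_funM => //; exact: measurable_cutoff.
  rewrite (eq_integral (fun z => 4%:E * (cutoff N z)%:E)%E); last first.
    by move=> z _; rewrite gee0_abs// lee_fin mulr_ge0// cutoff_ge0.
  rewrite ge0_integralZl//; last 2 first.
  - by apply/measurable_EFinP; exact: measurable_cutoff.
  - by move=> z _; rewrite lee_fin cutoff_ge0.
  by rewrite integral_cutoff// -EFinM ltry.
have Ale n z : (`|A n z| <= (4 * cutoff N z)%:E)%E.
  rewrite gee0_abs//; apply: (@le_trans _ _ ((cutoff N z)%:E * \int[mu]_w (box_avg n z w)%:E)%E).
    have mk : measurable_fun setT (fun w => (box_avg n z w)%:E).
      apply/measurable_EFinP.
      exact: (measurableT_comp (measurable_box_avg n) (measurable_pair1 z)).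
    have k0 w : setT w -> (0 <= (box_avg n z w)%:E)%E by rewrite lee_fin box_avg_ge0.
    rewrite -ge0_integralZl ?lee_fin ?cutoff_ge0//.
    apply: ge0_le_integral => //.
    - by move=> w _; exact: (F0 n (z, w)).
    - exact: (measurableT_comp (mF n) (measurable_pair1 z)).
    - exact: measurable_funeM.
    move=> w _; rewrite -EFinM lee_fin ler_wpM2r ?box_avg_ge0// /oscF /=.
    rewrite ler_piMr ?cutoff_ge0// /V !indicE.
    by case: (_ \in _); case: (_ \in _); rewrite ?subrr ?subr0 ?sub0r ?normrN ?normr0 ?normr1.
  rewrite (mulrC 4) [leRHS]EFinM; apply: lee_wpmul2l; first by rewrite lee_fin cutoff_ge0.
  exact: integral_box_avg_r.
have := @dominated_cvg _ _ _ mu setT measurableT A (cst 0%E)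
  (fun z => (4 * cutoff N z)%:E) mA (fun z _ => Acvg z) (fun z _ => isT) iq (fun n z _ => Ale n z).
by rewrite integral0.
Qed.

(** Monotone class argument: half-open rectangles are stable under intersection, proper differences
    follow by linearity, and increasing unions by [lebpt_approx] with dominated convergence. *)
Lemma lebpt_indic (A : set T2) : measurable A -> lebpt N (\1_A : T2 -> R).
Proof.
pose G := [set X : set T2 | exists a b c d, X = ocrect a b c d].
have GI : setI_closed G.
  move=> _ _ [a [b [c [d ->]]]] [a' [b' [c' [d' ->]]]].
  exists (Num.max a a'), (Num.min b b'), (Num.max c c'), (Num.min d d').
  apply/seteqP; split => z; rewrite /ocrect /= !in_itv/= !gt_max !le_min.
    by move=> [[/andP[-> ->] /andP[-> ->]] [/andP[-> ->] /andP[-> ->]]].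
  by move=> [/andP[/andP[-> ->] /andP[-> ->]] /andP[/andP[-> ->] /andP[-> ->]]].
pose H := [set X : set T2 | measurable X /\ lebpt N (\1_X : T2 -> R)].
have GH : G `<=` H.
  by move=> _ [a [b [c [d ->]]]]; split; [exact: measurable_ocrect|exact: lebpt_ocrect].
have lH : lambda_system setT H.
  split.
  - by move=> X _.
  - by split; [exact: measurableT|rewrite indicT; exact: lebpt_cst].
  - move=> X Y YX [mX vX] [mY vY]; split; first exact: measurableD.
    have -> : \1_(X `\` Y) = (fun z => \1_X z + -1 * \1_Y z) :> (T2 -> R).
      apply/funext => z; rewrite !indicE in_setD.
      have : z \in Y -> z \in X by rewrite !inE; exact: YX.
      case: (z \in Y); case: (z \in X) => h /=.
      - by rewrite mulr1 subrr.
      - by have := h isT.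
      - by rewrite mulr0 addr0.
      - by rewrite mulr0 addr0.
    exact: (lebptD vX (lebptZ (-1) vY)).
  - move=> F ndF HF.
    have mF n : measurable (F n) by have [] := HF n.
    have mU : measurable (\bigcup_n F n) by exact: bigcupT_measurable.
    split; first exact: mU.
    apply: lebpt_approx; first exact: measurable_indic.
    move=> e e0.
    pose V n z := \1_(\bigcup_k F k) z - \1_(F n) z : R.
    have mV n : measurable_fun setT (fun z => (cutoff (N + 1) z * `|V n z|)%:E).
      apply/measurable_EFinP; apply: measurable_funM; first exact: measurable_cutoff.
      by apply: measurableT_comp => //; apply: measurable_funB; exact: measurable_indic.
    have cV z : (cutoff (N + 1) z * `|V n z|)%:E @[n --> \oo] --> 0%E.
      have [[k _ Fk]|nU] := pselect ((\bigcup_k F k) z).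
        apply: cvg_near_cst; exists k => //= n /= kn.
        have Fn : F n z by have /subsetPset := ndF _ _ kn; apply.
        by rewrite /V !indicE !mem_set// ?subrr ?normr0 ?mulr0//; exists k.
      apply: cvg_near_cst; exists 0%N => //= n _.
      rewrite /V !indicE !memNset// ?subrr ?normr0 ?mulr0// => Fn.
      by apply: nU; exists n.
    have ic : mu.-integrable setT (fun z => (cutoff (N + 1) z)%:E).
      apply/integrableP; split; first by apply/measurable_EFinP; exact: measurable_cutoff.
      under eq_integral do rewrite gee0_abs ?lee_fin ?cutoff_ge0//.
      by rewrite integral_cutoff ?ltry// addr_ge0.
    have dV n z : (`|(cutoff (N + 1) z * `|V n z|)%:E| <= (cutoff (N + 1) z)%:E)%E.
      rewrite gee0_abs ?lee_fin ?mulr_ge0 ?cutoff_ge0// ler_piMr ?cutoff_ge0//.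
      rewrite /V !indicE.
      by case: (_ \in _); case: (_ \in _); rewrite ?subrr ?subr0 ?sub0r ?normrN ?normr0 ?normr1.
    have := @dominated_cvg _ _ _ mu setT measurableT _ (cst 0%E)
      (fun z => (cutoff (N + 1) z)%:E) mV (fun z _ => cV z) (fun z _ => isT) ic (fun n z _ => dV n z).
    rewrite integral0 => /vanish_cvg0 /(_ e e0)[n0 h].
    exists (\1_(F n0)); first by have [] := HF n0.
    exact: h.
(* Both projections are measurable for the sigma-algebra generated by the rectangles, hence so are
   all measurable products. *)
have sub : measurable `<=` <<s setT, G >>.
  pose X := g_sigma_algebraType G.
  (* The margin 1 gives the strict inequality at the open left end -n. *)
  have bnd (z : T2) : exists n : nat, `|z.1| <= n%:R - 1 /\ `|z.2| <= n%:R - 1.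
    exists (Num.bound (`|z.1| + `|z.2| + 1)).
    have : `|z.1| + `|z.2| + 1 < (Num.bound (`|z.1| + `|z.2| + 1))%:R.
      by apply: archi_boundP; rewrite !addr_ge0.
    by have := normr_ge0 z.1; have := normr_ge0 z.2; split; lra.
  have mfst : measurable_fun setT (@fst R R : X -> measurableTypeR R).
    apply: (measurability _ (RGenOInfty.measurableE R)).
    move=> _ [_ [x ->] <-]; rewrite setTI.
    have -> : (@fst R R) @^-1` `]x, +oo[ = \bigcup_n ocrect x n%:R (- n%:R) n%:R.
      apply/seteqP; split => [z|z [n _]]; rewrite /ocrect /= !in_itv/= ?andbT.
        move=> xz; have [n [h1 h2]] := bnd z; exists n => //.
        rewrite /ocrect /= !in_itv/= xz/=; move: h1 h2; rewrite !ler_norml.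
        by move=> /andP[a1 a2] /andP[b1 b2]; split; [|apply/andP; split]; lra.
      by move=> [/andP[]].
    apply: bigcupT_measurable => n; apply: sub_sigma_algebra.
    by exists x, n%:R, (- n%:R), n%:R.
  have msnd : measurable_fun setT (@snd R R : X -> measurableTypeR R).
    apply: (measurability _ (RGenOInfty.measurableE R)).
    move=> _ [_ [x ->] <-]; rewrite setTI.
    have -> : (@snd R R) @^-1` `]x, +oo[ = \bigcup_n ocrect (- n%:R) n%:R x n%:R.
      apply/seteqP; split => [z|z [n _]]; rewrite /ocrect /= !in_itv/= ?andbT.
        move=> xz; have [n [h1 h2]] := bnd z; exists n => //.
        rewrite /ocrect /= !in_itv/= xz/=; move: h1 h2; rewrite !ler_norml.
        by move=> /andP[a1 a2] /andP[b1 b2]; split; [apply/andP; split|]; lra.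
      by move=> [_ /andP[]].
    apply: bigcupT_measurable => n; apply: sub_sigma_algebra.
    by exists (- n%:R), n%:R, x, n%:R.
  rewrite measurable_prod_measurableType; apply: smallest_sub.
    exact: smallest_sigma_algebra.
  move=> _ [B mB [C mC <-]].
  have -> : B `*` C = ((@fst R R : X -> _) @^-1` B) `&` ((@snd R R : X -> _) @^-1` C) by [].
  have mB' := mfst measurableT B mB; have mC' := msnd measurableT C mC.
  rewrite !setTI in mB' mC'.
  exact: (@measurableI _ X _ _ mB' mC').
move=> mA.
have := lambda_system_subset GI lH GH.
move=> /(_ (fun _ _ => @subsetT _ _)) h.
by have [] := h A (sub A mA).
Qed.

End Sets.

(** * Mean oscillation of L^q functions *)

Section LpOscillation.
Variable R : realType.
Local Notation T2 := (measurableTypeR R * measurableTypeR R)%type.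
Local Notation mu := (leb2 R).

Import HBSimple.

Lemma lebpt_sfun (N : R) (g : {sfun T2 >-> R}) : 0 <= N -> lebpt N g.
Proof.
move=> N0.
have -> : (g : T2 -> R) =
    (fun z => \sum_(y <- finmap.enum_fset (fset_set (range g))) (y * \1_(g @^-1` [set y]) z)).
  by apply/funext => z; rewrite {1}fimfunE fsbig_finite.
elim: (X in lebpt N (fun z => \sum_(y <- X) _)) => [|y s IHs].
  have -> : (fun z : T2 => \sum_(y <- [::]) (y * \1_(g @^-1` [set y]) z)) = cst 0.
    by apply/funext => z; rewrite big_nil.
  exact: lebpt_cst.
have -> : (fun z : T2 => \sum_(y0 <- y :: s) (y0 * \1_(g @^-1` [set y0]) z)) =
   (fun z => y * \1_(g @^-1` [set y]) z + \sum_(y0 <- s) (y0 * \1_(g @^-1` [set y0]) z)).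
  by apply/funext => z; rewrite big_cons.
have my : measurable (g @^-1` [set y] : set T2) by exact: measurable_sfunP.
exact: (lebptD (lebptZ y (lebpt_indic N0 my)) IHs).
Qed.

Lemma cutoff_01 (r : R) (z : T2) : cutoff r z = 0 \/ cutoff r z = 1.
Proof.
rewrite /cutoff /bump -natrM mulnb; case: (_ && _); [by right|by left].
Qed.

Lemma in_Lp_cutoff p (r : R) : 0 < p -> 0 <= r -> in_Lp p (cutoff r : T2 -> R).
Proof.
move=> p0 r0; apply/(in_LpP _ p0); split; first exact: measurable_cutoff.
rewrite /Lp_pow; have -> : (\int[mu]_z (`|cutoff r z| `^ p)%:E = \int[mu]_z (cutoff r z)%:E)%E.
  apply: eq_integral => z _; have [->|->] := cutoff_01 r z.
    by rewrite normr0 powR0// gt_eqF.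
  by rewrite normr1 powR1.
by rewrite integral_cutoff// ltry.
Qed.

(** On the enlarged square V is integrable, since the cutoff lies in the conjugate space, and simple
    functions approximate it there in L^1. *)
Lemma lebpt_Lp q (N : R) (V : T2 -> R) : 1 < q -> 0 <= N -> in_Lp q V -> lebpt N V.
Proof.
move=> q1 N0 LV.
have q0 : 0 < q by exact: lt_trans q1.
have mV := in_Lp_measurable q0 LV.
pose p := (1 - q^-1)^-1.
have qp : q^-1 + p^-1 = 1 by rewrite /p invrK addrC subrK.
have p1 := conjugate_gt1 q1 qp.
have N10 : 0 <= N + 1 by rewrite addr_ge0.
have iV := integrable_mul q1 qp LV (in_Lp_cutoff (lt_trans ltr01 p1) N10).
have [g [ig _ cg]] := approximation_sfun_integrable measurableT iV.
apply: (lebpt_approx mV) => e e0.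
have [n0 h] := vanish_cvg0 cg e0.
exists (g n0); first exact: lebpt_sfun.
apply: (le_trans _ (h n0 (leqnn _))).
apply: ge0_le_integral => //.
- by move=> z _; rewrite lee_fin mulr_ge0// cutoff_ge0.
- apply/measurable_EFinP; apply: measurable_funM; first exact: measurable_cutoff.
  by apply: measurableT_comp => //; exact: measurable_funB.
- apply: measurableT_comp => //; apply: emeasurable_funB.
    by case/integrableP : iV.
  by case/integrableP : (ig n0).
move=> z _; rewrite -EFinB /= lee_fin.
by have [->|->] := cutoff_01 (N + 1) z; rewrite ?mul0r// mul1r mulr1.
Qed.

Lemma Lp_powZ p (c : R) (U : T2 -> R) : 0 <= c -> measurable_fun setT U ->
  Lp_pow p (fun z => c * U z) = ((c `^ p)%:E * Lp_pow p U)%E.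
Proof.
move=> c0 mU; rewrite /Lp_pow -ge0_integralZl//.
- by apply: eq_integral => z _; rewrite normrM powRM// ger0_norm// EFinM.
- by apply/measurable_EFinP; exact: measurable_normp.
- by rewrite lee_fin powR_ge0.
Qed.

Section Young.
Variables (p q : R) (U V : T2 -> R).
Hypotheses (p1 : 1 < p) (pq : p^-1 + q^-1 = 1).
Hypotheses (mU : measurable_fun setT U) (mV : measurable_fun setT V).

Let mU1 : measurable_fun setT (fun zw : T2 * T2 => `|U zw.1|).
Proof. by apply: measurableT_comp => //; exact: (measurableT_comp mU measurable_fst). Qed.
Let mV2 : measurable_fun setT (fun zw : T2 * T2 => `|V zw.2|).
Proof. by apply: measurableT_comp => //; exact: (measurableT_comp mV measurable_snd). Qed.

Definition oscU (zw : T2 * T2) : R := `|U zw.1| * `|V zw.1 - V zw.2|.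

Lemma measurable_oscU : measurable_fun setT oscU.
Proof.
apply: measurable_funM => //; apply: measurableT_comp => //; apply: measurable_funB.
  exact: (measurableT_comp mV measurable_fst).
exact: (measurableT_comp mV measurable_snd).
Qed.

(** The increment is split into V at z and V at w. The first product is handled by Young's
    inequality at one point, the second by the Schur test; each costs a factor 4. *)
Lemma avg2_young n : (avg2 n oscU <= 8%:E * (Lp_pow p U + Lp_pow q V))%E.
Proof.
pose g z := `|U z| * `|V z|.
have mg : measurable_fun setT g by apply: measurable_funM; exact: measurableT_comp.
have g0 z : 0 <= g z by exact: mulr_ge0.
have mg1 : measurable_fun setT (g \o @fst T2 T2) by exact: measurableT_comp.
pose h (zw : T2 * T2) := `|U zw.1| * `|V zw.2|.
have mh : measurable_fun setT h by exact: measurable_funM.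
have h0 zw : 0 <= h zw by exact: mulr_ge0.
apply: (@le_trans _ _ (avg2 n (fun zw => (g \o fst) zw + h zw))).
  apply: avg2_le.
  - exact: measurable_oscU.
  - exact: measurable_funD.
  - by move=> zw; exact: mulr_ge0.
  - by move=> zw; apply: addr_ge0; [exact: g0|exact: h0].
  move=> z w _; rewrite /oscU /g /h /= -mulrDr ler_wpM2l//.
  exact: ler_normB.
rewrite avg2D//; last by move=> zw; exact: g0.
have -> : (8%:E * (Lp_pow p U + Lp_pow q V) = 4%:E * (Lp_pow p U + Lp_pow q V) + 4%:E * (Lp_pow p U + Lp_pow q V))%E.
  rewrite -ge0_muleDl ?lee_fin// -EFinD; congr (_%:E * _)%E; ring.
apply: leeD.
  apply: (le_trans (avg2_fst n mg g0)); apply: lee_wpmul2l; first by rewrite lee_fin.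
  apply: le_trans (le_integral_mul p1 pq mU mV).
  by rewrite le_eqVlt; apply/orP; left; apply/eqP; apply: eq_integral => z _;
    rewrite /g -normrM.
pose d : R := n.+1%:R^-1.
have d0 : 0 <= d by rewrite invr_ge0.
pose K (zw : T2 * T2) := bump d (zw.1.1 - zw.2.1) * bump d (zw.1.2 - zw.2.2).
have mK : measurable_fun setT K by apply: measurable_kernel; exact: measurable_bump.
have mhK : measurable_fun setT (EFin \o (fun zw => h zw * K zw)).
  by apply/measurable_EFinP; exact: measurable_funM.
have hK0 zw : (0 <= (EFin \o (fun zw => h zw * K zw)%R) zw)%E.
  by rewrite lee_fin mulr_ge0// mulr_ge0// bump_ge0.
have mhB : measurable_fun setT (EFin \o (fun zw : T2 * T2 => h zw * box_avg n zw.1 zw.2)).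
  by apply/measurable_EFinP; apply: measurable_funM => //; exact: measurable_box_avg.
have hB0 zw : (0 <= (EFin \o (fun zw : T2 * T2 => h zw * box_avg n zw.1 zw.2)%R) zw)%E.
  by rewrite lee_fin mulr_ge0// box_avg_ge0.
(* The normalization of [box_avg] cancels the area 4 d^2 given by the Schur test. *)
have -> : 4 = n.+1%:R ^+ 2 * (4 * d * d) :> R.
  by rewrite /d; field; rewrite addrC natr1 pnatr_eq0.
have n20 : 0 <= n.+1%:R ^+ 2 :> R by exact: sqr_ge0.
rewrite EFinM -muleA; apply: (le_trans _ (lee_wpmul2l _ (schur p1 pq d0 d0 mU mV))); last first.
  by rewrite lee_fin.
rewrite -ge0_integralZl//; last 2 first.
- exact: (leb2_measurable_section mhK hK0).
- by move=> z _; apply: integral_ge0 => w _; exact: (hK0 (z, w)).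
apply: ge0_le_integral => //.
- by move=> z _; apply: integral_ge0 => w _; exact: (hB0 (z, w)).
- exact: (leb2_measurable_section mhB hB0).
- by apply: measurable_funeM; exact: (leb2_measurable_section mhK hK0).
move=> z _; rewrite -ge0_integralZl//; last 2 first.
- exact: (measurableT_comp mhK (measurable_pair1 z)).
- by move=> w _; exact: (hK0 (z, w)).
apply: ge0_le_integral => //.
- by move=> w _; exact: (hB0 (z, w)).
- exact: (measurableT_comp mhB (measurable_pair1 z)).
- by apply: measurable_funeM; exact: (measurableT_comp mhK (measurable_pair1 z)).
move=> w _; rewrite -EFinM lee_fin.
by rewrite [leRHS]mulrCA; apply: ler_wpM2l; [exact: h0|exact: box_avg_le].
Qed.

End Young.
End LpOscillation.

Section TruncatedOscillation.
Variable R : realType.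
Local Notation T2 := (measurableTypeR R * measurableTypeR R)%type.
Local Notation mu := (leb2 R).
Variables (p q N : R) (U V : T2 -> R).
Hypotheses (p1 : 1 < p) (pq : p^-1 + q^-1 = 1) (N0 : 0 <= N).
Hypotheses (LU : in_Lp p U) (LV : in_Lp q V).
Hypothesis UN : forall z, U z = U z * cutoff N z.

Let p0 : 0 < p := lt_trans ltr01 p1.
Let q1 : 1 < q := conjugate_gt1 p1 pq.
Let q0 : 0 < q := lt_trans ltr01 q1.
Let mU := in_Lp_measurable p0 LU.
Let mV := in_Lp_measurable q0 LV.

Let big (k : nat) (z : T2) : R := (k%:R < `|U z|)%R%:R.

Let big01 k z : 0 <= big k z <= 1.
Proof. by rewrite /big ler0n lern1 leq_b1. Qed.

Let measurable_big k : measurable_fun setT (big k).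
Proof.
have -> : big k = \1_[set z | k%:R < `|U z|].
  apply/funext => z; rewrite /big indicE; congr ((nat_of_bool _)%:R).
  by apply/idP/idP; rewrite inE.
apply: measurable_indic; rewrite -[X in measurable X]setTI.
have mn : measurable_fun setT (fun z => `|U z|) by exact: measurableT_comp.
have -> : [set z : T2 | k%:R < `|U z|] = (fun z => `|U z|) @^-1` `]k%:R, +oo[.
  by apply/seteqP; split => z /=; rewrite in_itv/= andbT.
exact: mn.
Qed.

(** The part of U where |U| exceeds k. *)
Let U2 k z := U z * big k z.

Let mU2 k : measurable_fun setT (U2 k).
Proof. by apply: measurable_funM => //; exact: measurable_big. Qed.

Let tail_small (e : R) : 0 < e -> exists k, (Lp_pow p (U2 k) <= e%:E)%E.
Proof.
move=> e0.
have [_ fU] := (in_LpP _ p0).1 LU.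
have m k : measurable_fun setT (fun z => (`|U2 k z| `^ p)%:E).
  by apply/measurable_EFinP; exact: measurable_normp.
have cv z : (`|U2 k z| `^ p)%:E @[k --> \oo] --> 0%E.
  apply: cvg_near_cst; exists (Num.bound `|U z|) => //= k /= kn.
  rewrite /U2 /big ltNge (_ : `|U z| <= k%:R).
    by rewrite mulr0 normr0 powR0// gt_eqF.
  have := archi_boundP (normr_ge0 (U z)) => /ltW /le_trans; apply.
  by rewrite ler_nat.
have iU : mu.-integrable setT (fun z => (`|U z| `^ p)%:E).
  apply/integrableP; split; first by apply/measurable_EFinP; exact: measurable_normp.
  apply: le_lt_trans fU; rewrite le_eqVlt; apply/orP; left; apply/eqP.
  by apply: eq_integral => z _; rewrite gee0_abs// lee_fin powR_ge0.
have dm k z : (`|(`|U2 k z| `^ p)%:E| <= (`|U z| `^ p)%:E)%E.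
  rewrite gee0_abs ?lee_fin ?powR_ge0//; apply: ge0_ler_powR; rewrite ?nnegrE//; first exact: ltW.
  by have /andP[b0 b1] := big01 k z; rewrite normrM (ger0_norm b0) ler_piMr.
have := @dominated_cvg _ _ _ mu setT measurableT _ (cst 0%E)
      (fun z => (`|U z| `^ p)%:E) m (fun z _ => cv z) (fun z _ => isT) iU (fun n z _ => dm n z).
rewrite integral0 => /vanish_cvg0 /(_ e e0)[n0 h].
by exists n0; exact: h.
Qed.

(** Where |U| is at most k, the weight is at most k times the cutoff and the L^1 oscillation of V
    suffices; the part above k is small in L^p uniformly in n. The index n is chosen after k. *)
Lemma vanish_oscU : vanish (fun n => avg2 n (oscU U V)).
Proof.
move=> e e0.
have [_ fV] := (in_LpP _ q0).1 LV.
have [b bE] : exists b : R, Lp_pow q V = b%:E.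
  by exists (fine (Lp_pow q V)); rewrite fineK// ge0_fin_numE ?Lp_pow_ge0.
have b0 : 0 <= b by rewrite -lee_fin -bE Lp_pow_ge0.
(* Replacing [U], [V] by [s^-1 U], [s V] makes the contribution of [V] to Young's
   inequality small; that of [U] is a small tail. *)
pose s : R := (e / (24 * (b + 1))) `^ q^-1.
have c0 : 0 < e / (24 * (b + 1)) by rewrite divr_gt0// mulr_gt0// ltr_wpDl.
have s0 : 0 < s by rewrite powR_gt0.
have sq : s `^ q = e / (24 * (b + 1)).
  by rewrite /s -powRrM mulVf ?gt_eqF// powRr1// ltW.
pose t := s^-1.
have t0 : 0 < t by rewrite invr_gt0.
have tp0 : 0 < t `^ p by rewrite powR_gt0.
have [k hk] := @tail_small (e / (24 * t `^ p)) (ltac:(by rewrite divr_gt0// mulr_gt0)).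
have [_ vV] := lebpt_Lp q1 N0 LV.
have [n0 hn0] := vanishZ (ler0n _ k) vV (ltac:(by rewrite divr_gt0) : 0 < e / 3).
exists n0 => n /hn0 hn.
pose F1 (zw : T2 * T2) := k%:R * oscF N V zw.
have mF1 : measurable_fun setT F1 by apply: measurable_funM => //; exact: measurable_oscF.
pose F2 := oscU (fun z => t * U2 k z) (fun z => s * V z).
have mtU : measurable_fun setT (fun z => t * U2 k z) by exact: measurable_funM.
have msV : measurable_fun setT (fun z => s * V z) by exact: measurable_funM.
have mF2 : measurable_fun setT F2 by exact: measurable_oscU.
have F10 zw : 0 <= F1 zw by rewrite mulr_ge0// oscF_ge0.
have F20 zw : 0 <= F2 zw by exact: mulr_ge0.
apply: (@le_trans _ _ (avg2 n (fun zw => F1 zw + F2 zw))).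
  apply: avg2_le.
  - exact: measurable_oscU.
  - exact: measurable_funD.
  - by move=> zw; exact: mulr_ge0.
  - by move=> zw; exact: addr_ge0.
  move=> z w _; rewrite /F1 /F2 /oscF /oscU /=.
  rewrite -mulrBr !normrM (gtr0_norm t0) (gtr0_norm s0).
  have -> : t * (`|U z| * `|big k z|) * (s * `|V z - V w|) =
     (t * s) * (`|U z| * `|big k z|) * `|V z - V w| by ring.
  rewrite mulVf ?gt_eqF// mul1r mulrA -mulrDl ler_wpM2r//.
  rewrite {1}UN normrM (ger0_norm (cutoff_ge0 _ _)).
  rewrite /big; case: (ltP k%:R `|U z|) => [_|Uk].
    rewrite normr1 mulr1 ler_wpDl// ?mulr_ge0// ?cutoff_ge0//.
    by rewrite ler_piMr// cutoff_le1.
  by rewrite normr0 mulr0 addr0 ler_wpM2r ?cutoff_ge0.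
rewrite avg2D//.
(* The 8 is the constant of [avg2_young]; it dictates the 24 in the choices of [s] and of the
   tail. *)
have -> : e = e / 3 + (8 * (e / 24) + 8 * (e / 24)) by field.
rewrite [leRHS]EFinD; apply: leeD.
  by rewrite avg2Z//; [exact: measurable_oscF|move=> zw; exact: oscF_ge0].
apply: (le_trans (avg2_young p1 pq mtU msV n)).
rewrite -mulrDr EFinM; apply: lee_wpmul2l; first by rewrite lee_fin.
rewrite EFinD; apply: leeD.
  rewrite (Lp_powZ p (ltW t0) (mU2 k)); apply: (le_trans (lee_wpmul2l _ hk)).
    by rewrite lee_fin ltW.
  have tpn : t `^ p != 0 by rewrite gt_eqF.
  by rewrite -EFinM lee_fin le_eqVlt; apply/orP; left; apply/eqP; field.
rewrite (Lp_powZ q (ltW s0) mV) bE -EFinM lee_fin sq.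
have b1 : 0 < b + 1 by rewrite ltr_wpDl.
have -> : e / (24 * (b + 1)) * b = e / 24 * (b / (b + 1)).
  by field; rewrite gt_eqF.
rewrite ler_piMr ?divr_ge0 ?(ltW e0)//.
by rewrite ler_pdivrMr// mul1r lerDl.
Qed.

End TruncatedOscillation.

(** * Weakly convergent sequences are bounded *)

Section Hump.
Variable R : realType.

Lemma limit_dist (P : nat -> R) (L c : R) (k : nat) :
  P @ \oo --> L -> (forall m, (k <= m)%N -> `|P m - P k| <= c) -> `|L - P k| <= c.
Proof.
move=> /cvgrPdist_le PL H; apply/ler_addgt0Pr => e e0.
have [m0 _ h] := PL e e0; pose m := maxn m0 k.
have h1 : `|L - P m| <= e by apply: h; exact: leq_maxl.
have h2 : `|P m - P k| <= c by apply: H; exact: leq_maxr.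
rewrite -[L](subrK (P m)) -addrA addrC.
by rewrite (le_trans (ler_normD _ _))// addrC addrC lerD.
Qed.

Variables (T : Type) (D : T -> Prop) (nm : T -> R) (add : R -> T -> T -> T).
Hypothesis nm_ge0 : forall g, 0 <= nm g.

(** [D] stands for membership in L^p, [nm] for its norm and [add a g h] for a g + h; the hump
    argument uses nothing else about the space. *)
Definition functional (l : T -> R) : Prop :=
  (forall a g h, D g -> D h -> l (add a g h) = a * l g + l h) /\
  exists C, forall g, D g -> `|l g| <= C * nm g.

(* The signs in the series of functionals are chosen one after
   the other so that the k-th term cannot cancel the preceding partial sum. *)
Lemma gliding_hump (f : nat -> T) (l : nat -> T -> R) :
  (forall n, D (f n)) ->
  (forall n a g h, D g -> D h -> l n (add a g h) = a * l n g + l n h) ->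
  (forall n g, D g -> `|l n g| <= nm g) ->
  (forall n, l n (f n) = nm (f n)) ->
  (forall L, functional L -> exists B, forall n, `|L (f n)| <= B) ->
  exists C, forall n, nm (f n) <= C.
Proof.
move=> Df linl lel lf bnd; apply: contrapT => unb.
(* Growth 4^k against weights 3^-k makes the k-th term of the series exceed (4/3)^k on its own
   vector. *)
have unb' k : exists n, (4 ^+ k < nm (f n) :> R).
  apply: contrapT => h; apply: unb; exists (4 ^+ k) => n.
  by rewrite leNgt; apply/negP => hn; apply: h; exists n.
have [nn Hn] := choice unb'.
pose P := fix P (k : nat) : T -> R := fun g => if k is k'.+1 then
  P k' g + (if 0 <= P k' (f (nn k')) then 1 else -1) * (3^-1 ^+ k' * l (nn k') g) else 0.
have step k g : D g -> `|P k.+1 g - P k g| <= 3^-1 ^+ k * nm g.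
  move=> Dg; rewrite /= addrC addKr normrM.
  have -> : `|(if 0 <= P k (f (nn k)) then 1 else -1) : R| = 1.
    by case: ifP; rewrite ?normrN normr1.
  rewrite mul1r normrM ger0_norm ?exprn_ge0 ?invr_ge0//.
  by rewrite ler_wpM2l ?exprn_ge0 ?invr_ge0// lel.
have linP k a g h : D g -> D h -> P k (add a g h) = a * P k g + P k h.
  move=> Dg Dh; elim: k => [|k IHk]; first by rewrite /= mulr0 addr0.
  rewrite /= IHk linl//; ring.
(* 3/2 times 3^-k is the sum of the geometric series started at k. *)
have tail k m g : D g -> (k <= m)%N -> `|P m g - P k g| <= 3 / 2 * 3^-1 ^+ k * nm g.
  move=> Dg /subnKC <-; move: (m - k)%N => j.
  suff h : `|P (k + j)%N g - P k g| <= 3 / 2 * (3^-1 ^+ k - 3^-1 ^+ (k + j)) * nm g.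
    apply: (le_trans h); rewrite ler_wpM2r// ler_wpM2l// ?divr_ge0//.
    by rewrite gerBl exprn_ge0// invr_ge0.
  elim: j => [|j IHj]; first by rewrite addn0 !subrr normr0 mulr0 mul0r.
  rewrite addnS -[P _.+1 g](subrK (P (k + j)%N g)) -addrA.
  apply: (le_trans (ler_normD _ _)); apply: (le_trans (lerD (step _ _ Dg) IHj)).
  rewrite -mulrDl ler_wpM2r// exprS; lra.
have cvgP g : D g -> cvg (P ^~ g @ \oo).
  move=> Dg.
  apply: cauchy_cvg; apply: cauchy_exP => e e0.
  have c0 : 0 < e / (3 / 2 * nm g + 1).
    by rewrite divr_gt0// ltr_wpDl// mulr_ge0// divr_ge0.
  have lt1 : `|3^-1 : R| < 1 by rewrite ger0_norm ?invr_ge0// invf_lt1// ltr1n.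
  have /cvgrPdist_lt /(_ _ c0)[k _ hk] := cvg_expr lt1.
  exists (P k g); exists k => // m /= km; rewrite /ball/= distrC.
  apply: (le_lt_trans (tail k m g Dg km)).
  have := hk k (leqnn k); rewrite /= sub0r normrN ger0_norm ?exprn_ge0 ?invr_ge0//.
  rewrite ltr_pdivlMr; last by rewrite ltr_wpDl// mulr_ge0// divr_ge0.
  have : 0 < 3^-1 ^+ k :> R by rewrite exprn_gt0// invr_gt0.
  by move: (3^-1 ^+ k) => x x0; rewrite mulrDr mulr1; nra.
pose L g := lim (P ^~ g @ \oo).
have LP g : D g -> P ^~ g @ \oo --> L g by exact: cvgP.
have Ltail k g : D g -> `|L g - P k g| <= 3 / 2 * 3^-1 ^+ k * nm g.
  by move=> Dg; apply: (limit_dist (LP g Dg)) => m; exact: tail.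
have FL : functional L.
  split => [a g h Dg Dh|]; last first.
    exists (3 / 2) => g Dg; have := Ltail 0%N g Dg.
    by rewrite /= subr0 expr0 mulr1.
  apply/cvg_lim => //.
  have -> : P ^~ (add a g h) = (fun k => a * P k g + P k h).
    by apply/funext => k; exact: linP.
  by apply: cvgD; [apply: cvgMr; exact: LP|exact: LP].
have [B HB] := bnd L FL.
(* By the choice of sign the partial sum through the k-th term is at least that term in absolute
   value; the remaining tail is at most half of it. *)
have low k : 1 / 2 * (4 / 3) ^+ k <= B.
  apply: le_trans (HB (nn k)); set g := f (nn k).
  have Dg : D g by exact: Df.
  have h1 : 3^-1 ^+ k * nm g <= `|P k.+1 g|.
    rewrite /= -/g lf -/g.
    have x0 : 0 <= 3^-1 ^+ k * nm g by rewrite mulr_ge0// exprn_ge0// invr_ge0.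
    case: ifPn => [P0|]; first by rewrite mul1r ger0_norm ?addr_ge0// lerDr.
    rewrite -ltNge => P0; rewrite mulN1r ler0_norm; first by lra.
    by lra.
  have h2 := Ltail k.+1 g Dg.
  have h3 : 3 / 2 * 3^-1 ^+ k.+1 * nm g = 1 / 2 * (3^-1 ^+ k * nm g).
    by rewrite exprS; field.
  rewrite h3 in h2.
  have h4 : (4 / 3) ^+ k <= 3^-1 ^+ k * nm g.
    by rewrite exprMn mulrC ler_wpM2l ?exprn_ge0 ?invr_ge0// ltW.
  have h5 : `|P k.+1 g| <= `|L g - P k.+1 g| + `|L g|.
    rewrite -[`|L g - _|]normrN opprB; apply: le_trans (ler_normD _ _).
    by rewrite subrK.
  lra.
have bern k : 1 + k%:R / 3 <= (4 / 3) ^+ k :> R.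
  elim: k => [|k IHk]; first by rewrite mul0r addr0 expr0.
  rewrite exprS -natr1; have k0 : 0 <= k%:R :> R by exact: ler0n.
  nra.
(* Half of k/3 exceeds |B| as soon as k > 6 |B|. *)
have := low (Num.bound (6 * `|B|)); have := bern (Num.bound (6 * `|B|)).
have : 6 * `|B| < (Num.bound (6 * `|B|))%:R by apply: archi_boundP; rewrite mulr_ge0.
have := ler_norm B; lra.
Qed.

End Hump.

(** * Duality between L^p and L^q *)

Section WeakBounded.
Variable R : realType.
Local Notation T2 := (measurableTypeR R * measurableTypeR R)%type.
Local Notation mu := (leb2 R).
Implicit Types (p q : R) (f g h : T2 -> R).

Definition Lp_normr p f : R := fine (Lp_norm p f).

Lemma Lp_normrE p f : 0 < p -> in_Lp p f -> Lp_norm p f = (Lp_normr p f)%:E.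
Proof.
move=> p0 Lf; rewrite /Lp_normr fineK// ge0_fin_numE; last exact: Lnorm_ge0.
by have [_ fl] := (in_LpP _ p0).1 Lf; rewrite Lp_normE poweR_lty.
Qed.

Lemma Lp_normr_ge0 p f : 0 <= Lp_normr p f.
Proof. by rewrite /Lp_normr fine_ge0// Lnorm_ge0. Qed.

Lemma Lp_pow_normr p f : 0 < p -> in_Lp p f -> Lp_pow p f = (Lp_normr p f `^ p)%:E.
Proof.
move=> p0 Lf; rewrite -poweR_EFin -Lp_normrE// Lp_normE -poweRrM mulVf ?gt_eqF//.
by rewrite poweRe1// Lp_pow_ge0.
Qed.

Lemma hoelder_Rintegral p q f g : 1 < p -> p^-1 + q^-1 = 1 ->
  in_Lp p f -> in_Lp q g -> `|\int[mu]_z (f z * g z)| <= Lp_normr p f * Lp_normr q g.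
Proof.
move=> p1 pq Lf Lg.
have p0 : 0 < p by exact: lt_trans p1.
have q0 : 0 < q by apply: lt_trans (conjugate_gt1 p1 pq).
have mf := in_Lp_measurable p0 Lf; have mg := in_Lp_measurable q0 Lg.
have := hoelder mu mf mg p0 q0 pq.
rewrite -/(Lp_norm p f) -/(Lp_norm q g) !Lp_normrE// Lnorm1 -EFinM => H.
apply: (normr_Rintegral_le _ H); exact: measurable_funM.
Qed.

Lemma Lp_dual_integral p q g : 1 < p -> p^-1 + q^-1 = 1 -> in_Lp q g ->
  Lp_dual p (fun f : R * R -> R => \int[mu]_z (f z * g z)).
Proof.
move=> p1 pq Lg; have p0 : 0 < p by exact: lt_trans p1.
split => [a f h Lf Lh|]; last first.
  exists (Lp_normr q g) => f Lf; rewrite Lp_normrE// -EFinM lee_fin mulrC.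
  exact: hoelder_Rintegral.
have i1 := integrable_mul p1 pq Lf Lg; have i2 := integrable_mul p1 pq Lh Lg.
rewrite -RintegralZl// -RintegralD//; last exact: (integrableZl measurableT a i1).
by apply: eq_Rintegral => z _; rewrite mulrDl mulrA.
Qed.

(** Explicit in place of Hahn-Banach: h = f |f|^(p-2) satisfies f h = |f|^p = |h|^q, so the integral
    against h, divided by the norm of h, norms f. *)
Lemma norming_functional p f : 1 < p -> in_Lp p f -> exists l : (T2 -> R) -> R,
  [/\ forall (a : R) g h, in_Lp p g -> in_Lp p h ->
        l (fun z => a * g z + h z) = a * l g + l h,
      forall g, in_Lp p g -> `|l g| <= Lp_normr p g & l f = Lp_normr p f].
Proof.
move=> p1 Lf.
have p0 : 0 < p by exact: lt_trans p1.
pose q := (1 - p^-1)^-1.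
have pq : p^-1 + q^-1 = 1 by rewrite /q invrK addrC subrK.
have q1 := conjugate_gt1 p1 pq.
have q0 : 0 < q by exact: lt_trans q1.
have mf := in_Lp_measurable p0 Lf.
have [f0|f0] := eqVneq (Lp_normr p f) 0.
  exists (fun=> 0); split => [a g h _ _|g _|]; rewrite ?mulr0 ?addr0 ?f0//.
  by rewrite normr0 Lp_normr_ge0.
pose h z := f z * `|f z| `^ (p - 2).
have mh : measurable_fun setT h by apply: measurable_funM => //; exact: measurable_normp.
have fh z : f z * h z = `|f z| `^ p.
  rewrite /h mulrA -expr2 -real_normK ?num_real//.
  have [->|fz] := eqVneq (f z) 0.
    by rewrite normr0 expr0n mul0r powR0// gt_eqF.
  rewrite -powR_mulrn// -powRD ?normr_eq0 ?fz ?implybT//; congr (_ `^ _); lra.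
have pq2 : (p - 1) * q = p.
  have pn0 : p != 0 by rewrite gt_eqF.
  have p1n0 : p - 1 != 0 by rewrite gt_eqF// subr_gt0.
  by rewrite /q; field; rewrite pn0 p1n0.
have hq z : `|h z| `^ q = `|f z| `^ p.
  have [fz|fz] := eqVneq (f z) 0.
    by rewrite /h fz mul0r normr0 !powR0// gt_eqF.
  have -> : `|h z| = `|f z| `^ (p - 1).
    rewrite /h normrM (ger0_norm (powR_ge0 _ _)) -{1}[`|f z|]powRr1//.
    by rewrite -powRD ?normr_eq0 ?fz ?implybT//; congr (_ `^ _); lra.
  by rewrite -powRrM pq2.
have Ih : Lp_pow q h = Lp_pow p f by apply: eq_integral => z _; rewrite hq.
have Lh : in_Lp q h.
  by apply/(in_LpP _ q0); split => //; rewrite Ih; have [] := (in_LpP _ p0).1 Lf.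
have nh : Lp_normr q h = Lp_normr p f `^ (p / q).
  by rewrite /Lp_normr Lp_normE Ih Lp_pow_normr// poweR_EFin /= -powRrM.
have n0 : 0 < Lp_normr p f by rewrite lt0r f0 Lp_normr_ge0.
have nh0 : 0 < Lp_normr q h by rewrite nh powR_gt0.
have [linh _] := Lp_dual_integral p1 pq Lh.
exists (fun g => (Lp_normr q h)^-1 * \int[mu]_z (g z * h z)); split.
- by move=> a g k Lg Lk; rewrite linh//; ring.
- move=> g Lg; rewrite normrM normfV (gtr0_norm nh0) ler_pdivrMl// mulrC.
  exact: hoelder_Rintegral.
- under eq_Rintegral do rewrite fh.
  have -> : \int[mu]_z (`|f z| `^ p) = Lp_normr p f `^ p.
    by rewrite /Rintegral -/(Lp_pow p f) Lp_pow_normr.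
  rewrite nh -powRN -powRD ?f0 ?implybT//.
  (* The norm of h is that of f to the power p / q, and p - p / q = 1 by conjugacy. *)
  have -> : - (p / q) + p = 1.
    have -> : q^-1 = 1 - p^-1 by rewrite -pq addrAC subrr add0r.
    by rewrite mulrBr mulr1 divff ?gt_eqF//; lra.
  by rewrite powRr1// ltW.
Qed.

Lemma weak_cvg0_bounded p (f : nat -> R * R -> R) : 1 < p -> weak_cvg0 p f ->
  exists2 C : R, 0 <= C & forall n, (Lp_pow p (f n) <= C%:E)%E.
Proof.
move=> p1 [Lf wf].
have p0 : 0 < p by exact: lt_trans p1.
have [l Hl] := choice (fun n => norming_functional p1 (Lf n)).
have [C HC] : exists C, forall n, Lp_normr p (f n) <= C.
  apply: (@gliding_hump R (T2 -> R) (fun g => in_Lp p g) (Lp_normr p)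
    (fun a g h z => a * g z + h z) (@Lp_normr_ge0 p) f l) => //.
  - by move=> n a g h Lg Lh; have [h1 _ _] := Hl n; exact: h1.
  - by move=> n g Lg; have [_ h2 _] := Hl n; exact: h2.
  - by move=> n; have [_ _ h3] := Hl n.
  move=> L [linL [C HC]].
  (* An abstract functional is an element of the dual, so weak convergence makes its values along
     [f] converge, hence stay bounded. *)
  have dL : Lp_dual p (L : (R * R -> R) -> R).
    split => //; exists C => g Lg; rewrite Lp_normrE// -EFinM lee_fin; exact: HC.
  have cL := wf L dL.
  have /cvg_seq_bounded[M [_ HM]] : cvgn (fun n => L (f n)) by apply/cvg_ex; exists 0.
  exists (M + 1) => n; apply: HM => //; by rewrite ltrDl.
exists (C `^ p); first exact: powR_ge0.
move=> n; rewrite Lp_pow_normr// lee_fin ge0_ler_powR ?nnegrE ?Lp_normr_ge0 ?(ltW p0)//.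
exact: le_trans (Lp_normr_ge0 _ _) (HC n).
Qed.

End WeakBounded.

(** * The three parts of the integral *)

Section Approx.
Variable R : realType.
Local Notation T2 := (measurableTypeR R * measurableTypeR R)%type.
Local Notation mu := (leb2 R).
Variables (p q : R).
Hypotheses (p1 : 1 < p) (pq : p^-1 + q^-1 = 1).
Let p0 : 0 < p := lt_trans ltr01 p1.
Let q1 : 1 < q := conjugate_gt1 p1 pq.
Let q0 : 0 < q := lt_trans ltr01 q1.
Let qp : q^-1 + p^-1 = 1. Proof. by rewrite addrC. Qed.

Lemma conv_weak_cvg0 (v : nat -> T2 -> R) (a b : R -> R) (z : T2) :
  test1 a -> test1 b -> weak_cvg0 q v -> (fun n => conv (v n) a b z) @ \oo --> (0 : R).
Proof.
move=> ca cb [_ wv].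
have [A [r [A0 r0 Ha]]] := test1_boxed ca; have [B [r' [B0 r'0 Hb]]] := test1_boxed cb.
exact: wv _ (Lp_dual_integral q1 qp (in_Lp_kernel z p0 r0 r'0 Ha Hb)).
Qed.

Lemma normr_conv_le (V : T2 -> R) (a b : R -> R) (A r B r' D : R) (z : T2) :
  0 <= r -> 0 <= r' -> boxed A r a -> boxed B r' b ->
  in_Lp q V -> (Lp_pow q V <= D%:E)%E ->
  `|conv V a b z| <= D + (`|A| * `|B|) `^ p * (4 * r * r').
Proof.
move=> r0 r'0 Ha Hb LV HD.
have mV := in_Lp_measurable q0 LV.
have [ma _] := Ha; have [mb _] := Hb.
apply: normr_Rintegral_le.
  by apply: measurable_funM => //; exact: measurable_kernel_r.
apply: (le_trans (le_integral_mul q1 qp mV (measurable_kernel_r z ma mb))).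
by rewrite EFinD; apply: leeD => //; exact: Lp_pow_kernel.
Qed.

(** On the fixed square the convolutions tend to 0 pointwise and boundedly, hence in L^q; they are
    then paired with the bounded sequence [u]. *)
Lemma conv_weak_small (u v : nat -> T2 -> R) (psi : T2 -> R) (a b : R -> R)
    (C M N : R) : test1 a -> test1 b -> 0 <= N -> 0 <= C ->
  (forall n, in_Lp p (u n)) -> (forall n, (Lp_pow p (u n) <= C%:E)%E) ->
  weak_cvg0 q v -> (forall n, (Lp_pow q (v n) <= C%:E)%E) ->
  measurable_fun setT psi -> (forall z, `|psi z| <= M * cutoff N z) ->
  forall e, 0 < e -> exists n0, forall n, (n0 <= n)%N ->
    `|\int[mu]_z (u n z * conv (v n) a b z * psi z)| <= e.
Proof.
move=> ca cb N0 C0 Lu uC wv vC mpsi psiM e e0.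
have [Lv _] := wv.
have [A [r [A0 r0 Ha]]] := test1_boxed ca; have [B [r' [B0 r'0 Hb]]] := test1_boxed cb.
pose K := C + (`|A| * `|B|) `^ p * (4 * r * r').
have mu_ n : measurable_fun setT (u n) by exact: in_Lp_measurable p0 (Lu n).
have mc n : measurable_fun setT (conv (v n) a b).
  by apply: measurable_conv; [exact: in_Lp_measurable q0 (Lv n)|case: Ha|case: Hb].
pose w n z := conv (v n) a b z * psi z.
have mw n : measurable_fun setT (w n) by exact: measurable_funM.
have wK n z : `|w n z| <= (K * M) * cutoff N z.
  rewrite normrM -mulrA; apply: ler_pM => //.
  by apply: normr_conv_le.
have small : vanish (fun n => Lp_pow q (w n)).
  apply: vanish_cvg0.
  have m n : measurable_fun setT (fun z => (`|w n z| `^ q)%:E).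
    by apply/measurable_EFinP; exact: measurable_normp.
  have cv z : (`|w n z| `^ q)%:E @[n --> \oo] --> 0%E.
    apply: cvg_EFin; first by near=> n.
    have wz : w n z @[n --> \oo] --> (0 : R).
      rewrite -[X in _ --> X](mul0r (psi z)).
      by apply: cvgMl; exact: conv_weak_cvg0.
    apply/cvgrPdist_le => d d0.
    have dq : 0 < d `^ q^-1 by rewrite powR_gt0.
    move/cvgrPdist_le : wz => /(_ _ dq); apply: filterS => n /=.
    rewrite !sub0r !normrN => h; rewrite ger0_norm ?powR_ge0//.
    have -> : d = (d `^ q^-1) `^ q by rewrite -powRrM mulVf ?gt_eqF// powRr1// ltW.
    by apply: ge0_ler_powR; rewrite ?nnegrE ?powR_ge0// ltW.
  have ic : mu.-integrable setT (fun z => ((`|K * M| `^ q) * cutoff N z)%:E).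
    apply/integrableP; split.
      by apply/measurable_EFinP; apply: measurable_funM => //; exact: measurable_cutoff.
    rewrite (eq_integral (fun z => (`|K * M| `^ q)%:E * (cutoff N z)%:E)%E); last first.
      by move=> z _; rewrite gee0_abs// lee_fin mulr_ge0 ?powR_ge0// cutoff_ge0.
    rewrite ge0_integralZl//; last 2 first.
    - by apply/measurable_EFinP; exact: measurable_cutoff.
    - by move=> z _; rewrite lee_fin cutoff_ge0.
    by rewrite integral_cutoff// -EFinM ltry.
  have dm n z : (`|(`|w n z| `^ q)%:E| <= ((`|K * M| `^ q) * cutoff N z)%:E)%E.
    rewrite gee0_abs ?lee_fin ?powR_ge0//.
    have := wK n z; have [->|->] := cutoff_01 N z.
      rewrite !mulr0 => h; have /eqP -> : `|w n z| == 0 by rewrite eq_le h normr_ge0.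
      by rewrite powR0// gt_eqF.
    rewrite !mulr1 => h; apply: ge0_ler_powR; rewrite ?nnegrE//; first exact: ltW.
    exact: le_trans h (ler_norm _).
  have := @dominated_cvg _ _ _ mu setT measurableT _ (cst 0%E)
      (fun z => ((`|K * M| `^ q) * cutoff N z)%:E) m (fun z _ => cv z) (fun z _ => isT) ic (fun n z _ => dm n z).
  by rewrite integral0.
(* Weighted Young inequality: t makes the term in [u n] at most e / 2 for all n, and the factor t^-1
   on the other side is fixed before n grows. *)
pose t : R := (e / (2 * (C + 1))) `^ p^-1.
have C10 : 0 < C + 1 by rewrite ltr_wpDl.
have c0 : 0 < e / (2 * (C + 1)) by rewrite divr_gt0// mulr_gt0.
have t0 : 0 < t by rewrite powR_gt0.
have tp : t `^ p = e / (2 * (C + 1)).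
  by rewrite /t -powRrM mulVf ?gt_eqF// powRr1// ltW.
have s0 : 0 < t^-1 `^ q by rewrite powR_gt0 ?invr_gt0.
have [n0 h] := small (e / 2 / (t^-1 `^ q)) (divr_gt0 (divr_gt0 e0 (ltr0n _ 2)) s0).
exists n0 => n /h hn.
have mtu : measurable_fun setT (fun z => t * u n z) by exact: measurable_funM.
have mtw : measurable_fun setT (fun z => t^-1 * w n z) by exact: measurable_funM.
have -> : \int[mu]_z (u n z * conv (v n) a b z * psi z) =
    \int[mu]_z ((t * u n z) * (t^-1 * w n z)).
  apply: eq_Rintegral => z _; rewrite mulrACA divff ?gt_eqF// mul1r /w mulrA//.
apply: normr_Rintegral_le; first exact: measurable_funM.
apply: (le_trans (le_integral_mul p1 pq mtu mtw)).
have -> : e = e / 2 + e / 2 by field.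
rewrite [leRHS]EFinD; apply: leeD.
  rewrite (Lp_powZ p (ltW t0) (mu_ n)); apply: (le_trans (lee_wpmul2l _ (uC n))).
    by rewrite lee_fin powR_ge0.
  rewrite -EFinM lee_fin tp.
  have -> : e / (2 * (C + 1)) * C = e / 2 * (C / (C + 1)) by field; rewrite gt_eqF.
  rewrite ler_piMr ?divr_ge0 ?(ltW e0)//.
  by rewrite ler_pdivrMr// mul1r lerDl.
have ti0 : 0 <= t^-1 by rewrite invr_ge0 ltW.
rewrite (Lp_powZ q ti0 (mw n)); apply: (le_trans (lee_wpmul2l _ hn)).
  by rewrite lee_fin powR_ge0.
by rewrite -EFinM lee_fin mulrC divfK// gt_eqF.
Unshelve. all: by end_near. Qed.

End Approx.

(** * Mollification error for a fixed pair of functions *)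

Section MollApprox.
Variable R : realType.
Local Notation T2 := (measurableTypeR R * measurableTypeR R)%type.
Local Notation mu := (leb2 R).

Lemma moll_neg (s x : R) : 0 < s -> x < 0 -> moll s x = 0.
Proof.
move=> s0 x0; rewrite /moll derive1E.
rewrite (@near_eq_derive _ _ _ _ (cst (0 : R))) ?derive_cst ?oner_eq0//.
near=> t; apply: scaled_step_le0 => //; apply/ltW; near: t; exact: lt_nbhsl.
Unshelve. all: by end_near. Qed.

(** The mollifier is supported in [0, s] rather than [-s, s], and so is dominated by the one-sided
    averaging kernel. *)
Lemma moll_hat : exists2 M : R, 0 <= M &
  forall s, 0 < s -> boxed (M / s) s (@moll R s) /\
    forall x, `|moll s x| <= M / s * hat s x.
Proof.
have [M M0 HM] := boxed_moll R; exists M => // s s0; split; first exact: HM.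
move=> x; have [x0|x0] := ltP x 0.
  by rewrite moll_neg// normr0 mulr_ge0 ?hat_ge0// divr_ge0// ltW.
have [_ /(_ x)] := HM s s0.
by rewrite /bump /hat x0 (ger0_norm x0).
Qed.

(** The kernel has mass one, so V z can be moved under the integral. *)
Lemma sub_conv_moll (q d : R) (V : T2 -> R) (z : T2) : 1 < q -> 0 < d -> in_Lp q V ->
  mu.-integrable setT
    (fun w => ((V z - V w) * (moll d (z.1 - w.1) * moll d (z.2 - w.2)))%:E) /\
  V z - conv V (moll d) (moll d) z =
  \int[mu]_w ((V z - V w) * (moll d (z.1 - w.1) * moll d (z.2 - w.2))).
Proof.
move=> q1 d0 LV; have [K _ /(_ d d0) Hb] := boxed_moll R.
have [mm _] := Hb.
pose kap (w : T2) := moll d (z.1 - w.1) * moll d (z.2 - w.2).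
have mk : measurable_fun setT kap by exact: measurable_kernel_r.
have ic := integrable_conv z q1 (ltW d0) (ltW d0) LV Hb Hb.
have ik : mu.-integrable setT (EFin \o kap).
  have := in_Lp_kernel z ltr01 (ltW d0) (ltW d0) Hb Hb => /(in_LpP _ ltr01)[_ fk].
  apply/integrableP; split; first exact/measurable_EFinP.
  apply: le_lt_trans fk; rewrite le_eqVlt; apply/orP; left; apply/eqP.
  by apply: eq_integral => w _; rewrite powRr1.
have ick : mu.-integrable setT (fun w => (V z * kap w)%:E).
  exact: (integrableZl measurableT (V z) ik).
have idiff : mu.-integrable setT (fun w => ((V z - V w) * kap w)%:E).
  have := integrableB measurableT ick ic.
  by apply: eq_integrable => // w _; rewrite /= -EFinB mulrBl.
split => //.
rewrite -[V z in LHS]mulr1 -(integral_moll2 z d0) -RintegralZl// /conv -RintegralB//.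
by apply: eq_Rintegral => w _; rewrite mulrBl.
Qed.

Section pq.
Variables (p q : R).
Hypotheses (p1 : 1 < p) (pq : p^-1 + q^-1 = 1).
Let p0 : 0 < p := lt_trans ltr01 p1.
Let q1 : 1 < q := conjugate_gt1 p1 pq.
Let q0 : 0 < q := lt_trans ltr01 q1.
Let qp : q^-1 + p^-1 = 1. Proof. by rewrite addrC. Qed.

Lemma in_Lp_bounded_mul (U psi : T2 -> R) (M : R) : in_Lp p U ->
  measurable_fun setT psi -> (forall z, `|psi z| <= M) ->
  in_Lp p (fun z => U z * psi z).
Proof.
move=> LU mpsi psiM; have [mU fU] := (in_LpP _ p0).1 LU.
have M0 : 0 <= M by exact: (le_trans _ (psiM (0, 0))).
apply/(in_LpP _ p0); split; first exact: measurable_funM.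
apply: (@le_lt_trans _ _ (Lp_pow p (fun z => M * U z)%R)).
  apply: ge0_le_integral => //.
  - by apply/measurable_EFinP; apply: measurable_normp; exact: measurable_funM.
  - by apply/measurable_EFinP; apply: measurable_normp; exact: measurable_funM.
  move=> z _; rewrite lee_fin; apply: ge0_ler_powR; rewrite ?nnegrE//; first exact: ltW.
  by rewrite !normrM (ger0_norm M0) mulrC ler_wpM2r.
by rewrite Lp_powZ// lte_mul_pinfty// lee_fin powR_ge0.
Qed.

(** The error is at most K^2 times the mean oscillation of V weighted by |U psi|, which vanishes by
    [vanish_oscU]. *)
Lemma moll_approx (U V psi : T2 -> R) (M N : R) : 0 <= N -> 0 <= M ->
  in_Lp p U -> in_Lp q V -> measurable_fun setT psi ->
  (forall z, `|psi z| <= M * cutoff N z) ->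
  forall e, 0 < e -> exists k0, forall k, (k0 <= k)%N ->
   `|\int[mu]_z (U z * (V z - conv V (moll k.+1%:R^-1) (moll k.+1%:R^-1) z) * psi z)| <= e.
Proof.
move=> N0 M0 LU LV mpsi psiM e e0.
have [K K0 HK] := moll_hat.
have psiM' z : `|psi z| <= M.
  by apply: (le_trans (psiM z)); rewrite ler_piMr// cutoff_le1.
have LU' := in_Lp_bounded_mul LU mpsi psiM'.
set U' := (fun z => U z * psi z) in LU'.
have UN z : U' z = U' z * cutoff N z.
  have := psiM z; rewrite /U'; have [->|->] := cutoff_01 N z; last by rewrite !mulr1.
  rewrite !mulr0 => h; have /eqP : `|psi z| == 0 by rewrite eq_le h normr_ge0.
  by move/normr0_eq0 => ->; rewrite mulr0.
have mV := in_Lp_measurable q0 LV.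
have mU' := in_Lp_measurable p0 LU'.
have [k0 hk0] := vanishZ (sqr_ge0 K) (vanish_oscU p1 pq N0 LU' LV UN) e0.
exists k0 => k /hk0 hk; set d : R := k.+1%:R^-1.
have d0 : 0 < d by rewrite invr_gt0.
have [Hb Hh] := HK d d0.
have [mm _] := Hb.
have mc : measurable_fun setT (conv V (moll d) (moll d)) by exact: (measurable_conv mV mm mm).
have -> : \int[mu]_z (U z * (V z - conv V (moll d) (moll d) z) * psi z) =
    \int[mu]_z (U' z * (V z - conv V (moll d) (moll d) z)).
  by apply: eq_Rintegral => z _; rewrite mulrAC.
have mD : measurable_fun setT (fun z => U' z * (V z - conv V (moll d) (moll d) z)).
  by apply: measurable_funM => //; exact: measurable_funB.
apply: normr_Rintegral_le => //; apply: le_trans hk.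
pose F (zw : T2 * T2) := oscU U' V zw * box_avg k zw.1 zw.2.
have mF : measurable_fun setT (EFin \o F).
  apply/measurable_EFinP; apply: measurable_funM; last exact: measurable_box_avg.
  exact: measurable_oscU.
have F0 zw : (0 <= (EFin \o F) zw)%E.
  by rewrite lee_fin mulr_ge0 ?box_avg_ge0// mulr_ge0.
rewrite -ge0_integralZl ?lee_fin ?sqr_ge0//; last 2 first.
- exact: (leb2_measurable_section mF F0).
- by move=> z _; apply: integral_ge0 => w _; exact: (F0 (z, w)).
apply: ge0_le_integral => //.
- by apply: measurableT_comp => //; exact/measurable_EFinP.
- by apply: measurable_funeM; exact: (leb2_measurable_section mF F0).
move=> z _.
pose kap (w : T2) := moll d (z.1 - w.1) * moll d (z.2 - w.2).
have mk : measurable_fun setT kap by exact: measurable_kernel_r.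
have [idiff ->] := sub_conv_moll z q1 d0 LV.
rewrite EFinM abseM [X in (_ * X)%E](_ : _ =
    `|\int[mu]_w ((V z - V w) * kap w)%:E|)%E; last first.
  by rewrite -EFin_normr_Rintegral.
have [mi _] := (integrableP _ _ _ idiff).
apply: (le_trans (lee_wpmul2l _ (le_abse_integral _ _ mi))) => //.
rewrite -ge0_integralZl//; last exact: measurableT_comp.
rewrite -ge0_integralZl ?lee_fin ?sqr_ge0//; last 2 first.
- exact: (measurableT_comp mF (measurable_pair1 z)).
- by move=> w _; exact: (F0 (z, w)).
apply: ge0_le_integral => //.
- by apply: measurable_funeM; exact: measurableT_comp.
- by apply: measurable_funeM; exact: (measurableT_comp mF (measurable_pair1 z)).
move=> w _; rewrite -!EFinM lee_fin normrM /F /oscU /=.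
have -> : K ^+ 2 * (`|U' z| * `|V z - V w| * box_avg k z w) =
  `|U' z| * (`|V z - V w| * (K ^+ 2 * box_avg k z w)) by ring.
rewrite -normrM -/(U' z) [`|_ * kap w|]normrM; do 2 apply: ler_wpM2l => //.
rewrite /kap normrM; apply: (le_trans (ler_pM _ _ (Hh _) (Hh _))) => //.
(* For d = 1/(k+1) the product of the two bounds K/d times [hat] is exactly K^2 times
   [box_avg k]. *)
rewrite /box_avg /d invrK le_eqVlt; apply/orP; left; apply/eqP; ring.
Qed.

End pq.
End MollApprox.

(** * Comparison of two mollification scales *)

Section Estimate.
Variable R : realType.
Local Notation T2 := (measurableTypeR R * measurableTypeR R)%type.
Local Notation mu := (leb2 R).
Variables (p q : R).
Hypotheses (p1 : 1 < p) (pq : p^-1 + q^-1 = 1).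
Let p0 : 0 < p := lt_trans ltr01 p1.
Let q1 : 1 < q := conjugate_gt1 p1 pq.
Let q0 : 0 < q := lt_trans ltr01 q1.

Lemma integrable_conv_test1_mul (U V psi : T2 -> R) (a b : R -> R) (M : R) :
  test1 a -> test1 b -> in_Lp p U -> in_Lp q V -> measurable_fun setT psi ->
  (forall z, `|psi z| <= M) ->
  mu.-integrable setT (fun z => (U z * conv V a b z * psi z)%:E).
Proof.
move=> ca cb LU LV mpsi psiM.
have [A [r [A0 r0 Ha]]] := test1_boxed ca; have [B [r' [B0 r'0 Hb]]] := test1_boxed cb.
apply: (integrable_conv_mul p1 pq A0 B0 r0 r'0 Ha Hb LU LV mpsi psiM).
  by rewrite Lp_pow_normr.
by rewrite Lp_pow_normr.
Qed.

Variables (u1 u2 v1 v2 d g : T2 -> R).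
Hypotheses (Lu1 : in_Lp p u1) (Lu2 : in_Lp p u2) (Ld : in_Lp p d).
Hypotheses (Lv1 : in_Lp q v1) (Lv2 : in_Lp q v2) (Lg : in_Lp q g).
Hypothesis div_eq : forall psi : R * R -> R, test_function psi ->
  - (\int[mu]_z (u1 z * dx psi z)) + - (\int[mu]_z (u2 z * dy psi z)) =
  \int[mu]_z (d z * psi z).
Hypothesis curl_eq : forall psi : R * R -> R, test_function psi ->
  - (\int[mu]_z (v1 z * dy psi z)) - - (\int[mu]_z (v2 z * dx psi z)) =
  \int[mu]_z (g z * psi z).

(** The curl equation tested on [kernel_at a b z]; differentiating in w gives a sign that cancels
    the one in the distributional derivative. *)
Lemma curl_conv (a b : R -> R) z : test1 a -> test1 b ->
  conv g a b z = conv v1 a (derive1 b) z - conv v2 (derive1 a) b z.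
Proof.
move=> ca cb; have da := test1_derive ca; have db := test1_derive cb.
have i1 := integrable_conv_test1 q1 Lv1 z ca db.
have i2 := integrable_conv_test1 q1 Lv2 z da cb.
have Ex : \int[mu]_w (v2 w * dx (kernel_at a b z) w) = - conv v2 (derive1 a) b z.
  rewrite -mulN1r /conv -RintegralZl//; apply: eq_Rintegral => w _.
  rewrite /dx; have [_ ->] := is_derive_kernel_x b z w ca.
  by rewrite mulrN mulN1r.
have Ey : \int[mu]_w (v1 w * dy (kernel_at a b z) w) = - conv v1 a (derive1 b) z.
  rewrite -mulN1r /conv -RintegralZl//; apply: eq_Rintegral => w _.
  rewrite /dy; have [_ ->] := is_derive_kernel_y a z w cb.
  by rewrite mulrN mulN1r.
have := curl_eq (test_function_kernel z ca cb).
by rewrite Ex Ey !opprK; exact: esym.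
Qed.

Variables (phi : R * R -> R) (M C K : R).
Hypotheses (tphi : test_function phi).
Hypotheses (phiM : forall z, `|phi z| <= M) (dxM : forall z, `|dx phi z| <= M)
  (dyM : forall z, `|dy phi z| <= M).
Hypotheses (u1C : (Lp_pow p u1 <= C%:E)%E) (u2C : (Lp_pow p u2 <= C%:E)%E)
  (dC : (Lp_pow p d <= C%:E)%E) (v1C : (Lp_pow q v1 <= C%:E)%E)
  (v2C : (Lp_pow q v2 <= C%:E)%E) (gC : (Lp_pow q g <= C%:E)%E).
Hypotheses (K0 : 0 <= K) (HK : forall s : R, 0 < s -> boxed (K / s) s (moll s)).
Variables (s e : R).
Hypotheses (s0 : 0 < s) (se : s <= e).

Let e0 : 0 < e := lt_le_trans s0 se.
Let ccD : test1 (step_diff s e) := test1_step_diff s0 se.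
Let ccs : test1 (moll s) := test1_moll s0.
Let cce : test1 (moll e) := test1_moll e0.
Let bD := boxed_step_diff s0 se.

Let mphi : measurable_fun setT (phi : T2 -> R).
Proof. by apply: measurable_continuous2; have [/(_ 0%N)[]] := tphi. Qed.

Let mdx : measurable_fun setT (dx phi : T2 -> R).
Proof.
apply: measurable_continuous2; have [/(_ 1%N)/Ck_elim[_ _ _ h _] _] := tphi.
exact: Ck_continuous h.
Qed.

Let mdy : measurable_fun setT (dy phi : T2 -> R).
Proof.
apply: measurable_continuous2; have [/(_ 1%N)/Ck_elim[_ _ _ _ h] _] := tphi.
exact: Ck_continuous h.
Qed.

Let bound := M * (4 * K * e) * (C + C).

(** The height K/s of the mollifier cancels the width s of its support; only the width e of
    [step_diff] remains. *)
Let bound1 (U V psi : T2 -> R) : in_Lp p U -> in_Lp q V ->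
  measurable_fun setT psi -> (forall z, `|psi z| <= M) ->
  (Lp_pow p U <= C%:E)%E -> (Lp_pow q V <= C%:E)%E ->
  `|\int[mu]_z (U z * conv V (step_diff s e) (moll s) z * psi z)| <= bound.
Proof.
move=> LU LV mpsi psiM UC VC.
have := normr_conv_mul p1 pq ler01 (divr_ge0 K0 (ltW s0)) (ltW e0) (ltW s0)
  bD (HK s0) LU LV mpsi psiM UC VC.
have -> // : 1 * (K / s) * (4 * e * s) = 4 * K * e by field; rewrite gt_eqF.
Qed.

Let bound2 (U V psi : T2 -> R) : in_Lp p U -> in_Lp q V ->
  measurable_fun setT psi -> (forall z, `|psi z| <= M) ->
  (Lp_pow p U <= C%:E)%E -> (Lp_pow q V <= C%:E)%E ->
  `|\int[mu]_z (U z * conv V (moll e) (step_diff s e) z * psi z)| <= bound.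
Proof.
move=> LU LV mpsi psiM UC VC.
have := normr_conv_mul p1 pq (divr_ge0 K0 (ltW e0)) ler01 (ltW e0) (ltW e0)
  (HK e0) bD LU LV mpsi psiM UC VC.
have -> // : K / e * 1 * (4 * e * e) = 4 * K * e by field; rewrite gt_eqF.
Qed.

(* Potential of the gradient part of [v * rho_s - v * rho_e]. *)
Let W (z : R * R) : R := conv v1 (step_diff s e) (moll s) z + conv v2 (moll e) (step_diff s e) z.
(** No smallness is claimed for [Wx] and [Wy]: they are eliminated by integration by parts. *)
Let Wx (z : R * R) : R := conv v1 (derive1 (step_diff s e)) (moll s) z +
  conv v2 (derive1 (moll e)) (step_diff s e) z.
Let Wy (z : R * R) : R := conv v1 (step_diff s e) (derive1 (moll s)) z +
  conv v2 (moll e) (derive1 (step_diff s e)) z.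
Let D1 (z : R * R) : R := conv v1 (moll s) (moll s) z - conv v1 (moll e) (moll e) z.
Let D2 (z : R * R) : R := conv v2 (moll s) (moll s) z - conv v2 (moll e) (moll e) z.

Let smoothW : smooth W.
Proof.
by move=> k; apply: CkD; [exact: (smooth_conv q1 Lv1)|exact: (smooth_conv q1 Lv2)].
Qed.

Let dWx z : is_derive z ((1, 0) : R * R) W (Wx z).
Proof.
apply: is_deriveD; [exact: (is_derive_conv_x q1 Lv1)|exact: (is_derive_conv_x q1 Lv2)].
Qed.

Let dWy z : is_derive z ((0, 1) : R * R) W (Wy z).
Proof.
apply: is_deriveD; [exact: (is_derive_conv_y q1 Lv1)|exact: (is_derive_conv_y q1 Lv2)].
Qed.

Let convBl (V : T2 -> R) (a a' b : R -> R) z : in_Lp q V -> test1 a -> test1 a' -> test1 b ->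
  conv V (fun x => a x - a' x) b z = conv V a b z - conv V a' b z.
Proof.
move=> LV ca ca' cb; rewrite /conv -RintegralB//.
- by apply: eq_Rintegral => w _; rewrite mulrBl mulrBr.
- exact: (integrable_conv_test1 q1 LV z ca cb).
- exact: (integrable_conv_test1 q1 LV z ca' cb).
Qed.

Let convBr (V : T2 -> R) (a b b' : R -> R) z : in_Lp q V -> test1 a -> test1 b -> test1 b' ->
  conv V a (fun x => b x - b' x) z = conv V a b z - conv V a b' z.
Proof.
move=> LV ca cb cb'; rewrite /conv -RintegralB//.
- by apply: eq_Rintegral => w _; rewrite !mulrBr.
- exact: (integrable_conv_test1 q1 LV z ca cb).
- exact: (integrable_conv_test1 q1 LV z ca cb').
Qed.

(** In the telescoped kernel, the summand m_e(x) (m_s - m_e)(y) is a y-derivative; [curl_conv]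
    trades it for an x-derivative acting on [v2], up to a term in [g]. *)
Let D1E z : D1 z = Wx z + conv g (moll e) (step_diff s e) z.
Proof.
have alg (x y w c : R) : x - y = (x - w + c) + ((w - y) - c) by ring.
rewrite (curl_conv z cce ccD) /Wx !derive1_step_diff (convBl z Lv1 ccs cce ccs).
by rewrite (convBr z Lv1 cce ccs cce); exact: alg.
Qed.

(** Here the summand (m_s - m_e)(x) m_s(y) is traded, from [v2] to [v1], hence the opposite sign of
    [g]. *)
Let D2E z : D2 z = Wy z - conv g (step_diff s e) (moll s) z.
Proof.
have alg (x y w c : R) : x - y = (c + (w - y)) - (c - (x - w)) by ring.
rewrite (curl_conv z ccD ccs) /Wy !derive1_step_diff (convBl z Lv2 ccs cce ccs).
by rewrite (convBr z Lv2 cce ccs cce); exact: alg.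
Qed.

Let tW : test_function (fun z => W z * phi z).
Proof.
have [sphi cphi] := tphi; split; first by move=> k; exact: CkM.
have [r r0 hr] := compactly_supported_bounded cphi.
apply: (@bounded_compactly_supported _ _ r) => z.
by rewrite mulf_eq0 negb_or => /andP[_ /hr].
Qed.

Let dphi z : is_derive z ((1, 0) : R * R) phi (dx phi z) /\
  is_derive z ((0, 1) : R * R) phi (dy phi z).
Proof. by have [/(_ 1%N)/Ck_elim[_ h1 h2 _ _] _] := tphi. Qed.

Let dxW z : dx (fun z => W z * phi z) z = W z * dx phi z + phi z * Wx z.
Proof. by have [_] := is_deriveM (dWx z) (dphi z).1. Qed.

Let dyW z : dy (fun z => W z * phi z) z = W z * dy phi z + phi z * Wy z.
Proof. by have [_] := is_deriveM (dWy z) (dphi z).2. Qed.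

Let isum (U V V' psi : T2 -> R) (a b a' b' : R -> R) :
  test1 a -> test1 b -> test1 a' -> test1 b' -> in_Lp p U -> in_Lp q V -> in_Lp q V' ->
  measurable_fun setT psi -> (forall z, `|psi z| <= M) ->
  mu.-integrable setT (fun z => (U z * (conv V a b z + conv V' a' b' z) * psi z)%:E) /\
  \int[mu]_z (U z * (conv V a b z + conv V' a' b' z) * psi z) =
  \int[mu]_z (U z * conv V a b z * psi z) + \int[mu]_z (U z * conv V' a' b' z * psi z).
Proof.
move=> ca cb ca' cb' LU LV LV' mpsi psiM.
have i1 := integrable_conv_test1_mul ca cb LU LV mpsi psiM.
have i2 := integrable_conv_test1_mul ca' cb' LU LV' mpsi psiM.
have E : (fun z => U z * (conv V a b z + conv V' a' b' z) * psi z) =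
   (fun z => U z * conv V a b z * psi z + U z * conv V' a' b' z * psi z).
  by apply/funext => z; rewrite mulrDr mulrDl.
rewrite E; split; last by rewrite RintegralD.
apply: (eq_integrable measurableT) (integrableD measurableT i1 i2) => z _.
by rewrite -EFinD mulrDr mulrDl.
Qed.

Let Rintegral_split (f f1 f2 : T2 -> R) :
  mu.-integrable setT (EFin \o f1) -> mu.-integrable setT (EFin \o f2) ->
  (forall z, f z = f1 z + f2 z) ->
  \int[mu]_z f z = \int[mu]_z f1 z + \int[mu]_z f2 z.
Proof.
move=> i1 i2 /funext ->; exact: (RintegralD measurableT i1 i2).
Qed.

Let Rintegral_split_sub (f f1 f2 : T2 -> R) :
  mu.-integrable setT (EFin \o f1) -> mu.-integrable setT (EFin \o f2) ->
  (forall z, f z = f1 z - f2 z) ->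
  \int[mu]_z f z = \int[mu]_z f1 z - \int[mu]_z f2 z.
Proof.
move=> i1 i2 /funext ->; exact: (RintegralB measurableT i1 i2).
Qed.

(** The uncontrolled y1 and y2, the integrals with [Wx] and [Wy], enter s1 + s2 only as y1 + y2,
    which the divergence identity equates to - a1 - a2 - a3. *)
Let norm_sum8 (x1 x2 x3 x4 x5 x6 x7 x8 y1 y2 w1 w2 w3 a1 a2 a3 s1 s2 B : R) :
  - w1 + - w2 = w3 -> w1 = a1 + y1 -> w2 = a2 + y2 -> w3 = a3 ->
  a1 = x1 + x2 -> a2 = x3 + x4 -> a3 = x5 + x6 ->
  s1 = y1 + x7 -> s2 = y2 - x8 ->
  `|x1| <= B -> `|x2| <= B -> `|x3| <= B -> `|x4| <= B -> `|x5| <= B ->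
  `|x6| <= B -> `|x7| <= B -> `|x8| <= B ->
  `|s1 + s2| <= 8 * B.
Proof.
move=> H E1 E2 E3 E4 E5 E6 -> ->; rewrite !ler_norml => /andP[? ?] /andP[? ?] /andP[? ?] /andP[? ?].
by move=> /andP[? ?] /andP[? ?] /andP[? ?] /andP[? ?]; apply/andP; split; lra.
Qed.

(** The divergence equation is tested on W phi. Eight terms survive: W has two summands, each paired
    with [u1], [u2] and [d], and [g] occurs twice. *)
Lemma div_curl_estimate :
  `|\int[mu]_z (u1 z * D1 z * phi z) + \int[mu]_z (u2 z * D2 z * phi z)| <= 8 * bound.
Proof.
have cD' := test1_derive ccD; have cs' := test1_derive ccs; have ce' := test1_derive cce.
have [iA1 EA1] := isum ccD ccs cce ccD Lu1 Lv1 Lv2 mdx dxM.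
have [iA2 EA2] := isum ccD ccs cce ccD Lu2 Lv1 Lv2 mdy dyM.
have [iE EE] := isum ccD ccs cce ccD Ld Lv1 Lv2 mphi phiM.
have [iB1 _] := isum cD' ccs ce' ccD Lu1 Lv1 Lv2 mphi phiM.
have [iB2 _] := isum ccD cs' cce cD' Lu2 Lv1 Lv2 mphi phiM.
have iG1 := integrable_conv_test1_mul cce ccD Lu1 Lg mphi phiM.
have iG2 := integrable_conv_test1_mul ccD ccs Lu2 Lg mphi phiM.
have algD (a b c x : R) : a * (b + c) * x = a * b * x + a * c * x by ring.
have algB (a b c x : R) : a * (b - c) * x = a * b * x - a * c * x by ring.
have S1 : \int[mu]_z (u1 z * D1 z * phi z) =
    \int[mu]_z (u1 z * Wx z * phi z) +
    \int[mu]_z (u1 z * conv g (moll e) (step_diff s e) z * phi z).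
  apply: (Rintegral_split iB1 iG1) => z.
  rewrite D1E.
  exact: algD.
have S2 : \int[mu]_z (u2 z * D2 z * phi z) =
    \int[mu]_z (u2 z * Wy z * phi z) -
    \int[mu]_z (u2 z * conv g (step_diff s e) (moll s) z * phi z).
  apply: (Rintegral_split_sub iB2 iG2) => z.
  rewrite D2E.
  exact: algB.
have alg (a b c x y : R) : a * (b * x + c * y) = a * b * x + a * y * c by ring.
have X1 : \int[mu]_z (u1 z * dx (fun z => W z * phi z) z) =
    \int[mu]_z (u1 z * W z * dx phi z) + \int[mu]_z (u1 z * Wx z * phi z).
  by apply: (Rintegral_split iA1 iB1) => z; rewrite dxW; exact: alg.
have X2 : \int[mu]_z (u2 z * dy (fun z => W z * phi z) z) =
    \int[mu]_z (u2 z * W z * dy phi z) + \int[mu]_z (u2 z * Wy z * phi z).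
  by apply: (Rintegral_split iA2 iB2) => z; rewrite dyW; exact: alg.
have XE : \int[mu]_z (d z * (W z * phi z)) = \int[mu]_z (d z * W z * phi z).
  by apply: eq_Rintegral => z _; rewrite mulrA.
have b1 := bound1 Lu1 Lv1 mdx dxM u1C v1C.
have b2 := bound2 Lu1 Lv2 mdx dxM u1C v2C.
have b3 := bound1 Lu2 Lv1 mdy dyM u2C v1C.
have b4 := bound2 Lu2 Lv2 mdy dyM u2C v2C.
have b5 := bound1 Ld Lv1 mphi phiM dC v1C.
have b6 := bound2 Ld Lv2 mphi phiM dC v2C.
have b7 := bound2 Lu1 Lg mphi phiM u1C gC.
have b8 := bound1 Lu2 Lg mphi phiM u2C gC.
exact: (norm_sum8 (div_eq tW) X1 X2 XE EA1 EA2 EE S1 S2 b1 b2 b3 b4 b5 b6 b7 b8).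
Qed.

End Estimate.

(** * Bounds and uniform continuity from compact support *)

Section CompactSupport.
Variable R : realType.
Local Notation T2 := (measurableTypeR R * measurableTypeR R)%type.
Implicit Types (f : R * R -> R).

Lemma compactly_supported_norm_le f : continuous f -> compactly_supported f ->
  exists2 M : R, 0 <= M & forall z, `|f z| <= M.
Proof.
move=> cf kf.
have := continuous_compact (continuous_subspaceT cf) kf.
move=> /compact_bounded/pinfty_ex_gt0[M M0 hM]; exists M; first exact: ltW.
move=> z; have [->|fz] := eqVneq (f z) 0; first by rewrite normr0 ltW.
by apply: hM; exists z => //; exact: subset_closure.
Qed.

Lemma norm_le_cutoff f (M r : R) : (forall z, `|f z| <= M) ->
  (forall z, f z != 0 -> `|z.1| <= r /\ `|z.2| <= r) ->
  forall z : T2, `|f z| <= M * cutoff r z.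
Proof.
move=> fM fr z; have M0 : 0 <= M by exact: (le_trans _ (fM (0, 0))).
have [->|fz] := eqVneq (f z) 0; first by rewrite normr0 mulr_ge0// cutoff_ge0.
have [h1 h2] := fr z fz; rewrite /cutoff /bump h1 h2 !mulr1.
exact: fM.
Qed.

(** Compactness gives one radius valid at all points of the support. If f vanishes at both points
    there is nothing to prove; otherwise one of them lies in the support and plays the role of the
    center. *)
Lemma compactly_supported_unif f (e : R) : continuous f -> compactly_supported f ->
  0 < e -> exists2 s : R, 0 < s & forall z w : R * R,
    `|z.1 - w.1| <= s -> `|z.2 - w.2| <= s -> `|f z - f w| <= e.
Proof.
move=> cf kf e0; pose P (s : R) (z : R * R) := forall w : R * R,
  `|z.1 - w.1| <= s -> `|z.2 - w.2| <= s -> `|f z - f w| <= e.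
have cov : \forall s \near (0 : R)^'+, closure [set z | f z != 0] `<=` P s.
  have /compact_near_coveringP := kf; apply => x _.
  have /cvgrPdist_le/(_ (e / 2)) := cf x.
  rewrite divr_gt0// => /(_ isT) /nbhs_ballP[d /= d0 hd].
  exists (ball x (d / 2), [set s | s < d / 2]).
    split; first by apply: nbhsx_ballx; rewrite divr_gt0.
    by apply: nbhs_right_lt; rewrite divr_gt0.
  move=> [z s] /= [[z1 z2] sd] w w1 w2.
  have hz : `|f x - f z| <= e / 2.
    apply: hd; split; apply: lt_le_trans; [exact: z1| |exact: z2|];
      by rewrite ler_pdivrMr// ler_peMr ?ler1n// ltW.
  have hw : `|f x - f w| <= e / 2.
    apply: hd; split; rewrite /ball /=.
      rewrite -(subrKA z.1) (splitr d) (le_lt_trans (ler_normD _ _))// ltr_leD//.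
      exact: le_trans w1 (ltW sd).
    rewrite -(subrKA z.2) (splitr d) (le_lt_trans (ler_normD _ _))// ltr_leD//.
    exact: le_trans w2 (ltW sd).
  rewrite -(subrKA (f x)) (splitr e) (le_trans (ler_normD _ _))// lerD//.
  by rewrite distrC.
have [s s0 hs] : exists2 s : R, 0 < s & closure [set z | f z != 0] `<=` P s.
  have : \forall s \near (0 : R)^'+, 0 < s /\ closure [set z | f z != 0] `<=` P s.
    by near=> s; split; [|near: s].
  by move=> /filter_ex[s [s0 hs]]; exists s.
exists s => // z w zw1 zw2.
have [fz|fz] := eqVneq (f z) 0; last by apply: hs => //; exact: subset_closure.
have [fw|fw] := eqVneq (f w) 0; first by rewrite fz fw subrr normr0 ltW.
rewrite distrC; apply: (hs w) => //; try exact: subset_closure; by rewrite distrC.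
Unshelve. all: by end_near. Qed.

Lemma test_function_derivatives_bounded f : test_function f ->
  exists (M r : R), [/\ 0 <= M, 0 <= r, forall z : T2, `|f z| <= M * cutoff r z,
    forall z, `|dx f z| <= M & forall z, `|dy f z| <= M].
Proof.
move=> [sf kf].
have cf : continuous f by have [] := sf 0%N.
have [_ _ _ /Ck_continuous cx /Ck_continuous cy] := Ck_elim (sf 1%N).
have [r r0 hr] := compactly_supported_bounded kf.
(* Outside the closed square f vanishes in a neighborhood, and so do its derivatives. *)
have supp (v : R * R) z : 'D_v f z != 0 -> `|z.1| <= r /\ `|z.2| <= r.
  move=> Dz; suff : ~ (r < `|z.1|) /\ ~ (r < `|z.2|).
    by move=> [/negP h1 /negP h2]; rewrite !leNgt.
  have zero : (\forall w \near z, f w = 0) -> False.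
    move=> h; move: Dz; rewrite (@near_eq_derive _ _ _ _ (cst (0 : R)) z v h).
    by rewrite derive_cst eqxx.
  split=> rz; apply: zero.
    have c : `|w.1| @[w --> z] --> `|z.1| by apply: cvg_norm; exact: cvg_fst.
    have rw := @cvgr_gt R _ _ _ _ _ c _ rz.
    near=> w; apply/eqP/negP => /negP /hr[+ _].
    by apply/negP; rewrite -ltNge; near: w; exact: rw.
  have c : `|w.2| @[w --> z] --> `|z.2| by apply: cvg_norm; exact: cvg_snd.
  have rw := @cvgr_gt R _ _ _ _ _ c _ rz.
  near=> w; apply/eqP/negP => /negP /hr[_].
  by apply/negP; rewrite -ltNge; near: w; exact: rw.
have [M1 M10 h1] := compactly_supported_norm_le cf kf.
have [M2 M20 h2] := compactly_supported_norm_le cx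
  (bounded_compactly_supported (fun z => @supp (1, 0) z)).
have [M3 M30 h3] := compactly_supported_norm_le cy
  (bounded_compactly_supported (fun z => @supp (0, 1) z)).
exists (M1 + M2 + M3), r; split => //.
- by rewrite !addr_ge0.
- apply: norm_le_cutoff => // z; apply: (le_trans (h1 z)).
  by rewrite -addrA lerDl addr_ge0.
- by move=> z; apply: (le_trans (h2 z)); rewrite addrAC lerDr addr_ge0.
- by move=> z; apply: (le_trans (h3 z)); rewrite lerDr addr_ge0.
Unshelve. all: by end_near. Qed.

End CompactSupport.

(** * Uniform approximation by test functions *)

Section Density.
Variable R : realType.
Local Notation T2 := (measurableTypeR R * measurableTypeR R)%type.
Local Notation mu := (leb2 R).

Lemma in_Lp_compactly_supported (p : R) (f : R * R -> R) : 1 < p ->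
  continuous f -> compactly_supported f -> in_Lp p f.
Proof.
move=> p1 cf kf; have [M _ fM] := compactly_supported_norm_le cf kf.
have [r r0 hr] := compactly_supported_bounded kf.
have Lc := in_Lp_cutoff (lt_trans ltr01 p1) r0.
have := in_Lp_bounded_mul p1 Lc (measurable_continuous2 cf) fM.
congr in_Lp; apply/funext => z.
have := norm_le_cutoff fM hr z; have [->|->] := cutoff_01 r z; last by rewrite mul1r.
by rewrite mulr0 normr_le0 mul0r => /eqP.
Qed.

Lemma boxed_eq0 (A r : R) (a : R -> R) (x : R) : boxed A r a -> r < `|x| -> a x = 0.
Proof.
move=> [_ /(_ x)] + rx; rewrite /bump (lt_geF rx) mulr0.
by rewrite normr_le0 => /eqP.
Qed.

Lemma test_function_conv_moll (f : R * R -> R) (s : R) :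
  continuous f -> compactly_supported f -> 0 < s ->
  test_function (conv f (moll s) (moll s)).
Proof.
move=> cf kf s0; have p2 : 1 < 2 :> R by rewrite ltr1n.
have Lf := in_Lp_compactly_supported p2 cf kf.
have cms := test1_moll s0.
split; first exact: (smooth_conv p2 Lf cms cms).
have [r r0 hr] := compactly_supported_bounded kf.
have [K _ /(_ s s0) Hb] := boxed_moll R.
apply: (@bounded_compactly_supported _ _ (r + s)) => z.
have far (x y : R) : r + s < `|x| -> `|y| <= r -> s < `|x - y|.
  move=> xr yr; rewrite -(ltrD2l r); apply: (lt_le_trans xr).
  rewrite -{1}(subrK y x) addrC (le_trans (ler_normD _ _))// lerD//.
have zero : (forall w, f w != 0 ->
    moll s (z.1 - w.1) * moll s (z.2 - w.2) = 0) -> conv f (moll s) (moll s) z = 0.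
  move=> h; rewrite /conv; under eq_Rintegral => w _.
    have -> : f w * (moll s (z.1 - w.1) * moll s (z.2 - w.2)) = 0; last over.
    by have [->|/h ->] := eqVneq (f w) 0; rewrite ?mul0r ?mulr0.
  by rewrite Rintegral_cst// mul0r.
move=> cz; rewrite !leNgt; split; apply/negP => zr; move/eqP: cz; apply; apply: zero => w /hr[w1 w2].
  by rewrite (boxed_eq0 Hb (far _ _ zr w1)) mul0r.
by rewrite (boxed_eq0 Hb (far _ _ zr w2)) mulr0.
Qed.

Lemma test_function_dense (f : R * R -> R) (e : R) :
  continuous f -> compactly_supported f -> 0 < e ->
  exists2 g, test_function g & forall z, `|f z - g z| <= e.
Proof.
move=> cf kf e0; have [K K0 HK] := boxed_moll R.
(* The kernel has height at most (K/s)^2 on a square of area 4 s^2, so its L^1 norm is at most 4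
   K^2; f varies by at most e' over its support. *)
pose e' := e / (4 * K ^+ 2 + 1).
have D0 : 0 < 4 * K ^+ 2 + 1 by rewrite ltr_wpDl// mulr_ge0// sqr_ge0.
have e'0 : 0 < e' by rewrite divr_gt0.
have [s s0 hs] := compactly_supported_unif cf kf e'0.
exists (conv f (moll s) (moll s)); first exact: test_function_conv_moll.
move=> z; have p2 : 1 < 2 :> R by rewrite ltr1n.
have Lf := in_Lp_compactly_supported p2 cf kf; have Hb := HK s s0.
have [mm _] := Hb.
have [idiff ->] := sub_conv_moll z p2 s0 Lf.
have [mi _] := (integrableP _ _ _ idiff).
pose kap (w : T2) := moll s (z.1 - w.1) * moll s (z.2 - w.2).
have mk : measurable_fun setT kap by exact: measurable_kernel_r.
apply: normr_Rintegral_le; first by move/measurable_EFinP : mi.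
apply: (@le_trans _ _ (e'%:E * Lp_pow 1 kap)%E).
  rewrite /Lp_pow -ge0_integralZl//; last 2 first.
  - by apply/measurable_EFinP; exact: measurable_normp.
  - by rewrite lee_fin ltW.
  apply: ge0_le_integral => //.
  - exact: measurableT_comp.
  - by apply: measurable_funeM; apply/measurable_EFinP; exact: measurable_normp.
  move=> w _; rewrite -EFinM lee_fin powRr1// normrM -/(kap w).
  have [z1|z1] := leP `|z.1 - w.1| s; last first.
    by rewrite /kap (boxed_eq0 Hb z1) mul0r normr0 !mulr0.
  have [z2|z2] := leP `|z.2 - w.2| s; last first.
    by rewrite /kap (boxed_eq0 Hb z2) mulr0 normr0 !mulr0.
  by apply: ler_wpM2r => //; exact: hs.
have := Lp_pow_kernel z ltr01 (ltW s0) (ltW s0) Hb Hb.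
rewrite powRr1// => h; apply: (le_trans (lee_wpmul2l _ h)); first by rewrite lee_fin ltW.
rewrite -EFinM lee_fin ger0_norm ?divr_ge0 ?(ltW s0)//.
have -> : e' * (K / s * (K / s) * (4 * s * s)) = e * (4 * K ^+ 2 / (4 * K ^+ 2 + 1)).
  by rewrite /e'; field; rewrite !gt_eqF.
by rewrite ler_piMr ?(ltW e0)// ler_pdivrMr// mul1r lerDl.
Qed.

End Density.

(** * Passage to the limit *)

Section DivCurl.
Variable R : realType.
Local Notation T2 := (measurableTypeR R * measurableTypeR R)%type.
Local Notation mu := (leb2 R).
Variables (p q : R).
Hypotheses (p1 : 1 < p) (pq : p^-1 + q^-1 = 1).
Let p0 : 0 < p := lt_trans ltr01 p1.
Let q1 : 1 < q := conjugate_gt1 p1 pq.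
Let q0 : 0 < q := lt_trans ltr01 q1.

Lemma integrable_mul_bounded (U V psi : T2 -> R) (M : R) : in_Lp p U -> in_Lp q V ->
  measurable_fun setT psi -> (forall z, `|psi z| <= M) ->
  mu.-integrable setT (fun z => (U z * V z * psi z)%:E).
Proof.
move=> LU LV mpsi psiM.
have := integrable_mul p1 pq LU (in_Lp_bounded_mul q1 LV mpsi psiM).
by apply: eq_integrable => // z _; rewrite mulrA.
Qed.

Lemma normr_integral_mul_le (U V psi : T2 -> R) (M C : R) : in_Lp p U -> in_Lp q V ->
  measurable_fun setT psi -> (forall z, `|psi z| <= M) ->
  (Lp_pow p U <= C%:E)%E -> (Lp_pow q V <= C%:E)%E ->
  `|\int[mu]_z (U z * V z * psi z)| <= M * (C + C).
Proof.
move=> LU LV mpsi psiM UC VC.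
have mU := in_Lp_measurable p0 LU; have mV := in_Lp_measurable q0 LV.
have M0 : 0 <= M by exact: (le_trans _ (psiM (0, 0))).
have mUV : measurable_fun setT (fun z => U z * V z) by exact: measurable_funM.
apply: normr_Rintegral_le; first exact: measurable_funM.
apply: (le_trans (le_integral_weight mUV mpsi psiM)).
rewrite [leRHS]EFinM; apply: lee_wpmul2l; first by rewrite lee_fin.
apply: (le_trans (le_integral_mul p1 pq mU mV)).
rewrite [leRHS]EFinD; exact: (leeD UC VC).
Qed.

Lemma Rintegral_moll_split (U V psi : T2 -> R) (M s e : R) :
  0 < s -> 0 < e -> in_Lp p U -> in_Lp q V ->
  measurable_fun setT psi -> (forall z, `|psi z| <= M) ->
  \int[mu]_z (U z * V z * psi z) =
  \int[mu]_z (U z * (V z - conv V (moll s) (moll s) z) * psi z) +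
  \int[mu]_z (U z * (conv V (moll s) (moll s) z - conv V (moll e) (moll e) z) * psi z) +
  \int[mu]_z (U z * conv V (moll e) (moll e) z * psi z).
Proof.
move=> s0 e0 LU LV mpsi psiM.
have i1 := integrable_mul_bounded LU LV mpsi psiM.
have i2 := integrable_conv_test1_mul p1 pq (test1_moll s0) (test1_moll s0) LU LV mpsi psiM.
have i3 := integrable_conv_test1_mul p1 pq (test1_moll e0) (test1_moll e0) LU LV mpsi psiM.
have alg (a b c x : R) : a * (b - c) * x = a * b * x - a * c * x by ring.
have E1 : \int[mu]_z (U z * (V z - conv V (moll s) (moll s) z) * psi z) =
    \int[mu]_z (U z * V z * psi z) -
    \int[mu]_z (U z * conv V (moll s) (moll s) z * psi z).
  rewrite -(RintegralB measurableT i1 i2); apply: eq_Rintegral => z _; exact: alg.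
have E2 : \int[mu]_z (U z * (conv V (moll s) (moll s) z - conv V (moll e) (moll e) z) * psi z) =
    \int[mu]_z (U z * conv V (moll s) (moll s) z * psi z) -
    \int[mu]_z (U z * conv V (moll e) (moll e) z * psi z).
  rewrite -(RintegralB measurableT i2 i3); apply: eq_Rintegral => z _; exact: alg.
have telescope (x y w a b : R) : a = x - y -> b = y - w -> x = a + b + w.
  by move=> -> ->; ring.
exact: (telescope _ _ _ _ _ E1 E2).
Qed.

Variables (u1 u2 v1 v2 d g : nat -> T2 -> R) (C : R).
Hypotheses (C0 : 0 <= C) (wv1 : weak_cvg0 q v1) (wv2 : weak_cvg0 q v2).
Hypotheses (Lu1 : forall n, in_Lp p (u1 n)) (Lu2 : forall n, in_Lp p (u2 n))
  (Ld : forall n, in_Lp p (d n)) (Lg : forall n, in_Lp q (g n)).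
Hypotheses (u1C : forall n, (Lp_pow p (u1 n) <= C%:E)%E)
  (u2C : forall n, (Lp_pow p (u2 n) <= C%:E)%E)
  (dC : forall n, (Lp_pow p (d n) <= C%:E)%E)
  (v1C : forall n, (Lp_pow q (v1 n) <= C%:E)%E)
  (v2C : forall n, (Lp_pow q (v2 n) <= C%:E)%E)
  (gC : forall n, (Lp_pow q (g n) <= C%:E)%E).
Hypothesis div_eq : forall n (psi : R * R -> R), test_function psi ->
  - (\int[mu]_z (u1 n z * dx psi z)) + - (\int[mu]_z (u2 n z * dy psi z)) =
  \int[mu]_z (d n z * psi z).
Hypothesis curl_eq : forall n (psi : R * R -> R), test_function psi ->
  - (\int[mu]_z (v1 n z * dy psi z)) - - (\int[mu]_z (v2 n z * dx psi z)) =
  \int[mu]_z (g n z * psi z).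
Let Lv1 n : in_Lp q (v1 n) := wv1.1 n.
Let Lv2 n : in_Lp q (v2 n) := wv2.1 n.

Let sum6_le (e x1 x2 a1 a2 b1 b2 c1 c2 : R) :
  x1 = a1 + b1 + c1 -> x2 = a2 + b2 + c2 -> `|a1| <= e / 8 -> `|a2| <= e / 8 ->
  `|b1 + b2| <= e / 2 -> `|c1| <= e / 8 -> `|c2| <= e / 8 ->
  `|x1 + x2| <= e.
Proof.
move=> -> ->; rewrite !ler_norml => /andP[? ?] /andP[? ?] /andP[? ?] /andP[? ?] /andP[? ?].
by apply/andP; split; lra.
Qed.

(** The order of choices matters: the coarse scale eps depends on e alone, then n is taken large for
    this scale, and the fine scale 1/(k+1) is chosen last, depending on n. *)
Lemma div_curl_test_function (phi : R * R -> R) (e : R) : test_function phi -> 0 < e ->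
  exists n0, forall n, (n0 <= n)%N ->
  `|\int[mu]_z (u1 n z * v1 n z * phi z) + \int[mu]_z (u2 n z * v2 n z * phi z)| <= e.
Proof.
move=> tphi e0.
have [M [r [M0 r0 phiMr dxM dyM]]] := test_function_derivatives_bounded tphi.
have phiM z : `|phi z| <= M.
  by apply: (le_trans (phiMr z)); rewrite ler_piMr// cutoff_le1.
have mphi : measurable_fun setT (phi : T2 -> R).
  by apply: measurable_continuous2; have [/(_ 0%N)[]] := tphi.
have [K K0 HK] := boxed_moll R.
(* 64 is 8 (terms) times 4 (area of a box) times 2 (the two powers in Young's inequality); the 1
   keeps D positive. *)
pose D := 64 * M * K * C + 1.
have D0 : 0 < D by rewrite ltr_wpDl// !mulr_ge0.
pose eps := e / (2 * D).
have eps0 : 0 < eps by rewrite divr_gt0// mulr_gt0.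
have e8 : 0 < e / 8 by rewrite divr_gt0.
have epsE : 8 * (M * (4 * K * eps) * (C + C)) <= e / 2.
  have -> : 8 * (M * (4 * K * eps) * (C + C)) = e / 2 * ((64 * M * K * C) / D).
    by rewrite /eps; field; rewrite gt_eqF.
  rewrite ler_piMr ?(ltW (divr_gt0 e0 _))//.
  by rewrite ler_pdivrMr// mul1r /D lerDl.
have ce := test1_moll eps0.
have [n1 hn1] := conv_weak_small p1 pq ce ce r0 C0 Lu1 u1C wv1 v1C mphi phiMr e8.
have [n2 hn2] := conv_weak_small p1 pq ce ce r0 C0 Lu2 u2C wv2 v2C mphi phiMr e8.
exists (maxn n1 n2) => n; rewrite geq_max => /andP[/hn1 c1 /hn2 c2].
have [k1 hk1] := moll_approx p1 pq r0 M0 (Lu1 n) (Lv1 n) mphi phiMr e8.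
have [k2 hk2] := moll_approx p1 pq r0 M0 (Lu2 n) (Lv2 n) mphi phiMr e8.
(* The last entry ensures 1/(k+1) <= eps, as the comparison of scales requires. *)
pose k := maxn (maxn k1 k2) (Num.truncn eps^-1).
have a1 := hk1 k (leq_trans (leq_maxl _ _) (leq_maxl _ _)).
have a2 := hk2 k (leq_trans (leq_maxr _ _) (leq_maxl _ _)).
have s0 : 0 < k.+1%:R^-1 :> R by rewrite invr_gt0.
have se : k.+1%:R^-1 <= eps.
  rewrite -[eps]invrK lef_pV2 ?posrE ?invr_gt0//.
  apply: (le_trans (ltW (truncnS_gt _))).
  by rewrite ler_nat ltnS leq_maxr.
have b := div_curl_estimate p1 pq (Lu1 n) (Lu2 n) (Ld n) (Lv1 n) (Lv2 n) (Lg n)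
  (@div_eq n) (@curl_eq n) tphi phiM dxM dyM (u1C n) (u2C n) (dC n) (v1C n) (v2C n)
  (gC n) K0 HK s0 se.
have E1 := Rintegral_moll_split s0 eps0 (Lu1 n) (Lv1 n) mphi phiM.
have E2 := Rintegral_moll_split s0 eps0 (Lu2 n) (Lv2 n) mphi phiM.
exact: (sum6_le E1 E2 a1 a2 (le_trans b epsE) c1 c2).
Qed.

Lemma div_curl_continuous (phi : R * R -> R) (e : R) :
  continuous phi -> compactly_supported phi -> 0 < e ->
  exists n0, forall n, (n0 <= n)%N ->
  `|\int[mu]_z ((u1 n z * v1 n z + u2 n z * v2 n z) * phi z)| <= e.
Proof.
move=> cphi kphi e0.
(* Replacing phi by psi costs e' (C + C) in each of the two products, 4 C e' in total. *)
pose e' := e / 2 / (4 * C + 1).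
have D0 : 0 < 4 * C + 1 by rewrite ltr_wpDl// mulr_ge0.
have e'0 : 0 < e' by rewrite !divr_gt0.
have [psi tpsi near_psi] := test_function_dense cphi kphi e'0.
have [n0 hn0] := div_curl_test_function tpsi (divr_gt0 e0 (ltr0n _ 2)).
exists n0 => n /hn0.
have [M _ phiM] := compactly_supported_norm_le cphi kphi.
have mphi : measurable_fun setT (phi : T2 -> R) by exact: measurable_continuous2.
have cpsi : continuous psi by have [/(_ 0%N)[]] := tpsi.
have [M' _ psiM] := compactly_supported_norm_le cpsi tpsi.2.
have mpsi : measurable_fun setT (psi : T2 -> R) by exact: measurable_continuous2.
pose del z := phi z - psi z.
have mdel : measurable_fun setT (del : T2 -> R) by exact: measurable_funB.
have i1 := integrable_mul_bounded (Lu1 n) (Lv1 n) mphi phiM.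
have i2 := integrable_mul_bounded (Lu2 n) (Lv2 n) mphi phiM.
have split (U V : T2 -> R) : in_Lp p U -> in_Lp q V ->
    \int[mu]_z (U z * V z * phi z) =
    \int[mu]_z (U z * V z * psi z) + \int[mu]_z (U z * V z * del z).
  move=> LU LV; rewrite -RintegralD//.
  - by apply: eq_Rintegral => z _; rewrite -mulrDr /del addrC subrK.
  - exact: (integrable_mul_bounded LU LV mpsi psiM).
  - exact: (integrable_mul_bounded LU LV mdel near_psi).
have d1 := normr_integral_mul_le (Lu1 n) (Lv1 n) mdel near_psi (u1C n) (v1C n).
have d2 := normr_integral_mul_le (Lu2 n) (Lv2 n) mdel near_psi (u2C n) (v2C n).
have -> : \int[mu]_z ((u1 n z * v1 n z + u2 n z * v2 n z) * phi z) =
    \int[mu]_z (u1 n z * v1 n z * phi z) + \int[mu]_z (u2 n z * v2 n z * phi z).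
  rewrite -(RintegralD measurableT i1 i2).
  by apply: eq_Rintegral => z _; rewrite mulrDl.
rewrite (split _ _ (Lu1 n) (Lv1 n)) (split _ _ (Lu2 n) (Lv2 n)) addrACA => h.
apply: (le_trans (ler_normD _ _)).
have h' := le_trans (ler_normD _ _) (lerD d1 d2).
apply: (le_trans (lerD h h')).
have -> : e' * (C + C) + e' * (C + C) = e / 2 * (4 * C / (4 * C + 1)).
  by rewrite /e'; field; rewrite gt_eqF.
rewrite [leRHS]splitr lerD2l ler_piMr ?divr_ge0 ?(ltW e0)//.
by rewrite ler_pdivrMr// mul1r lerDl.
Qed.

End DivCurl.

Lemma Lp_pow_le (R : realType) (p M : R) (f : R * R -> R) : 0 < p -> in_Lp p f ->
  (Lp_norm p f <= M%:E)%E -> (Lp_pow p f <= (`|M| `^ p)%:E)%E.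
Proof.
move=> p0 Lf; rewrite (Lp_normrE p0 Lf) (Lp_pow_normr p0 Lf) !lee_fin => h.
apply: ge0_ler_powR; rewrite ?nnegrE ?Lp_normr_ge0 ?(ltW p0)//.
exact: le_trans h (ler_norm M).
Qed.

Theorem theorem15 (R : realType) (p p' : R) (u v : nat -> R * R -> R * R)
  (p_gt1 : 1 < p) (pp' : p^-1 + p'^-1 = 1)
  (u_weak : weak_cvg0_vec p u) (v_weak : weak_cvg0_vec p' v)
  (div_bounded : bounded_in_Lp p (fun n => distr_div (u n)))
  (curl_bounded : bounded_in_Lp p' (fun n => distr_curl (v n))) :
  let uv n z := (u n z).1 * (v n z).1 + (u n z).2 * (v n z).2 in
  distr_cvg0 (fun n => of_fun (uv n)) /\ vague_cvg0 (fun n => of_fun (uv n)).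
Proof.
move=> uv.
have p'_gt1 := conjugate_gt1 p_gt1 pp'.
have p_gt0 := lt_trans ltr01 p_gt1; have p'_gt0 := lt_trans ltr01 p'_gt1.
have [wu1 wu2] := u_weak; have [wv1 wv2] := v_weak.
have [C1 C10 hC1] := weak_cvg0_bounded p_gt1 wu1.
have [C2 C20 hC2] := weak_cvg0_bounded p_gt1 wu2.
have [C3 C30 hC3] := weak_cvg0_bounded p'_gt1 wv1.
have [C4 C40 hC4] := weak_cvg0_bounded p'_gt1 wv2.
have [M5 [d hd]] := div_bounded; have [M6 [g hg]] := curl_bounded.
have Ld n : in_Lp p (d n) by have [] := hd n.
have Lg n : in_Lp p' (g n) by have [] := hg n.
have hC5 n : (Lp_pow p (d n) <= (`|M5| `^ p)%:E)%E.
  by apply: Lp_pow_le => //; have [] := hd n.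
have hC6 n : (Lp_pow p' (g n) <= (`|M6| `^ p')%:E)%E.
  by apply: Lp_pow_le => //; have [] := hg n.
have hd' n (psi : R * R -> R) : test_function psi -> _ :=
  fun t => (let: And3 _ _ h := hd n in h) psi t.
have hg' n (psi : R * R -> R) : test_function psi -> _ :=
  fun t => (let: And3 _ _ h := hg n in h) psi t.
move: (powR_ge0 `|M5| p) (powR_ge0 `|M6| p') hC5 hC6.
move: (`|M5| `^ p) (`|M6| `^ p') => C5 C6 C50 C60 hC5 hC6.
(* A common bound for the six sequences: four from weak convergence, two from the divergence and
   curl hypotheses. *)
pose C := C1 + C2 + C3 + C4 + C5 + C6.
have C0 : 0 <= C by rewrite !addr_ge0.
have weaken (c : R) (x : nat -> \bar R) : c <= C ->
    (forall n, (x n <= c%:E)%E) -> forall n, (x n <= C%:E)%E.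
  by move=> cC h n; apply: (le_trans (h n)); rewrite lee_fin.
have vague : vague_cvg0 (fun n => of_fun (uv n)).
  move=> phi cphi kphi; apply/cvgrPdist_le => e e0.
  have [n0 hn0] := div_curl_continuous p_gt1 pp' C0 wv1 wv2 wu1.1 wu2.1 Ld Lg
    (weaken C1 _ ltac:(rewrite /C; lra) hC1) (weaken C2 _ ltac:(rewrite /C; lra) hC2)
    (weaken C5 _ ltac:(rewrite /C; lra) hC5) (weaken C3 _ ltac:(rewrite /C; lra) hC3)
    (weaken C4 _ ltac:(rewrite /C; lra) hC4) (weaken C6 _ ltac:(rewrite /C; lra) hC6)
    hd' hg' cphi kphi e0.
  by exists n0 => // n /= /hn0; rewrite sub0r normrN.
(* Test functions are continuous with compact support, so distributional convergence is a special
   case of the vague one. *)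
split=> // phi [sphi kphi]; apply: vague => //.
by have [] := sphi 0%N.
Qed.
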